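(* (1) Let $(D;Q,Q;M)$ be an involutive double vector bundle with involution $\mathcal I$ and core $B^*$. Then the dual $\mathbb E:=D^*_{\pi_1}$, a double vector bundle with sides $Q$ and $B$ over $M$, inherits a linear metric $\mathbb E\times_B\mathbb E\to\mathbb R$ defined by $$\langle e_1,e_2\rangle_{\mathbb E}=\langle e_1,d\rangle_Q+\langle e_2,\mathcal I(d)\rangle_Q$$ for $(e_1,e_2)\in\mathbb E\times_B\mathbb E$ and any $d\in D$ with $\pi_Q(e_1)=\pi_1(d)$ and $\pi_Q(e_2)=\pi_2(d)$. (2) Conversely, let $(\mathbb E;Q,B;M)$ be a metric double vector bundle with core $Q^*$. Then the dual $D=\mathbb E^*_Q$, with sides $\pi_1\colon\mathbb E^*_Q\to Q$, $\pi_2\colon\mathbb E^*_Q\to Q^{**}\simeq Q$ and with core $B^*$, is an involutive double vector bundle with $\mathcal I\colon D\to D$ defined by $$\langle\mathcal I(d),e\rangle_Q=\langle\!\langle e,d\rangle\!\rangle$$ for $d\in D$ and $e\in\mathbb E\simeq\mathbb E^*_B$ with $\pi_2(d)=\pi_Q(e)$. (3) The constructions in (1) and (2) are inverse to each other.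
   Context: All objects are smooth and real. A double vector bundle $(D;A,B;M)$ is a manifold $D$ with two vector bundle structures $\pi_A\colon D\to A$, $\pi_B\colon D\to B$ over the total spaces of vector bundles $q_A\colon A\to M$, $q_B\colon B\to M$, with $q_A\pi_A=q_B\pi_B$, such that the projection, addition and scalar multiplication of each structure are vector bundle morphisms for the other one. Its core is the vector bundle $C=\ker\pi_A\cap\ker\pi_B$ over $M$, with inclusion $c\mapsto\overline c$. The dual $D^*_A$ of $D\to A$ is a double vector bundle with sides $A$ and $C^*$ and core $B^*$: $\pi_{C^*}(\Phi)(c_m)=\Phi(0^D_{a_m}+_B\overline{c_m})$ for $\Phi$ over $a_m\in A$; $(\Phi_1+_{C^*}\Phi_2)(d_1+_Bd_2)=\Phi_1(d_1)+\Phi_2(d_2)$; and $\overline{\beta_m}(d)=\beta_m(\pi_B(d))$ for $\beta_m\in B_m^*$ and $d$ with $\pi_A(d)=0^A_m$. The pairing $\langle\!\langle\cdot,\cdot\rangle\!\rangle\colon D^*_A\times_{C^*}D^*_B\to\mathbb R$ is $\langle\!\langle\Phi,\Psi\rangle\!\rangle=\langle\Phi,d\rangle_A-\langle\Psi,d\rangle_B$ for any $d\in D$ with $\pi_A(d)=\pi_A(\Phi)$, $\pi_B(d)=\pi_B(\Psi)$ (independent of $d$). In (2) it is applied to $\mathbb E^*_B\times_{Q}\mathbb E^*_Q$, so that $\langle\!\langle e,d\rangle\!\rangle=\langle e,x\rangle_{\mathbb E}-\langle d,x\rangle_Q$ for any $x\in\mathbb E$ with $\pi_B(x)=\pi_B(e)$,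 $\pi_Q(x)=\pi_1(d)$. An involutive double vector bundle is a double vector bundle $(D;Q,Q;M)$ with projections $\pi_1,\pi_2\colon D\to Q$ and core $B^*$, with a morphism of double vector bundles $\mathcal I\colon D\to D$ (a vector bundle morphism from $\pi_1$ to $\pi_2$ and from $\pi_2$ to $\pi_1$, over $\mathrm{Id}_Q$) with $\mathcal I^2=\mathrm{Id}_D$, $\pi_1\circ\mathcal I=\pi_2$, $\pi_2\circ\mathcal I=\pi_1$ and core morphism $-\mathrm{Id}_{B^*}$. A metric double vector bundle is a double vector bundle $(\mathbb E;Q,B;M)$ with a linear metric, i.e. a symmetric nondegenerate (fibrewise bilinear) pairing $\mathbb E\times_B\mathbb E\to\mathbb R$ on $\mathbb E\to B$ that is linear over $Q$: the induced map $\boldsymbol\beta\colon\mathbb E\to\mathbb E^*_B$ is an isomorphism of double vector bundles (over $\mathrm{Id}_B$); equivalently $\langle e_1+_Qe_2,f_1+_Qf_2\rangle=\langle e_1,f_1\rangle+\langle e_2,f_2\rangle$ whenever the sums are defined and $\pi_B(e_i)=\pi_B(f_i)$. The core of $\mathbb E$ is then isomorphic to $Q^*$ and always identified with $Q^*$ via the pairing: $\langle e,0^{\mathbb E}_{b}+_Q\overline\tau\rangle=\langle\pi_Q(e),\tau\rangle$ for $\pi_B(e)=b$. The isomorphism $\mathbb E\simeq\mathbb E^*_B$ is $\boldsymbol\beta$. *)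

(* Defs.v *)
From HB Require Import structures.
From mathcomp Require Import all_boot all_order all_algebra.
From mathcomp Require Import all_classical all_reals all_analysis.

Set Implicit Arguments.
Unset Strict Implicit.
Unset Printing Implicit Defensive.

Import Order.TTheory GRing.Theory Num.Theory.
Import numFieldNormedType.Exports.

Local Open Scope classical_set_scope.
Local Open Scope ring_scope.

(* Conventions.  The structures [premfd], [vbstr], [prevb] and [predvb] carry
   only data; the axioms are the predicates [is_manifold], [is_vb], [is_dvb].
   In this way the dual of a double vector bundle is a plain construction, and
   that it is again a double vector bundle is something to be proved.
   The operations of a bundle are total functions, of which only the values on
   elements of a common fibre are meaningful. *)

Definition choose_or (T : Type) (x0 : T) (P : set T) : T :=
  match pselect (exists x, P x) with
  | left ex => projT1 (cid ex)
  | right _ => x0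
  end.

Section Manifolds.
Variable R : realType.

Fixpoint Ck (k n m : nat) (U : set 'rV[R]_n) (f : 'rV[R]_n -> 'rV[R]_m) : Prop :=
  match k with
  | 0%N => forall x, U x -> {for x, continuous f}
  | k'.+1 => (forall x, U x -> differentiable f x) /\
             (forall v, Ck k' U (fun x => 'D_v f x))
  end.

(* Used on open sets [U] only. *)
Definition smooth_on n m (U : set 'rV[R]_n) (f : 'rV[R]_n -> 'rV[R]_m) : Prop :=
  forall k, Ck k U f.

(* A manifold is a set with an atlas, which also determines its topology.  The
   dimension is part of the chart, so it is only locally constant; likewise the
   rank of a vector bundle below. *)
Record chart (X : Type) := Chart {
  cdim : nat;
  cdom : set X;
  cmap : X -> 'rV[R]_cdim }.

Record premfd := PreMfd { carrier :> Type; atlas : set (chart carrier) }.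
Arguments atlas : clear implicits.

Definition mopen (X : premfd) (O : set X) : Prop :=
  forall c, atlas X c -> open (cmap c @` (cdom c `&` O)).

Definition chart_compat (X : Type) (c c' : chart X) : Prop :=
  open (cmap c @` (cdom c `&` cdom c')) /\
  exists g : 'rV[R]_(cdim c) -> 'rV[R]_(cdim c'),
    smooth_on (cmap c @` (cdom c `&` cdom c')) g /\
    forall x, cdom c x -> cdom c' x -> cmap c' x = g (cmap c x).

Record is_manifold (X : premfd) : Prop := IsManifold {
  mfd_inj : forall c, atlas X c -> forall x y, cdom c x -> cdom c y ->
    cmap c x = cmap c y -> x = y;
  mfd_compat : forall c c', atlas X c -> atlas X c' -> chart_compat c c';
  mfd_cover : forall x : X, exists c, atlas X c /\ cdom c x;
  mfd_hausdorff : forall x y : X, x <> y -> exists O O' : set X,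
    [/\ mopen O, mopen O', O x, O' y & O `&` O' = set0];
  mfd_second_countable : exists W : nat -> set X,
    (forall n, mopen (W n)) /\
    forall O, mopen O -> forall x, O x -> exists n, W n x /\ W n `<=` O }.

(* Smoothness in a neighbourhood of x. *)
Definition smooth_at (X Y : premfd) (f : X -> Y) (x : X) : Prop :=
  exists (c : chart X) (c' : chart Y) (O : set 'rV[R]_(cdim c))
         (g : 'rV[R]_(cdim c) -> 'rV[R]_(cdim c')),
    [/\ atlas X c /\ cdom c x, atlas Y c' /\ cdom c' (f x),
        open O /\ O (cmap c x), smooth_on O g &
        forall y, cdom c y -> O (cmap c y) ->
          cdom c' (f y) /\ cmap c' (f y) = g (cmap c y)].

Definition smooth (X Y : premfd) (f : X -> Y) : Prop := forall x, smooth_at f x.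

Definition euclid (n : nat) : premfd :=
  @PreMfd 'rV[R]_n [set @Chart 'rV[R]_n n setT id].

Definition prod_chart (X Y : Type) (c : chart X) (c' : chart Y) : chart (X * Y) :=
  @Chart (X * Y) (cdim c + cdim c') [set p | cdom c p.1 /\ cdom c' p.2]
    (fun p => row_mx (cmap c p.1) (cmap c' p.2)).

Definition prod_mfd (X Y : premfd) : premfd :=
  @PreMfd (X * Y) [set prod_chart c c' | c in atlas X & c' in atlas Y].

End Manifolds.

Arguments atlas {R} _ _.

Section VectorBundles.
Variable R : realType.

Record vbstr (E M : Type) := VbStr {
  vproj : E -> M;
  vzero : M -> E;
  vadd : E -> E -> E;
  vscale : R -> E -> E }.

Record prevb (M : premfd R) := PreVb {
  vtot :> premfd R;
  vstr :> vbstr vtot M }.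

Definition fibres_are_vector_spaces (E M : Type) (v : vbstr E M) : Prop :=
  [/\ forall m, vproj v (vzero v m) = m,
      forall e f, vproj v e = vproj v f -> vproj v (vadd v e f) = vproj v e &
      forall a e, vproj v (vscale v a e) = vproj v e] /\
  [/\ forall e f, vproj v e = vproj v f -> vadd v e f = vadd v f e,
      forall e f h, vproj v e = vproj v f -> vproj v f = vproj v h ->
        vadd v e (vadd v f h) = vadd v (vadd v e f) h,
      forall e, vadd v (vzero v (vproj v e)) e = e &
      forall e, vadd v (vscale v (-1) e) e = vzero v (vproj v e)] /\
  [/\ forall e, vscale v 1 e = e,
      forall a b e, vscale v a (vscale v b e) = vscale v (a * b) e,
      forall a e f, vproj v e = vproj v f ->
        vscale v a (vadd v e f) = vadd v (vscale v a e) (vscale v a f) &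
      forall a b e, vscale v (a + b) e = vadd v (vscale v a e) (vscale v b e)].

(* (vproj, phi) is a fibrewise linear diffeomorphism from the part of E over
   the open set U onto U x R^n, with inverse psi. *)
Record trivialization (E M : premfd R) (v : vbstr E M) (U : set M) (n : nat)
    (phi : E -> euclid R n) (psi : prod_mfd M (euclid R n) -> E) : Prop :=
  Trivialization {
    triv_open : mopen U;
    triv_smooth : forall e, U (vproj v e) -> smooth_at phi e;
    triv_inv_smooth : forall p, U p.1 -> smooth_at psi p;
    triv_projK : forall p, U p.1 -> vproj v (psi p) = p.1;
    triv_coordK : forall p, U p.1 -> phi (psi p) = p.2;
    triv_invK : forall e, U (vproj v e) -> psi (vproj v e, phi e) = e;
    triv_add : forall e f, U (vproj v e) -> vproj v e = vproj v f ->
      phi (vadd v e f) = (phi e : 'rV[R]_n) + phi f;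
    triv_scale : forall a e, U (vproj v e) ->
      phi (vscale v a e) = a *: (phi e : 'rV[R]_n) }.

Record is_vb (E M : premfd R) (v : vbstr E M) : Prop := IsVb {
  vb_total : is_manifold E;
  vb_base : is_manifold M;
  vb_proj_smooth : smooth (vproj v);
  vb_fibres : fibres_are_vector_spaces v;
  vb_triv : forall m : M, exists (U : set M) (n : nat) (phi : E -> euclid R n)
    (psi : prod_mfd M (euclid R n) -> E), U m /\ trivialization v U phi psi }.

(* F is a morphism of vector bundles over f; that f is smooth follows. *)
Record is_vbmor (E M E' M' : premfd R) (v : vbstr E M) (v' : vbstr E' M')
    (F : E -> E') (f : M -> M') : Prop := IsVbMor {
  vbmor_smooth : smooth F;
  vbmor_proj : forall e, vproj v' (F e) = f (vproj v e);
  vbmor_add : forall e e', vproj v e = vproj v e' ->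
    F (vadd v e e') = vadd v' (F e) (F e');
  vbmor_scale : forall a e, F (vscale v a e) = vscale v' a (F e) }.

(* Dual vector bundle.  A covector at m is a linear form on the fibre over m,
   represented by its extension by 0 to the total space, so that equality of
   covectors is equality of the forms. *)
Definition linear_over (E M : Type) (v : vbstr E M) (m : M) (f : E -> R) : Prop :=
  forall a e e', vproj v e = m -> vproj v e' = m ->
    f (vadd v (vscale v a e) e') = a * f e + f e'.

Record covector (E M : Type) (v : vbstr E M) := Covector {
  cobase : M;
  coform :> E -> R;
  coform_linear : linear_over v cobase coform;
  coform_off : forall e, vproj v e <> cobase -> coform e = 0 }.

Definition restrict_to (E M : Type) (v : vbstr E M) (m : M) (f : E -> R) : E -> R :=
  fun e => if pselect (vproj v e = m) then f e else 0.

Lemma restrict_to_off (E M : Type) (v : vbstr E M) (m : M) (f : E -> R) e :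
  vproj v e <> m -> restrict_to v m f e = 0.
Proof. by rewrite /restrict_to; case: pselect. Qed.

Lemma zero_linear_over (E M : Type) (v : vbstr E M) (m : M) :
  linear_over v m (fun=> 0).
Proof. by move=> a e e' _ _; rewrite mulr0 addr0. Qed.

(* The covector at m given by the restriction of f to the fibre over m (the zero
   covector if this restriction is not linear). *)
Definition mkcovector (E M : Type) (v : vbstr E M) (m : M) (f : E -> R) : covector v :=
  match pselect (linear_over v m (restrict_to v m f)) with
  | left lin => Covector lin (@restrict_to_off E M v m f)
  | right _ => Covector (@zero_linear_over E M v m) (fun _ _ => erefl)
  end.

(* The chart of the dual bundle induced by a chart of the base and a
   trivialization: a covector is sent to the coordinates of its base point and
   its values on the frame of the trivialization. *)
Definition dual_chart (E M : premfd R) (v : vbstr E M) (c : chart R M) (U : set M)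
    (n : nat) (psi : prod_mfd M (euclid R n) -> E) : chart R (covector v) :=
  @Chart R (covector v) (cdim c + n)
    [set Phi | cdom c (cobase Phi) /\ U (cobase Phi)]
    (fun Phi => row_mx (cmap c (cobase Phi))
                  (\row_i Phi (psi (cobase Phi, delta_mx 0 i)))).

Definition dual_mfd (E M : premfd R) (v : vbstr E M) : premfd R :=
  @PreMfd R (covector v) [set c' | exists (c : chart R M) (U : set M) (n : nat)
    (phi : E -> euclid R n) (psi : prod_mfd M (euclid R n) -> E),
    [/\ atlas M c, trivialization v U phi psi & c' = dual_chart v c U psi]].

Definition dual_str (E M : premfd R) (v : vbstr E M) : vbstr (dual_mfd v) M :=
  @VbStr (dual_mfd v) M
    (@cobase E M v)
    (fun m => mkcovector v m (fun=> 0))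
    (fun Phi Psi => mkcovector v (cobase Phi) (fun e => Phi e + Psi e))
    (fun a Phi => mkcovector v (cobase Phi) (fun e => a * Phi e)).

Definition dual_vb (M : premfd R) (q : prevb M) : prevb M :=
  PreVb (dual_str q).

Definition ev (E M : premfd R) (v : vbstr E M) (e : E) : dual_mfd (dual_str v) :=
  mkcovector (dual_str v) (vproj v e) (fun Phi : dual_mfd v => coform Phi e).

End VectorBundles.

Section DoubleVectorBundles.
Variables (R : realType) (M : premfd R).

(* (D; A, B; M) with core K^*, the inclusion of the core being [dbar].  Writing
   the core as a dual is no restriction, as C = (C^* )^*. *)
Record predvb (A B K : prevb M) := PreDvb {
  dtot :> premfd R;
  dstr1 : vbstr R dtot A;
  dstr2 : vbstr R dtot B;
  dbar : dual_vb K -> dtot }.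

Definition flip (A B K : prevb M) (D : predvb A B K) : predvb B A K :=
  PreDvb (dstr2 D) (dstr1 D) (@dbar _ _ _ D).

Record is_core (A B K : prevb M) (D : predvb A B K) : Prop := IsCore {
  core_smooth : smooth (@dbar _ _ _ D);
  core_proj1 : forall k : dual_vb K,
    vproj (dstr1 D) (dbar D k) = vzero A (cobase k);
  core_proj2 : forall k : dual_vb K,
    vproj (dstr2 D) (dbar D k) = vzero B (cobase k);
  core_add : forall k l : dual_vb K, cobase k = cobase l ->
    dbar D (vadd (dual_vb K) k l) = vadd (dstr1 D) (dbar D k) (dbar D l) /\
    dbar D (vadd (dual_vb K) k l) = vadd (dstr2 D) (dbar D k) (dbar D l);
  core_scale : forall a (k : dual_vb K),
    dbar D (vscale (dual_vb K) a k) = vscale (dstr1 D) a (dbar D k) /\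
    dbar D (vscale (dual_vb K) a k) = vscale (dstr2 D) a (dbar D k);
  core_inj : injective (@dbar _ _ _ D);
  core_surj : forall (d : D) (m : M),
    vproj (dstr1 D) d = vzero A m -> vproj (dstr2 D) d = vzero B m ->
    exists k : dual_vb K, dbar D k = d }.

(* Projections and scalar multiplications of each structure are vector bundle
   morphisms for the other one.  That the additions are morphisms means, besides
   smoothness (automatic from local triviality), compatibility with the
   projections and scalar multiplications, contained in the above, and the
   interchange law. *)
Record is_dvb (A B K : prevb M) (D : predvb A B K) : Prop := IsDvb {
  dvb_A : is_vb A;
  dvb_B : is_vb B;
  dvb_K : is_vb K;
  dvb_1 : is_vb (dstr1 D);
  dvb_2 : is_vb (dstr2 D);
  dvb_commutes : forall d : D,
    vproj A (vproj (dstr1 D) d) = vproj B (vproj (dstr2 D) d);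
  dvb_proj1 : is_vbmor (dstr2 D) A (vproj (dstr1 D)) (vproj B);
  dvb_proj2 : is_vbmor (dstr1 D) B (vproj (dstr2 D)) (vproj A);
  dvb_scale1 : forall a,
    is_vbmor (dstr2 D) (dstr2 D) (vscale (dstr1 D) a) (vscale B a);
  dvb_scale2 : forall a,
    is_vbmor (dstr1 D) (dstr1 D) (vscale (dstr2 D) a) (vscale A a);
  dvb_interchange : forall d1 d2 d3 d4 : D,
    vproj (dstr1 D) d1 = vproj (dstr1 D) d2 ->
    vproj (dstr1 D) d3 = vproj (dstr1 D) d4 ->
    vproj (dstr2 D) d1 = vproj (dstr2 D) d3 ->
    vproj (dstr2 D) d2 = vproj (dstr2 D) d4 ->
    vadd (dstr2 D) (vadd (dstr1 D) d1 d2) (vadd (dstr1 D) d3 d4) =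
    vadd (dstr1 D) (vadd (dstr2 D) d1 d3) (vadd (dstr2 D) d2 d4);
  dvb_core : is_core D }.

(* Isomorphism of double vector bundles over the identities of both sides and
   inducing the identity on the core. *)
Definition is_dvb_iso (A B K : prevb M) (D D' : predvb A B K) (F : D -> D') : Prop :=
  [/\ is_vbmor (dstr1 D) (dstr1 D') F id,
      is_vbmor (dstr2 D) (dstr2 D') F id,
      forall k : dual_vb K, F (dbar D k) = dbar D' k &
      exists G : D' -> D, [/\ smooth G, cancel F G & cancel G F]].

(* The dual of D over A, with sides A and K = (K^* )^* and core B^*.  The
   operations over K are characterized by
     kappa (dual_proj2 Phi) = Phi (0^D_a +_B kappa-bar),
     (Phi1 +_K Phi2) (d1 +_B d2) = Phi1 d1 + Phi2 d2,
     (s ._K Phi) (s ._B d) = s * Phi d. *)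
Section Dual.
Variables (A B K : prevb M) (D : predvb A B K).

Local Notation D1 := (dstr1 D).
Local Notation D2 := (dstr2 D).
Local Notation Dstar := (dual_mfd (dstr1 D)).

Definition dual_proj2 (Phi : Dstar) : K :=
  let m := vproj A (cobase Phi) in
  choose_or (vzero K m)
    [set k : K | vproj K k = m /\
      forall kappa : dual_vb K, cobase kappa = m ->
        coform kappa k = coform Phi (vadd D2 (vzero D1 (cobase Phi)) (dbar D kappa))].

Definition dual_zero2 (k : K) : Dstar :=
  let m := vproj K k in
  choose_or (vzero (dual_str D1) (vzero A m))
    [set Psi : Dstar | [/\ cobase Psi = vzero A m,
      forall b : B, vproj B b = m -> coform Psi (vzero D2 b) = 0 &
      forall kappa : dual_vb K, cobase kappa = m ->
        coform Psi (dbar D kappa) = coform kappa k]].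

Definition dual_add2 (Phi1 Phi2 : Dstar) : Dstar :=
  choose_or Phi1
    [set Psi : Dstar | cobase Psi = vadd A (cobase Phi1) (cobase Phi2) /\
      forall d1 d2 : D, vproj D1 d1 = cobase Phi1 -> vproj D1 d2 = cobase Phi2 ->
        vproj D2 d1 = vproj D2 d2 ->
        coform Psi (vadd D2 d1 d2) = coform Phi1 d1 + coform Phi2 d2].

(* The condition on dual_proj2 only matters for s = 0. *)
Definition dual_scale2 (s : R) (Phi : Dstar) : Dstar :=
  choose_or Phi
    [set Psi : Dstar | [/\ cobase Psi = vscale A s (cobase Phi),
      dual_proj2 Psi = dual_proj2 Phi &
      forall d : D, vproj D1 d = cobase Phi ->
        coform Psi (vscale D2 s d) = s * coform Phi d]].

Definition dual_bar (beta : dual_vb B) : Dstar :=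
  mkcovector D1 (vzero A (cobase beta)) (fun d => coform beta (vproj D2 d)).

Definition dual_dvb : predvb A K B :=
  PreDvb (dual_str D1) (VbStr dual_proj2 dual_zero2 dual_add2 dual_scale2) dual_bar.

End Dual.

(* << Phi, Psi >> for Phi in D^*_A and Psi in D^*_B over the same point of K. *)
Definition dual_pairing (A B K : prevb M) (D : predvb A B K)
    (Phi : dual_dvb D) (Psi : dual_dvb (flip D)) : R :=
  choose_or 0
    [set r | exists d : D, [/\ vproj (dstr1 D) d = vproj (dstr1 (dual_dvb D)) Phi,
      vproj (dstr2 D) d = vproj (dstr1 (dual_dvb (flip D))) Psi &
      r = coform Phi d - coform Psi d]].

(* The type of D makes its core B^*. *)
Record is_involution (Q B : prevb M) (D : predvb Q Q B) (I : D -> D) : Prop :=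
  IsInvolution {
    inv_mor12 : is_vbmor (dstr1 D) (dstr2 D) I id;
    inv_mor21 : is_vbmor (dstr2 D) (dstr1 D) I id;
    inv_invol : forall d, I (I d) = d;
    inv_proj1 : forall d, vproj (dstr1 D) (I d) = vproj (dstr2 D) d;
    inv_proj2 : forall d, vproj (dstr2 D) (I d) = vproj (dstr1 D) d;
    inv_core : forall beta : dual_vb B,
      I (dbar D beta) = dbar D (vscale (dual_vb B) (-1) beta) }.

Definition involutive_dvb (Q B : prevb M) (D : predvb Q Q B) (I : D -> D) : Prop :=
  is_dvb D /\ is_involution I.

Definition metric_beta (Q B : prevb M) (E : predvb Q B Q) (g : E -> E -> R)
    (e : E) : dual_dvb (flip E) :=
  mkcovector (dstr2 E) (vproj (dstr2 E) e) (g e).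

(* The core of E is Q^*; [metric_core] says that its inclusion is the one
   obtained from the pairing. *)
Record is_linear_metric (Q B : prevb M) (E : predvb Q B Q) (g : E -> E -> R) : Prop :=
  IsLinearMetric {
    metric_sym : forall e f : E, vproj (dstr2 E) e = vproj (dstr2 E) f -> g e f = g f e;
    metric_lin : forall a (e e' f : E), vproj (dstr2 E) e = vproj (dstr2 E) f ->
      vproj (dstr2 E) e' = vproj (dstr2 E) f ->
      g (vadd (dstr2 E) (vscale (dstr2 E) a e) e') f = a * g e f + g e' f;
    metric_nondeg : forall e : E,
      (forall f : E, vproj (dstr2 E) f = vproj (dstr2 E) e -> g e f = 0) ->
      e = vzero (dstr2 E) (vproj (dstr2 E) e);
    metric_iso : @is_dvb_iso B Q Q (flip E) (dual_dvb (flip E)) (metric_beta g);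
    metric_core : forall (e : E) (tau : dual_vb Q),
      vproj Q (vproj (dstr1 E) e) = cobase tau ->
      g e (vadd (dstr1 E) (vzero (dstr2 E) (vproj (dstr2 E) e)) (dbar E tau)) =
      coform tau (vproj (dstr1 E) e) }.

Definition metric_dvb (Q B : prevb M) (E : predvb Q B Q) (g : E -> E -> R) : Prop :=
  is_dvb E /\ is_linear_metric g.

(* <e1, e2> = <e1, d> + <e2, I d>, on D^*_{pi_1}. *)
Definition metric_of_involution (Q B : prevb M) (D : predvb Q Q B) (I : D -> D)
    (e1 e2 : dual_dvb D) : R :=
  choose_or 0
    [set r | exists d : D, [/\ vproj (dstr1 D) d = vproj (dstr1 (dual_dvb D)) e1,
      vproj (dstr2 D) d = vproj (dstr1 (dual_dvb D)) e2 &
      r = coform e1 d + coform e2 (I d)]].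

(* <I d, e> = << e, d >>, on E^*_Q, where E is identified with E^*_B. *)
Definition involution_of_metric (Q B : prevb M) (E : predvb Q B Q) (g : E -> E -> R)
    (d : dual_dvb E) : dual_dvb E :=
  mkcovector (dstr1 E) (vproj (dstr2 (dual_dvb E)) d)
    (fun e => @dual_pairing B Q Q (flip E) (metric_beta g e) d).

End DoubleVectorBundles.

(* Main.v *)
(** A double vector bundle D with sides A, B and core C over M is locally the
    product of A, B and C.  Indeed, D_b -> A_m is onto at b = 0 (zero section), this is
    an open condition in b, and scaling over A moves b towards 0, so D_b -> A_m is onto
    for every b.  A smooth right inverse of its matrix over a local section b_i of B
    gives a section of D -> A over b_i that is linear over B; the sections obtained from
    a frame of B, together with a frame of C, decompose D.

    In a decomposition (x, y, z) of D, with z in the core, the dual over A has the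
    dual coordinates, with side and core interchanged, and the double dual is the
    identity.  An involution has the form I (x, y, z) = (y, x, w(x, y) - z) and a linear
    metric the form <(x, b, t), (x', b, t')> = t.x' + t'.x + w_b(x, x'), with w
    multilinear and symmetric in x, x'.  A shift of the core coordinate by w/2 makes
    w = 0, and the two constructions exchange the normal forms
    I (x, y, z) = (y, x, -z) and <(x, b, t), (x', b, t')> = t.x' + t'.x. *)

Require Import Defs.
From HB Require Import structures.
From mathcomp Require Import all_boot all_order all_algebra.
From mathcomp Require Import all_classical all_reals all_analysis.
From mathcomp Require Import lra.

Set Implicit Arguments.
Unset Strict Implicit.
Unset Printing Implicit Defensive.

Import Order.TTheory GRing.Theory Num.Theory.
Import numFieldNormedType.Exports.

Local Open Scope classical_set_scope.
Local Open Scope ring_scope.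

(** * Smooth functions on R^n *)

(** The second structure of a dual, the pairing, the metric and the involution are selected by
    choice from a description, and [mkcovector] returns the zero covector unless the given form is
    linear. Nothing can be computed with them before the description is known to have exactly one
    solution. A decomposition provides this: on its domain each description becomes a set of linear
    equations between row vectors. So [dtriv] is the common currency. The axioms of a double vector
    bundle, isomorphisms, involutions and metrics are each recovered from coordinate formulas near
    every point of M, and the dual inherits a decomposition by the dual coordinates. Two points
    shape the details. A dual starts as a bare set with charts, so its smooth calculus must precede
    its Hausdorff and countability properties; hence the weaker notion [premanifold]. And the normal
    forms compare the two sides, or a side and the core, in one and the same frame of Q; hence
    decompositions are built relative to prescribed frames, and only their domain may shrink. *)

Section Calculus.
Variable R : realType.

(** The difference g - f vanishes near x, so it is differentiable at x with differential 0; then g =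
    f + (g - f). *)
Lemma near_eq_differentiable (V W : normedModType R) (f g : V -> W) x :
  (\forall z \near x, f z = g z) -> differentiable f x -> differentiable g x.
Proof.
move=> fg df.
have h0 : differentiable (g \- f) x.
  have H : (g \- f) \o shift x = cst ((g \- f) x) + (\0 : {linear V -> W}) +o_ 0 id.
    apply/eqaddoP => e e0; near=> h => /=.
    have E : f (h + x) = g (h + x).
      near: h; have := fg; rewrite (near_shift 0) /=.
      by apply: filterS => h; rewrite /= subr0.
    have E0 : f x = g x := nbhs_singleton fg.
    rewrite [X in `|X|](_ : _ = 0) ?normr0 ?mulr_ge0// ?ltW//.
    rewrite -[LHS]/((g (h + x) - f (h + x)) - ((g x - f x) + 0)).
    by rewrite E E0 !subrr addr0 subr0.
  have c0 : continuous (\0 : {linear V -> W}) by move=> ?; apply: cvg_cst.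
  apply/diff_locallyP; rewrite (diff_unique c0 H); split => //.
have -> : g = f + (g \- f).
  by apply/funext => z; rewrite /GRing.add /= addrC subrK.
exact: differentiableD.
Unshelve. all: by end_near. Qed.

Lemma near_open (T : topologicalType) (w : T) (P : T -> Prop) :
  (\forall z \near w, P z) -> exists V, [/\ open V, V w & forall z, V z -> P z].
Proof.
move=> nP; have : nbhs w [set z | P z] by [].
by rewrite nbhsE => -[V [oV Vw] VP]; exists V; split.
Qed.

(** Scalar counterpart of [Ck]: products and inverses make sense for scalar values only, and
    [Ck_Ckr] passes to rows componentwise. *)
Fixpoint Ckr (k n : nat) (U : set 'rV[R]_n) (f : 'rV[R]_n -> R) : Prop :=
  match k with
  | 0%N => forall x, U x -> {for x, continuous f}
  | k'.+1 => (forall x, U x -> differentiable f x) /\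
             (forall v, Ckr k' U (fun x => 'D_v f x))
  end.

Lemma Ckr_ext k n (U : set 'rV[R]_n) f g : open U ->
  (forall x, U x -> f x = g x) -> Ckr k U f -> Ckr k U g.
Proof.
move=> oU; have nU x : U x -> nbhs x U by move=> Ux; apply: open_nbhs_nbhs.
elim: k f g => [|k IH] f g fg /=.
  move=> cf x Ux A; rewrite -(fg _ Ux) => /(cf x Ux) nA.
  by apply: filterS2 (nU _ Ux) nA => z Uz /=; rewrite (fg _ Uz).
move=> [df Df]; split.
  move=> x Ux; apply: near_eq_differentiable (df x Ux).
  by apply: filterS (nU _ Ux) => z; exact: fg.
move=> v; apply: IH (Df v) => x Ux; apply: near_eq_derive.
by apply: filterS (nU _ Ux) => z; exact: fg.
Qed.

Lemma Ckr_sub k n (U V : set 'rV[R]_n) f : V `<=` U -> Ckr k U f -> Ckr k V f.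
Proof.
move=> VU; elim: k f => [|k IH] f /=; first by move=> h x /VU /h.
by move=> [h1 h2]; split => [x /VU /h1//|v]; apply: IH.
Qed.

Lemma CkrW k n (U : set 'rV[R]_n) f : Ckr k.+1 U f -> Ckr k U f.
Proof.
elim: k f => [|k IH] f; first by move=> [h _] x /h; exact: differentiable_continuous.
by move=> [h1 h2]; split => // v; exact: IH.
Qed.

Lemma Ckr_cst k n (U : set 'rV[R]_n) (a : R) : Ckr k U (fun=> a).
Proof.
elim: k a => [|k IH] a /=; first by move=> x _; apply: cst_continuous.
split => [x _|v]; first exact: differentiable_cst.
have -> : (fun x => 'D_v (fun=> a) x) = (fun=> 0 : R).
  by apply/funext => x; exact: derive_cst.
exact: IH.
Qed.

Lemma CkrD k n (U : set 'rV[R]_n) f g : open U -> Ckr k U f -> Ckr k U g ->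
  Ckr k U (fun x => f x + g x).
Proof.
move=> oU; elim: k f g => [|k IH] f g /=.
  by move=> hf hg x Ux; apply: continuousD; [exact: hf|exact: hg].
move=> [df Df] [dg Dg]; split.
  by move=> x Ux; apply: differentiableD; auto.
move=> v; apply: Ckr_ext oU _ (IH _ _ (Df v) (Dg v)) => x Ux.
by rewrite deriveD//; apply: diff_derivable; auto.
Qed.

Lemma CkrM k n (U : set 'rV[R]_n) f g : open U -> Ckr k U f -> Ckr k U g ->
  Ckr k U (fun x => f x * g x).
Proof.
move=> oU; elim: k f g => [|k IH] f g.
  by move=> hf hg x Ux; apply: continuousM; [exact: hf|exact: hg].
move=> hf hg; have hf' := CkrW hf; have hg' := CkrW hg.
case: hf => df Df; case: hg => dg Dg; split.
  by move=> x Ux; apply: differentiableM; auto.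
move=> v; apply: Ckr_ext oU _ (CkrD oU (IH _ _ hf' (Dg v)) (IH _ _ hg' (Df v))) => x Ux.
by rewrite deriveM//; apply: diff_derivable; auto.
Qed.

Lemma Ckr_sum k n (U : set 'rV[R]_n) (I : Type) (r : seq I) (P : pred I) (f : I -> 'rV[R]_n -> R) :
  open U -> (forall i, Ckr k U (f i)) -> Ckr k U (fun x => \sum_(i <- r | P i) f i x).
Proof.
move=> oU hf; elim: r => [|i r IH].
  by under eq_fun do rewrite big_nil; exact: Ckr_cst.
under eq_fun do rewrite big_cons.
by case: (P i) => //; exact: CkrD.
Qed.

(** In D(1/f) = - (1/f)^2 Df the induction hypothesis is applied to 1/f itself, which is already
    known to be smooth one order lower. *)
Lemma CkrV k n (U : set 'rV[R]_n) f : open U -> (forall x, U x -> f x != 0) ->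
  Ckr k U f -> Ckr k U (fun x => (f x)^-1).
Proof.
move=> oU f0; elim: k => [|k IH].
  by move=> hf x Ux; apply: continuousV; [exact: f0|exact: hf].
move=> hf; have /IH hf' := CkrW hf; case: hf => df Df; split.
  by move=> x Ux; apply: differentiableV; auto.
move=> v; apply: Ckr_ext oU _
  (CkrM oU (Ckr_cst k U (-1)) (CkrM oU (CkrM oU hf' hf') (Df v))) => x Ux.
rewrite deriveV ?f0//; last exact/diff_derivable/df.
by rewrite scaleNr /GRing.scale /= mulN1r expr2 invfM.
Qed.

Lemma Ckr_coord k n (U : set 'rV[R]_n) j : Ckr k U (fun x => x 0 j).
Proof.
case: k => [|k]; first by move=> x _; exact: coord_continuous.
split; first by move=> x _; exact: differentiable_coord.
move=> v; have -> : (fun x : 'rV[R]_n => 'D_v (fun y : 'rV[R]_n => y 0 j) x) = (fun=> v 0 j).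
  apply/funext => x.
  have := @derive_mx R _ 1 n id x v (@derivable_id _ _ _ _).
  by rewrite derive_id => /matrixP/(_ 0 j); rewrite mxE => ->.
exact: Ckr_cst.
Qed.

Lemma differentiable_row n m (F : 'rV[R]_n -> 'rV[R]_m) x :
  (forall j, differentiable (fun z => F z 0 j) x) -> differentiable F x.
Proof.
move=> h.
have -> : F = fun z => \sum_(j < m) (fun z => F z 0 j *: delta_mx 0 j) z.
  by apply/funext => z; rewrite [LHS]row_sum_delta.
have -> : (fun z => \sum_(j < m) (F z 0 j *: (delta_mx 0 j : 'rV_m))) =
   \sum_(j < m) (fun z => F z 0 j *: (delta_mx 0 j : 'rV_m)).
  by apply/funext => z; rewrite fct_sumE.
apply: differentiable_sum => j; exact: differentiableZl.
Qed.

Lemma row_cts (T : topologicalType) m (F : T -> 'rV[R]_m) w :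
  (forall j, {for w, continuous (fun x => F x 0 j)}) -> {for w, continuous F}.
Proof.
move=> hF A /= /nbhs_ballP[e /= e0 eA].
have: \forall z \near w, forall j, ball (F w 0 j) e (F z 0 j).
  apply: filter_forall => j; apply: (hF j); exact: nbhsx_ballx.
apply: filterS => z hz; apply: eA; split => // i j.
by rewrite (ord1 i).
Qed.

(** The chain rule writes the derivative as the finite sum of D_v F_j times the j-th partial
    derivative of g composed with F. The induction runs over g, so that it applies to these partial
    derivatives. *)
Lemma Ckr_comp k n m (U : set 'rV[R]_n) (V : set 'rV[R]_m)
  (F : 'rV[R]_n -> 'rV[R]_m) g : open U -> open V ->
  (forall x, U x -> V (F x)) -> (forall j, Ckr k U (fun x => F x 0 j)) -> Ckr k V g ->
  Ckr k U (fun x => g (F x)).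
Proof.
move=> oU oV UV; elim: k g => [|k IH] g hF hg.
  move=> x Ux; apply: continuous_comp; last exact/hg/UV.
  by apply: row_cts => j; exact: hF.
have dF x : U x -> differentiable F x.
  by move=> Ux; apply: differentiable_row => j; case: (hF j) => /(_ _ Ux).
have hF' j := CkrW (hF j).
case: hg => dg Dg; split.
  by move=> x Ux; apply: differentiable_comp; [exact: dF|exact/dg/UV].
move=> v.
apply: (@Ckr_ext _ _ _ (fun x => \sum_j 'D_v (fun z => F z 0 j) x *
   'D_(delta_mx 0 j) g (F x))) => //; last first.
  apply: Ckr_sum => // j; apply: CkrM => //; first by case: (hF j) => _ /(_ v).
  apply: (IH (fun y => 'D_(delta_mx 0 j) g y)) => //; exact: Dg.
move=> x Ux.
have dgx := dg _ (UV _ Ux).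
rewrite deriveE; last by apply: differentiable_comp; [exact: dF|exact: dgx].
rewrite (@diff_comp _ _ _ _ F g)//; last exact: dF.
rewrite /= -(deriveE v (dF _ Ux)).
rewrite derive_mx; last exact/diff_derivable/dF.
rewrite [X in 'd g _ X]row_sum_delta linear_sum; apply: eq_bigr => j _.
by rewrite linearZ /= mxE -(deriveE _ dgx).
Qed.

Lemma Ck_Ckr k n m (U : set 'rV[R]_n) (F : 'rV[R]_n -> 'rV[R]_m) : open U ->
  Ck k U F <-> forall j, Ckr k U (fun x => F x 0 j).
Proof.
move=> oU; elim: k F => [|k IH] F; split => /=.
- move=> h j x Ux; apply: (@continuous_comp _ _ _ F (fun v : 'rV[R]_m => v 0 j)).
    exact: h.
  exact: coord_continuous.
- by move=> hF x Ux; apply: row_cts => j; exact: hF.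
- move=> [dF DF] j; split.
    move=> x Ux; apply: (@differentiable_comp _ _ _ _ F (fun v : 'rV[R]_m => v 0 j)).
      exact: dF.
    exact: differentiable_coord.
  move=> v; have /IH/(_ j) := DF v; apply: Ckr_ext => // x Ux.
  by rewrite derive_mx ?mxE//; exact/diff_derivable/dF.
- move=> h; have dF x : U x -> differentiable F x.
    by move=> Ux; apply: differentiable_row => j; case: (h j) => /(_ _ Ux).
  split => // v; apply/IH => j; have [_ /(_ v)] := h j; apply: Ckr_ext => // x Ux.
  by rewrite derive_mx ?mxE//; exact/diff_derivable/dF.
Qed.

(** * Germs of smooth functions *)

Definition gsmooth n (g : 'rV[R]_n -> R) (w : 'rV[R]_n) :=
  exists U, [/\ open U, U w & forall k, Ckr k U g].

Lemma gsmooth_cst n (a : R) (w : 'rV[R]_n) : gsmooth (fun=> a) w.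
Proof. by exists setT; split => //; [exact: openT|move=> k; exact: Ckr_cst]. Qed.

Lemma gsmooth_coord n j (w : 'rV[R]_n) : gsmooth (fun x => x 0 j) w.
Proof. by exists setT; split => //; [exact: openT|move=> k; exact: Ckr_coord]. Qed.

Lemma gsmoothD n f g (w : 'rV[R]_n) : gsmooth f w -> gsmooth g w -> gsmooth (fun x => f x + g x) w.
Proof.
move=> [U [oU Uw hf]] [V [oV Vw hg]]; exists (U `&` V); split => //.
  exact: openI.
by move=> k; apply: CkrD; [exact: openI|apply: Ckr_sub (hf k) => ? []|
  apply: Ckr_sub (hg k) => ? []].
Qed.

Lemma gsmoothM n f g (w : 'rV[R]_n) : gsmooth f w -> gsmooth g w -> gsmooth (fun x => f x * g x) w.
Proof.
move=> [U [oU Uw hf]] [V [oV Vw hg]]; exists (U `&` V); split => //.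
  exact: openI.
by move=> k; apply: CkrM; [exact: openI|apply: Ckr_sub (hf k) => ? []|
  apply: Ckr_sub (hg k) => ? []].
Qed.

Lemma gsmooth_cts n f (w : 'rV[R]_n) : gsmooth f w -> {for w, continuous f}.
Proof. by move=> [U [oU Uw /(_ 0%N)]]; exact. Qed.

Lemma gsmooth_near n f (w : 'rV[R]_n) : gsmooth f w -> \forall z \near w, gsmooth f z.
Proof.
move=> [U [oU Uw hf]]; have : nbhs w U by apply: open_nbhs_nbhs.
by apply: filterS => z Uz; exists U.
Qed.

Lemma gsmooth_ext n f g (w : 'rV[R]_n) :
  (\forall z \near w, f z = g z) -> gsmooth f w -> gsmooth g w.
Proof.
move=> fg [U [oU Uw hf]].
have [V [oV Vw VP]] := near_open fg.
exists (U `&` V); split => //; first exact: openI.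
move=> k; apply: Ckr_ext (Ckr_sub _ (hf k)); first exact: openI.
  by move=> x [_ /VP].
by move=> x [].
Qed.

Lemma gsmoothV n f (w : 'rV[R]_n) : gsmooth f w -> f w != 0 -> gsmooth (fun x => (f x)^-1) w.
Proof.
move=> hf f0; have cf := gsmooth_cts hf; case: hf => U [oU Uw hf].
have : \forall z \near w, f z != 0.
  apply: (cf [set y | y != 0]); apply: open_nbhs_nbhs; split => //; exact: open_neq.
move=> /near_open[V [oV Vw VP]].
exists (U `&` V); split => //; first exact: openI.
move=> k; apply: CkrV; first exact: openI.
  by move=> x [_ /VP].
by apply: Ckr_sub (hf k) => x [].
Qed.

Lemma gsmooth_comp n m (F : 'rV[R]_n -> 'rV[R]_m) g w :
  (forall j, gsmooth (fun x => F x 0 j) w) -> gsmooth g (F w) -> gsmooth (fun x => g (F x)) w.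
Proof.
move=> hF [V [oV Vw hg]].
have cF : {for w, continuous F} by apply: row_cts => j; exact: gsmooth_cts.
have {hF}[U [oU Uw hF]] : exists U, [/\ open U, U w & forall j k, Ckr k U (fun x => F x 0 j)].
  have [U hU] := choice hF.
  have nU j : \forall z \near w, U j z.
    by case: (hU j) => ? ? _; apply: open_nbhs_nbhs.
  have [V' [oV' Vw' VU]] := near_open (filter_forall _ nU); exists V'; split => // j k.
  by case: (hU j) => _ _ /(_ k); apply: Ckr_sub => x /VU.
have : nbhs w (F @^-1` V) by apply: cF; apply: open_nbhs_nbhs.
rewrite nbhsE => -[W [oW Ww] WV].
exists (U `&` W); split => //; first exact: openI.
move=> k; apply: (@Ckr_comp _ _ _ _ V) => //; first exact: openI.
  by move=> x [_ /WV].
by move=> j; apply: Ckr_sub (hF j k) => x [].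
Qed.

(** Each finite order is a condition at every point of U separately, so neighbourhoods that vary
    with the point suffice. *)
Lemma smooth_onP n m (U : set 'rV[R]_n) (F : 'rV[R]_n -> 'rV[R]_m) : open U ->
  smooth_on U F <-> forall w j, U w -> gsmooth (fun x => F x 0 j) w.
Proof.
move=> oU; split.
  move=> h w j Uw; exists U; split => // k.
  by have /Ck_Ckr := h k; apply.
move=> h k; apply/Ck_Ckr => // j.
have loc w : U w -> exists V, [/\ open V, V w & Ckr k V (fun x => F x 0 j)].
  by move=> /(h w j)[V [oV Vw hV]]; exists V.
(* The induction ranges over all functions that are locally of class k, not only the components of
   F, in order to pass to derivatives. *)
elim: k (fun x => F x 0 j) loc => [|k IH] f loc /=.
  by move=> x /loc[V [_ Vx]]; apply.
split; first by move=> x /loc[V [_ Vx [df _]]]; exact: df.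
by move=> v; apply: IH => w /loc[V [oV Vw [_ hV]]]; exists V; split => //; exact: hV.
Qed.

End Calculus.

(** * Smooth maps between manifolds *)

Section Charts.
Variable R : realType.

(* P holds near x as seen in the chart c alone: X carries no topology yet. *)
Definition cnear (X : Type) (c : chart R X) (x : X) (P : X -> Prop) :=
  cdom c x /\ \forall w \near cmap c x, forall y, cdom c y -> cmap c y = w -> P y.

Definition csmooth (X : Type) (c : chart R X) (f : X -> R) (x : X) :=
  exists g, gsmooth g (cmap c x) /\ cnear c x (fun y => f y = g (cmap c y)).

Lemma cnearS X (c : chart R X) x (P Q : X -> Prop) :
  (forall y, cdom c y -> P y -> Q y) -> cnear c x P -> cnear c x Q.
Proof.
move=> PQ [cx nP]; split => //; apply: filterS nP => w h y cy yw.
by apply: PQ => //; exact: h yw.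
Qed.

Lemma cnearI X (c : chart R X) x (P Q : X -> Prop) :
  cnear c x P -> cnear c x Q -> cnear c x (fun y => P y /\ Q y).
Proof.
move=> [cx nP] [_ nQ]; split => //; apply: filterS2 nP nQ => w h h' y cy yw.
by split; [exact: h yw|exact: h' yw].
Qed.

Lemma cnear_forall X (c : chart R X) x n (P : 'I_n -> X -> Prop) : cdom c x ->
  (forall i, cnear c x (P i)) -> cnear c x (fun y => forall i, P i y).
Proof.
move=> cx nP; split => //.
have : forall i, \forall w \near cmap c x, forall y, cdom c y -> cmap c y = w -> P i y.
  by move=> i; case: (nP i).
move/(filter_forall _); apply: filterS => w h y cy yw i; exact: h yw.
Qed.

Lemma cnear_true X (c : chart R X) x (P : X -> Prop) : cdom c x ->
  (forall y, cdom c y -> P y) -> cnear c x P.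
Proof. by move=> cx hP; split => //; apply: filterE => w y cy _; exact: hP. Qed.

Lemma cnear_self X (c : chart R X) x (P : X -> Prop) : cnear c x P -> P x.
Proof. by move=> [cx /nbhs_singleton/= h]; exact: h. Qed.

Lemma cnear_cnear X (c : chart R X) x (P : X -> Prop) :
  cnear c x P -> cnear c x (cnear c ^~ P).
Proof.
move=> [cx nP]; split => //; have := nbhs_interior nP; apply: filterS => w iw y cy yw.
by split => //; rewrite yw.
Qed.

Lemma cnear_map X (c : chart R X) x (P : _ -> Prop) : cdom c x ->
  (\forall w \near cmap c x, P w) -> cnear c x (fun y => P (cmap c y)).
Proof. by move=> cx nP; split => //; apply: filterS nP => w Pw y _ ->. Qed.

Lemma csmooth_cst X (c : chart R X) x a : cdom c x -> csmooth c (fun=> a) x.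
Proof. by move=> cx; exists (fun=> a); split; [exact: gsmooth_cst|exact: cnear_true]. Qed.

Lemma csmoothD X (c : chart R X) x f g : csmooth c f x -> csmooth c g x ->
  csmooth c (fun y => f y + g y) x.
Proof.
move=> [f' [sf nf]] [g' [sg ng]]; exists (fun w => f' w + g' w); split.
  exact: gsmoothD.
by apply: cnearS (cnearI nf ng) => y _ [-> ->].
Qed.

Lemma csmoothM X (c : chart R X) x f g : csmooth c f x -> csmooth c g x ->
  csmooth c (fun y => f y * g y) x.
Proof.
move=> [f' [sf nf]] [g' [sg ng]]; exists (fun w => f' w * g' w); split.
  exact: gsmoothM.
by apply: cnearS (cnearI nf ng) => y _ [-> ->].
Qed.

Lemma csmoothV X (c : chart R X) x f : csmooth c f x -> f x != 0 ->
  csmooth c (fun y => (f y)^-1) x.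
Proof.
move=> [f' [sf nf]] f0; exists (fun w => (f' w)^-1); split.
  by apply: gsmoothV => //; rewrite -(cnear_self nf).
by apply: cnearS nf => y _ ->.
Qed.

Lemma csmooth_ext X (c : chart R X) x f g : cnear c x (fun y => f y = g y) ->
  csmooth c f x -> csmooth c g x.
Proof.
move=> fg [f' [sf nf]]; exists f'; split => //.
by apply: cnearS (cnearI nf fg) => y _ [-> ->].
Qed.

Lemma csmooth_coord X (c : chart R X) x j : cdom c x -> csmooth c (fun y => cmap c y 0 j) x.
Proof.
by move=> cx; exists (fun w => w 0 j); split; [exact: gsmooth_coord|exact: cnear_true].
Qed.

Lemma csmooth_near X (c : chart R X) x f : csmooth c f x -> cnear c x (csmooth c f).
Proof.
move=> [g [sg ng]]; have cx : cdom c x by case: ng.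
have := cnearI (cnear_cnear ng) (cnear_map cx (gsmooth_near sg)).
by apply: cnearS => y _ [ny sy]; exists g.
Qed.

Lemma csmooth_change X (c c' : chart R X) x t : cdom c' x ->
  t (cmap c' x) = cmap c x -> (forall j, gsmooth (fun w => t w 0 j) (cmap c' x)) ->
  cnear c' x (fun y => cdom c y /\ cmap c y = t (cmap c' y)) ->
  (forall P, cnear c x P -> cnear c' x P) /\ (forall f, csmooth c f x -> csmooth c' f x).
Proof.
move=> c'x tx st nt.
have nch P : cnear c x P -> cnear c' x P.
  move=> [cx nP].
  have : {for cmap c' x, continuous t} by apply: row_cts => j; exact: gsmooth_cts.
  rewrite /prop_for /continuous_at tx => /(_ _ nP) /(cnear_map c'x) n2.
  by apply: cnearS (cnearI nt n2) => y c'y [[cy e]]; apply; rewrite ?e.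
split => // f [g [sg ng]]; exists (g \o t); split.
  by apply: gsmooth_comp; rewrite ?tx.
by apply: cnearS (cnearI nt (nch _ ng)) => y _ [[cy e] ->]; rewrite e.
Qed.

(** Since c is injective, the transition map can be chosen point by point on the image of the
    overlap, with default 0 outside; near each point of the image it then agrees with the given
    smooth coordinate expressions. *)
Lemma chart_compatP X (c c' : chart R X) :
  (forall x y, cdom c x -> cdom c y -> cmap c x = cmap c y -> x = y) ->
  open (cmap c @` (cdom c `&` cdom c')) ->
  (forall x j, cdom c x -> cdom c' x -> csmooth c (fun y => cmap c' y 0 j) x) ->
  chart_compat c c'.
Proof.
move=> inj oI sm; split => //.
pose ex w := [set v | exists x, [/\ cdom c x, cdom c' x, cmap c x = w & v = cmap c' x]].
exists (fun w => choose_or 0 (ex w)).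
have gE x : cdom c x -> cdom c' x -> choose_or 0 (ex (cmap c x)) = cmap c' x.
  move=> cx c'x; rewrite /choose_or; case: pselect => [h|]; last first.
    by case; exists (cmap c' x); exists x.
  case: cid => v /= [y [cy c'y yx ->]].
  by rewrite (inj y x).
split; last by move=> x cx c'x; rewrite gE.
apply/smooth_onP => // _ j [x [cx c'x] <-].
have [g [sg [_ ng]]] := sm x j cx c'x.
apply: gsmooth_ext sg.
have nI : \forall w \near cmap c x, (cmap c @` (cdom c `&` cdom c')) w.
  by apply: open_nbhs_nbhs; split => //; exists x.
apply: filterS2 nI ng => w [y [cy c'y] <-] /(_ y cy erefl) h.
by rewrite gE// -h.
Qed.

(** A manifold without the Hausdorff and countability axioms. The local calculus below works at this
    generality, and it must be available for the total space of a dual bundle before those two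
    axioms are established there. *)
Record premanifold (X : premfd R) : Prop := IsPremanifold {
  pm_inj : forall c, atlas X c -> forall x y, cdom c x -> cdom c y ->
    cmap c x = cmap c y -> x = y;
  pm_compat : forall c c', atlas X c -> atlas X c' -> chart_compat c c';
  pm_cover : forall x : X, exists c, atlas X c /\ cdom c x }.

Lemma manifold_premanifold X : is_manifold X -> premanifold X.
Proof. by case. Qed.

Definition mnear (X : premfd R) (x : X) (P : X -> Prop) :=
  exists c, atlas X c /\ cnear c x P.

Definition rsmooth (X : premfd R) (f : X -> R) (x : X) :=
  exists c, atlas X c /\ csmooth c f x.

Section OnPmfd.
Variables (X : premfd R).
Hypothesis pX : premanifold X.
Implicit Types (x : X) (c : chart R X).

Lemma chart_transition c c' x : atlas X c -> atlas X c' -> cdom c x -> cdom c' x ->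
  exists t, [/\ t (cmap c' x) = cmap c x,
    forall j, gsmooth (fun w => t w 0 j) (cmap c' x) &
    cnear c' x (fun y => cdom c y /\ cmap c y = t (cmap c' y))].
Proof.
move=> ac ac' cx c'x; have [oI [t [st tE]]] := pm_compat pX ac' ac.
exists t; split; first by rewrite tE.
  by move=> j; have /smooth_onP := st; apply => //; exists x.
split => //.
have nI : \forall w \near cmap c' x, (cmap c' @` (cdom c' `&` cdom c)) w.
  by apply: open_nbhs_nbhs; split => //; exists x.
apply: filterS nI => w [y [c'y cy] <-] z c'z /(pm_inj pX ac' c'z c'y) ->.
by rewrite tE.
Qed.

Lemma cnear_change c c' x P : atlas X c -> atlas X c' -> cdom c' x ->
  cnear c x P -> cnear c' x P.
Proof.
move=> ac ac' c'x nP; have cx : cdom c x by case: nP.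
have [t [tx st nt]] := chart_transition ac ac' cx c'x.
by have [h _] := csmooth_change c'x tx st nt; exact: h.
Qed.

Lemma csmooth_atlas c c' x f : atlas X c -> atlas X c' -> cdom c' x ->
  csmooth c f x -> csmooth c' f x.
Proof.
move=> ac ac' c'x nP; have cx : cdom c x by case: nP => g [_ []].
have [t [tx st nt]] := chart_transition ac ac' cx c'x.
by have [_ h] := csmooth_change c'x tx st nt; exact: h.
Qed.

Lemma mnear_chart c x P : atlas X c -> cdom c x -> mnear x P -> cnear c x P.
Proof. by move=> ac cx [c' [ac' h]]; exact: cnear_change h. Qed.

Lemma rsmooth_chart c x f : atlas X c -> cdom c x -> rsmooth f x -> csmooth c f x.
Proof. by move=> ac cx [c' [ac' h]]; exact: csmooth_atlas h. Qed.

Lemma mnearS x (P Q : X -> Prop) : (forall y, P y -> Q y) -> mnear x P -> mnear x Q.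
Proof.
by move=> PQ [c [ac h]]; exists c; split => //; apply: cnearS h => y _; exact: PQ.
Qed.

Lemma mnearI x (P Q : X -> Prop) : mnear x P -> mnear x Q ->
  mnear x (fun y => P y /\ Q y).
Proof.
move=> [c [ac h]] hQ; exists c; split => //; apply: cnearI => //.
by apply: mnear_chart => //; case: h.
Qed.

Lemma mnearE x (P : X -> Prop) : (forall y, P y) -> mnear x P.
Proof.
have [c [ac cx]] := pm_cover pX x.
by move=> hP; exists c; split => //; exact: cnear_true.
Qed.

Lemma mnear_self x (P : X -> Prop) : mnear x P -> P x.
Proof. by move=> [c [_ h]]; exact: (cnear_self h). Qed.

Lemma mnear_mnear x (P : X -> Prop) : mnear x P -> mnear x (fun y => mnear y P).
Proof.
move=> [c [ac h]]; exists c; split => //.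
by apply: cnearS (cnear_cnear h) => y _ hy; exists c.
Qed.

Lemma mnear_forall x n (P : 'I_n -> X -> Prop) :
  (forall i, mnear x (P i)) -> mnear x (fun y => forall i, P i y).
Proof.
have [c [ac cx]] := pm_cover pX x.
move=> h; exists c; split => //; apply: cnear_forall => // i.
by apply: mnear_chart.
Qed.

Lemma mopen_mnear (O : set X) x : mopen O -> O x -> mnear x O.
Proof.
move=> oO Ox; have [c [ac cx]] := pm_cover pX x; exists c; split => //; split => //.
have nI : \forall w \near cmap c x, (cmap c @` (cdom c `&` O)) w.
  by apply: open_nbhs_nbhs; split; [exact: oO|exists x].
by apply: filterS nI => w [y [cy Oy] <-] z cz /(pm_inj pX ac cz cy) ->.
Qed.

Lemma chart_image_open c : atlas X c -> open (cmap c @` cdom c).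
Proof. by move=> ac; have [+ _] := pm_compat pX ac ac; rewrite setIid. Qed.

Lemma mopenP (O : set X) : (forall x, O x -> mnear x O) -> mopen O.
Proof.
move=> h c ac; rewrite openE => _ [x [cx Ox] <-].
have [_ nO] := mnear_chart ac cx (h x Ox).
have nI : \forall w \near cmap c x, (cmap c @` cdom c) w.
  by apply: open_nbhs_nbhs; split; [exact: chart_image_open|exists x].
apply: filterS2 nI nO => w [y cy yw] /(_ y cy yw) Oy.
by exists y.
Qed.

Lemma mnear_chartdom c x : atlas X c -> cdom c x -> mnear x (cdom c).
Proof. by move=> ac cx; exists c; split => //; exact: cnear_true. Qed.

Lemma rsmooth_cst x a : rsmooth (fun=> a) x.
Proof.
have [c [ac cx]] := pm_cover pX x; exists c; split => //; exact: csmooth_cst.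
Qed.

Lemma rsmoothD x f g : rsmooth f x -> rsmooth g x -> rsmooth (fun y => f y + g y) x.
Proof.
move=> [c [ac sf]] sg; have cx : cdom c x by case: sf => ? [_ []].
by exists c; split => //; apply: csmoothD => //; exact: rsmooth_chart.
Qed.

Lemma rsmoothM x f g : rsmooth f x -> rsmooth g x -> rsmooth (fun y => f y * g y) x.
Proof.
move=> [c [ac sf]] sg; have cx : cdom c x by case: sf => ? [_ []].
by exists c; split => //; apply: csmoothM => //; exact: rsmooth_chart.
Qed.

Lemma rsmoothN x f : rsmooth f x -> rsmooth (fun y => - f y) x.
Proof.
move=> sf; have := rsmoothM (rsmooth_cst x (-1)) sf.
by under eq_fun do rewrite mulN1r.
Qed.

Lemma rsmoothB x f g : rsmooth f x -> rsmooth g x -> rsmooth (fun y => f y - g y) x.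
Proof. by move=> sf sg; apply: rsmoothD => //; exact: rsmoothN. Qed.

Lemma rsmoothV x f : rsmooth f x -> f x != 0 -> rsmooth (fun y => (f y)^-1) x.
Proof. by move=> [c [ac sf]] f0; exists c; split => //; exact: csmoothV. Qed.

Lemma rsmooth_sum x (I : Type) (r : seq I) (P : pred I) (f : I -> X -> R) :
  (forall i, rsmooth (f i) x) -> rsmooth (fun y => \sum_(i <- r | P i) f i y) x.
Proof.
move=> hf; elim: r => [|i r IH].
  by under eq_fun do rewrite big_nil; exact: rsmooth_cst.
under eq_fun do rewrite big_cons.
by case: (P i) => //; exact: rsmoothD.
Qed.

Lemma rsmooth_prod x (I : Type) (r : seq I) (P : pred I) (f : I -> X -> R) :
  (forall i, rsmooth (f i) x) -> rsmooth (fun y => \prod_(i <- r | P i) f i y) x.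
Proof.
move=> hf; elim: r => [|i r IH].
  by under eq_fun do rewrite big_nil; exact: rsmooth_cst.
under eq_fun do rewrite big_cons.
by case: (P i) => //; exact: rsmoothM.
Qed.

Lemma rsmooth_ext x f g : mnear x (fun y => f y = g y) -> rsmooth f x -> rsmooth g x.
Proof.
move=> fg [c [ac sf]]; have cx : cdom c x by case: sf => ? [_ []].
by exists c; split => //; apply: csmooth_ext sf; exact: mnear_chart.
Qed.

Lemma rsmooth_near x f : rsmooth f x -> mnear x (rsmooth f).
Proof.
move=> [c [ac h]]; exists c; split => //.
by apply: cnearS (csmooth_near h) => y _ hy; exists c.
Qed.

Lemma rsmooth_coord c x j : atlas X c -> cdom c x -> rsmooth (fun y => cmap c y 0 j) x.
Proof. by move=> ac cx; exists c; split => //; exact: csmooth_coord. Qed.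

Lemma rsmooth_neq0 x f : rsmooth f x -> f x != 0 -> mnear x (fun y => f y != 0).
Proof.
move=> [c [ac [g [sg ng]]]] f0; have cx : cdom c x by case: ng.
exists c; split => //.
have n0 : \forall w \near cmap c x, g w != 0.
  have := gsmooth_cts sg; rewrite /prop_for /continuous_at => /(_ [set z | z != 0]).
  apply; apply: open_nbhs_nbhs; split; first exact: open_neq.
  by rewrite /= -(cnear_self ng).
by apply: cnearS (cnearI ng (cnear_map cx n0)) => y _ [-> ].
Qed.

(** Trades the single open set and the single vector-valued representative of [smooth_at] for one
    condition per target coordinate; the finitely many neighbourhoods are intersected. *)
Lemma smooth_atP (Y : premfd R) (f : X -> Y) x :
  smooth_at f x <-> exists c' : chart R Y, [/\ atlas Y c', mnear x (fun y => cdom c' (f y)) &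
    forall j, rsmooth (fun y => cmap c' (f y) 0 j) x].
Proof.
split.
  move=> [c [c' [W [g [[ac cx] [ac' c'x] [oW Wcx] sg h]]]]]; exists c'.
  have nW : \forall w \near cmap c x, W w by apply: open_nbhs_nbhs.
  have nOx := cnear_map cx nW.
  split => //.
    by exists c; split => //; apply: cnearS nOx => y cy /(h y cy)[].
  move=> j; exists c; split => //; exists (fun w => g w 0 j); split.
    by have /smooth_onP := sg; apply.
  by apply: cnearS nOx => y cy /(h y cy)[_ ->].
move=> [c' [ac' [c [ac nc]] sc]].
have cx : cdom c x by case: nc.
have sj j : csmooth c (fun y => cmap c' (f y) 0 j) x by exact: rsmooth_chart.
have [g hg] := choice sj.
have hsm : forall j, \forall w \near cmap c x, gsmooth (g j) w.
  by move=> j; apply: gsmooth_near; case: (hg j).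
have [_ ng] : cnear c x (fun y => forall j, cmap c' (f y) 0 j = g j (cmap c y)).
  by apply: cnear_forall => // j; case: (hg j).
case: nc => _ nc.
have [V [oV Vx VP]] := near_open (filterI nc (filterI ng (filter_forall _ hsm))).
exists c, c', V, (fun w => \row_j g j w); split => //.
- by split => //; case: (VP _ Vx) => + _; exact.
- apply/smooth_onP => // w j /VP[_ [_ /(_ j)]].
  by under [X in _ -> gsmooth X _]eq_fun do rewrite mxE.
- move=> y cy /VP[/(_ y cy erefl) h [/(_ y cy erefl) h' _]]; split => //.
  by apply/rowP => j; rewrite mxE h'.
Qed.

Lemma smooth_ext (Y : premfd R) (f g : X -> Y) x : mnear x (fun y => f y = g y) ->
  smooth_at f x -> smooth_at g x.
Proof.
move=> fg /smooth_atP[c' [ac' nc sc]]; apply/smooth_atP; exists c'; split => //.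
  by apply: mnearS (mnearI nc fg) => y [h <-].
by move=> j; apply: rsmooth_ext (sc j); apply: mnearS fg => y ->.
Qed.

Lemma smooth_idP x : smooth_at (id : X -> X) x.
Proof.
have [c [ac cx]] := pm_cover pX x; apply/smooth_atP; exists c; split => //.
  exact: mnear_chartdom.
by move=> j; exact: rsmooth_coord.
Qed.

Lemma smooth_cst (Y : premfd R) (y : Y) x : premanifold Y -> smooth_at (fun=> y : Y) x.
Proof.
move=> pY; have [c [ac cy]] := pm_cover pY y; apply/smooth_atP; exists c; split => //.
  exact: mnearE.
by move=> j; exact: rsmooth_cst.
Qed.

Lemma smooth_euclidP n (f : X -> euclid R n) x :
  smooth_at f x <-> forall j, rsmooth (fun y => (f y : 'rV[R]_n) 0 j) x.
Proof.
split.
  by move=> /smooth_atP[_ [-> _ h]].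
move=> h; apply/smooth_atP; exists (@Chart R 'rV[R]_n n setT id); split => //.
exact: mnearE.
Qed.

End OnPmfd.

Section Composition.
Variables (X Y : premfd R) (f : X -> Y) (x : X).
Hypotheses (pX : premanifold X) (pY : premanifold Y) (sf : smooth_at f x).

(** Continuity of smooth maps, phrased for properties that hold near a point. *)
Lemma mnear_comp P : mnear (f x) P -> mnear x (fun y => P (f y)).
Proof.
case: sf => c [c' [W [g [[ac cx] [ac' c'x] [oW Wcx] sg h]]]].
move=> /(mnear_chart pY ac' c'x)[_ nP]; exists c; split => //.
have nW : \forall w \near cmap c x, W w by apply: open_nbhs_nbhs.
have cg : {for cmap c x, continuous g}.
  by apply: row_cts => j; apply: gsmooth_cts; have /smooth_onP := sg; apply.
have [_ gx] := h _ cx Wcx; rewrite gx in nP.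
have := cnearI (cnear_map cx nW) (cnear_map cx (cg _ nP)).
apply: cnearS => y cy [Wy]; have [c'y gy] := h _ cy Wy; apply => //.
Qed.

Lemma rsmooth_comp k : rsmooth k (f x) -> rsmooth (fun y => k (f y)) x.
Proof.
case: (sf) => c [c' [W [g [[ac cx] [ac' c'x] [oW Wcx] sg h]]]].
move=> /(rsmooth_chart pY ac' c'x)[k' [sk nk]]; exists c; split => //.
have nW : \forall w \near cmap c x, W w by apply: open_nbhs_nbhs.
have [_ gx] := h _ cx Wcx; rewrite gx in sk.
exists (k' \o g); split.
  by apply: gsmooth_comp => // j; have /smooth_onP := sg; apply.
have nk' : mnear (f x) (fun y => k y = k' (cmap c' y)) by exists c'.
have := cnearI (cnear_map cx nW) (mnear_chart pX ac cx (mnear_comp nk')).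
by apply: cnearS => y cy [Wy ->]; have [_ ->] := h _ cy Wy.
Qed.

Lemma smooth_comp (Z : premfd R) (k : Y -> Z) :
  smooth_at k (f x) -> smooth_at (fun y => k (f y)) x.
Proof.
move=> /(smooth_atP pY)[c [ac nc sc]]; apply/(smooth_atP pX).
exists c; split => //; first exact: (mnear_comp nc).
by move=> j; exact: (rsmooth_comp (sc j)).
Qed.

End Composition.

Lemma open_preimage (T U : topologicalType) (f : T -> U) (O : set U) :
  continuous f -> open O -> open (f @^-1` O).
Proof. by move=> cf oO; apply: open_comp => // x _; exact: cf. Qed.

Lemma lsubmx_continuous n m : continuous (lsubmx : 'rV[R]_(n + m) -> 'rV[R]_n).
Proof.
move=> x; apply: row_cts => j.
have -> : (fun y : 'rV[R]_(n + m) => lsubmx y 0 j) = (fun y => y 0 (lshift m j)).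
  by apply/funext => y; rewrite mxE.
exact: coord_continuous.
Qed.

Lemma rsubmx_continuous n m : continuous (rsubmx : 'rV[R]_(n + m) -> 'rV[R]_m).
Proof.
move=> x; apply: row_cts => j.
have -> : (fun y : 'rV[R]_(n + m) => rsubmx y 0 j) = (fun y => y 0 (rshift n j)).
  by apply/funext => y; rewrite mxE.
exact: coord_continuous.
Qed.

Lemma gsmooth_lsub n m g (a : 'rV[R]_n) (b : 'rV[R]_m) : gsmooth g a ->
  gsmooth (fun w : 'rV[R]_(n + m) => g (lsubmx w)) (row_mx a b).
Proof.
move=> sg; apply: gsmooth_comp; last by rewrite row_mxKl.
move=> j; under eq_fun do rewrite mxE; exact: gsmooth_coord.
Qed.

Lemma gsmooth_rsub n m g (a : 'rV[R]_n) (b : 'rV[R]_m) : gsmooth g b ->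
  gsmooth (fun w : 'rV[R]_(n + m) => g (rsubmx w)) (row_mx a b).
Proof.
move=> sg; apply: gsmooth_comp; last by rewrite row_mxKr.
move=> j; under eq_fun do rewrite mxE; exact: gsmooth_coord.
Qed.

Lemma open_image_row n m (A : set 'rV[R]_n) (B : set 'rV[R]_m) : open A -> open B ->
  open [set w : 'rV[R]_(n + m) | A (lsubmx w) /\ B (rsubmx w)].
Proof.
move=> oA oB; apply: (@openI _ [set w : 'rV[R]_(n + m) | A (lsubmx w)]).
  exact: (open_preimage (@lsubmx_continuous n m) oA).
exact: (open_preimage (@rsubmx_continuous n m) oB).
Qed.

Lemma premanifold_euclid n : premanifold (euclid R n).
Proof.
split => [c -> //|c c' -> ->|x].
  apply: chart_compatP => //=.
    by rewrite image_id setIT; exact: openT.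
  by move=> x j _ _; exists (fun w => w 0 j); split; [exact: gsmooth_coord|exact: cnear_true].
by exists (@Chart R 'rV[R]_n n setT id).
Qed.

Section Product.
Variables (X Y : premfd R).

Lemma cnear_fst (c : chart R X) (d : chart R Y) (p : X * Y) P :
  cdom d p.2 -> cnear c p.1 P -> cnear (prod_chart c d) p (fun q => P q.1).
Proof.
move=> dp [cp nP]; split => //=.
have : \forall w \near row_mx (cmap c p.1) (cmap d p.2), forall y,
    cdom c y -> cmap c y = lsubmx w -> P y.
  have := @lsubmx_continuous (cdim c) (cdim d) (row_mx (cmap c p.1) (cmap d p.2)).
  by rewrite /continuous_at row_mxKl => C; exact: (C _ nP).
by apply: filterS => w h [y z] /= [cy dz] e; apply: h => //; rewrite -e row_mxKl.
Qed.

Lemma cnear_snd (c : chart R X) (d : chart R Y) (p : X * Y) P :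
  cdom c p.1 -> cnear d p.2 P -> cnear (prod_chart c d) p (fun q => P q.2).
Proof.
move=> cp [dp nP]; split => //=.
have : \forall w \near row_mx (cmap c p.1) (cmap d p.2), forall y,
    cdom d y -> cmap d y = rsubmx w -> P y.
  have := @rsubmx_continuous (cdim c) (cdim d) (row_mx (cmap c p.1) (cmap d p.2)).
  by rewrite /continuous_at row_mxKr => C; exact: (C _ nP).
by apply: filterS => w h [y z] /= [cy dz] e; apply: h => //; rewrite -e row_mxKr.
Qed.

Lemma csmooth_fst (c : chart R X) (d : chart R Y) (p : X * Y) f :
  cdom d p.2 -> csmooth c f p.1 -> csmooth (prod_chart c d) (fun q => f q.1) p.
Proof.
move=> dp [g [sg ng]]; exists (fun w => g (lsubmx w)); split; first exact: gsmooth_lsub.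
by apply: cnearS (cnear_fst dp ng) => -[y z] _ /= ->; rewrite row_mxKl.
Qed.

Lemma csmooth_snd (c : chart R X) (d : chart R Y) (p : X * Y) f :
  cdom c p.1 -> csmooth d f p.2 -> csmooth (prod_chart c d) (fun q => f q.2) p.
Proof.
move=> dp [g [sg ng]]; exists (fun w => g (rsubmx w)); split; first exact: gsmooth_rsub.
by apply: cnearS (cnear_snd dp ng) => -[y z] _ /= ->; rewrite row_mxKr.
Qed.

Hypotheses (pX : premanifold X) (pY : premanifold Y).

Lemma premanifold_prod : premanifold (prod_mfd X Y).
Proof.
split.
- move=> _ [c ac [d ad <-]] [x y] [x' y'] /= [cx dy] [cx' dy'] /eq_row_mx[].
  by move=> /(pm_inj pX ac cx cx') -> /(pm_inj pY ad dy dy') ->.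
- move=> _ _ [c ac [d ad <-]] [c' ac' [d' ad' <-]]; apply: chart_compatP.
  + move=> [x y] [x' y'] /= [cx dy] [cx' dy'] /eq_row_mx[].
    by move=> /(pm_inj pX ac cx cx') -> /(pm_inj pY ad dy dy') ->.
  + have [c_op _] := pm_compat pX ac ac'; have [d_op _] := pm_compat pY ad ad'.
    have := open_image_row c_op d_op.
    suff -> : [set w | (cmap c @` (cdom c `&` cdom c')) (lsubmx w) /\
        (cmap d @` (cdom d `&` cdom d')) (rsubmx w)] =
      cmap (prod_chart c d) @` (cdom (prod_chart c d) `&` cdom (prod_chart c' d')) by [].
    apply/seteqP; split => [w /=|w].
      move=> [[x [cx c'x] xw] [y [dy d'y] yw]]; exists (x, y) => //=.
      by rewrite xw yw hsubmxK.
    move=> [[x y] /= [[cx dy] [c'x d'y]] <-].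
    by rewrite /= row_mxKl row_mxKr; split; [exists x|exists y].
  + move=> [x y] j /= [cx dy] [c'x d'y].
    case: (split_ordP j) => k ->.
      under eq_fun do rewrite row_mxEl.
      apply: (@csmooth_fst c d (x, y) (fun z => cmap c' z 0 k)) => //=.
      by apply: rsmooth_chart => //; exact: rsmooth_coord.
    under eq_fun do rewrite row_mxEr.
    apply: (@csmooth_snd c d (x, y) (fun z => cmap d' z 0 k)) => //=.
    by apply: rsmooth_chart => //; exact: rsmooth_coord.
- move=> [x y]; have [c [ac cx]] := pm_cover pX x; have [d [ad dy]] := pm_cover pY y.
  by exists (prod_chart c d); split => //; exists c => //; exists d.
Qed.

Lemma smooth_fst p : smooth_at (fst : prod_mfd X Y -> X) p.
Proof.
case: p => x y; have [c [ac cx]] := pm_cover pX x; have [d [ad dy]] := pm_cover pY y.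
have acd : atlas (prod_mfd X Y) (prod_chart c d) by exists c => //; exists d.
apply/(smooth_atP premanifold_prod); exists c; split => //.
  exists (prod_chart c d); split => //; apply: (@cnear_fst c d (x, y) (cdom c)) => //.
  exact: cnear_true.
move=> j; exists (prod_chart c d); split => //.
by apply: (@csmooth_fst c d (x, y) (fun z => cmap c z 0 j)) => //; exact: csmooth_coord.
Qed.

Lemma smooth_snd p : smooth_at (snd : prod_mfd X Y -> Y) p.
Proof.
case: p => x y; have [c [ac cx]] := pm_cover pX x; have [d [ad dy]] := pm_cover pY y.
have acd : atlas (prod_mfd X Y) (prod_chart c d) by exists c => //; exists d.
apply/(smooth_atP premanifold_prod); exists d; split => //.
  exists (prod_chart c d); split => //; apply: (@cnear_snd c d (x, y) (cdom d)) => //.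
  exact: cnear_true.
move=> j; exists (prod_chart c d); split => //.
by apply: (@csmooth_snd c d (x, y) (fun z => cmap d z 0 j)) => //; exact: csmooth_coord.
Qed.

Lemma smooth_pair (Z : premfd R) (f : Z -> X) (g : Z -> Y) z : premanifold Z ->
  smooth_at f z -> smooth_at g z ->
  smooth_at ((fun t => (f t, g t)) : Z -> prod_mfd X Y) z.
Proof.
move=> pZ /(smooth_atP pZ)[c [ac nc sc]] /(smooth_atP pZ)[d [ad nd sd]].
apply/(smooth_atP pZ); exists (prod_chart c d); split.
- by exists c => //; exists d.
- exact: mnearI.
- move=> j /=; case: (split_ordP j) => k ->.
    by under eq_fun do rewrite row_mxEl.
  by under eq_fun do rewrite row_mxEr.
Qed.

End Product.
End Charts.

(** * Vector bundles and their duals *)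

Section Fibres.
Variables (R : realType).

Section Dot.
Variable n : nat.
Implicit Types x y : 'rV[R]_n.

Definition dot x y := \sum_j x 0 j * y 0 j.

Lemma dotC x y : dot x y = dot y x.
Proof. by apply: eq_bigr => j _; rewrite mulrC. Qed.

Lemma dotP a x x' y : dot (a *: x + x') y = a * dot x y + dot x' y.
Proof.
by rewrite /dot mulr_sumr -big_split; apply: eq_bigr => j _; rewrite !mxE mulrDl mulrA.
Qed.

Lemma dotDl x x' y : dot (x + x') y = dot x y + dot x' y.
Proof. by rewrite -[x]scale1r dotP mul1r scale1r. Qed.

Lemma dot0l y : dot 0 y = 0.
Proof. by rewrite /dot big1 // => j _; rewrite mxE mul0r. Qed.

Lemma dotZl a x y : dot (a *: x) y = a * dot x y.
Proof. by rewrite -[a *: x]addr0 dotP dot0l addr0. Qed.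

Lemma dotNl x y : dot (- x) y = - dot x y.
Proof. by rewrite -scaleN1r dotZl mulN1r. Qed.

Lemma dotDr x y y' : dot x (y + y') = dot x y + dot x y'.
Proof. by rewrite dotC dotDl !(dotC x). Qed.

Lemma dotZr a x y : dot x (a *: y) = a * dot x y.
Proof. by rewrite dotC dotZl (dotC x). Qed.

Lemma dot0r x : dot x 0 = 0.
Proof. by rewrite dotC dot0l. Qed.

Lemma dot_delta x j : dot x (delta_mx 0 j) = x 0 j.
Proof.
rewrite /dot (bigD1 j)//= mxE !eqxx mulr1 big1 ?addr0// => i ij.
by rewrite mxE eqxx /= (negbTE ij) mulr0.
Qed.

Lemma dot_inj x y : (forall z, dot x z = dot y z) -> x = y.
Proof. by move=> h; apply/rowP => j; rewrite -!dot_delta. Qed.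

Lemma linear_dot (h : 'rV[R]_n -> R) :
  (forall a x y, h (a *: x + y) = a * h x + h y) ->
  forall x, h x = dot (\row_j h (delta_mx 0 j)) x.
Proof.
move=> hl x.
have h0 : h 0 = 0.
  by have := hl (-1) 0 0; rewrite scaler0 addr0 mulN1r addNr.
have hs (I : Type) (r : seq I) (F : I -> R) (G : I -> 'rV[R]_n) :
    h (\sum_(i <- r) F i *: G i) = \sum_(i <- r) F i * h (G i).
  by elim: r => [|i r IH]; rewrite ?big_nil ?big_cons // hl IH.
by rewrite {1}[x]row_sum_delta hs; apply: eq_bigr => j _; rewrite mxE mulrC.
Qed.

End Dot.

Section FibreAlgebra.
Variables (E M : Type) (v : vbstr R E M).
Hypothesis F : fibres_are_vector_spaces v.

Lemma fproj0 m : vproj v (vzero v m) = m.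
Proof. by case: F => -[]. Qed.

Lemma fprojD e f : vproj v e = vproj v f -> vproj v (vadd v e f) = vproj v e.
Proof. by case: F => -[_ h _] _; exact: h. Qed.

Lemma fprojZ a e : vproj v (vscale v a e) = vproj v e.
Proof. by case: F => -[_ _ h] _; exact: h. Qed.

Lemma faddC e f : vproj v e = vproj v f -> vadd v e f = vadd v f e.
Proof. by case: F => _ [[h _ _ _] _]; exact: h. Qed.

Lemma faddA e f h : vproj v e = vproj v f -> vproj v f = vproj v h ->
  vadd v e (vadd v f h) = vadd v (vadd v e f) h.
Proof. by case: F => _ [[_ g _ _] _]; exact: g. Qed.

Lemma fadd0l e m : vproj v e = m -> vadd v (vzero v m) e = e.
Proof. by move=> <-; case: F => _ [[_ _ g _] _]; exact: g. Qed.

Lemma faddN e : vadd v (vscale v (-1) e) e = vzero v (vproj v e).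
Proof. by case: F => _ [[_ _ _ g] _]; exact: g. Qed.

Lemma fscale1 e : vscale v 1 e = e.
Proof. by case: F => _ [_ [g _ _ _]]; exact: g. Qed.

Lemma fscaleA a b e : vscale v a (vscale v b e) = vscale v (a * b) e.
Proof. by case: F => _ [_ [_ g _ _]]; exact: g. Qed.

Lemma fscaleDr a e f : vproj v e = vproj v f ->
  vscale v a (vadd v e f) = vadd v (vscale v a e) (vscale v a f).
Proof. by case: F => _ [_ [_ _ g _]]; exact: g. Qed.

Lemma fscaleDl a b e : vscale v (a + b) e = vadd v (vscale v a e) (vscale v b e).
Proof. by case: F => _ [_ [_ _ _ g]]; exact: g. Qed.

Lemma fscale0 e : vscale v 0 e = vzero v (vproj v e).
Proof. by rewrite -(addNr (1 : R)) fscaleDl fscale1 faddN. Qed.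

Lemma fadd0r e m : vproj v e = m -> vadd v e (vzero v m) = e.
Proof. by move=> em; rewrite faddC ?fproj0 // fadd0l. Qed.

Lemma fscale_zero a m : vscale v a (vzero v m) = vzero v m.
Proof. by rewrite -{1}(fproj0 m) -fscale0 fscaleA mulr0 fscale0 fproj0. Qed.

Lemma fsubK e f : vproj v e = vproj v f ->
  vadd v (vadd v e (vscale v (-1) f)) f = e.
Proof. by move=> ef; rewrite -faddA ?fprojZ // faddN fadd0r. Qed.

Lemma linear_over_mk m f : linear_over v m f -> linear_over v m (restrict_to v m f).
Proof.
move=> lf a e e' em e'm; rewrite /restrict_to.
have pm : vproj v (vadd v (vscale v a e) e') = m by rewrite fprojD fprojZ // em e'm.
by do 3 (case: pselect => [?|//]); exact: lf.
Qed.

Lemma mkcovectorE m f e : linear_over v m f -> vproj v e = m ->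
  coform (mkcovector v m f) e = f e.
Proof.
move=> lf em; rewrite /mkcovector; case: pselect => [l|]; last first.
  by case; exact: linear_over_mk.
by rewrite /= /restrict_to; case: pselect.
Qed.

Lemma cobase_mk m f : cobase (mkcovector v m f) = m.
Proof. by rewrite /mkcovector; case: pselect. Qed.

(** Off the fibre of its base point a covector is 0 by definition, so agreement on the fibre is
    equality of functions; the remaining fields are propositions. *)
Lemma covector_ext (Phi Psi : covector v) : cobase Phi = cobase Psi ->
  (forall e, vproj v e = cobase Phi -> coform Phi e = coform Psi e) -> Phi = Psi.
Proof.
case: Phi Psi => m f fl fo [m' g gl go] /= mm'; subst m' => fg.
have e : f = g.
  apply/funext => e; have [/fg //|ne] := pselect (vproj v e = m).
  by rewrite fo // go.
by subst g; congr Covector; exact: Prop_irrelevance.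
Qed.

Lemma colin (Phi : covector v) a e f m : cobase Phi = m -> vproj v e = m -> vproj v f = m ->
  coform Phi (vadd v (vscale v a e) f) = a * coform Phi e + coform Phi f.
Proof. by move=> <-; exact: coform_linear. Qed.

Lemma coformD (Phi : covector v) e f m : cobase Phi = m -> vproj v e = m -> vproj v f = m ->
  coform Phi (vadd v e f) = coform Phi e + coform Phi f.
Proof. by move=> pm em fm; rewrite -{1}(fscale1 e) (colin _ pm) ?mul1r. Qed.

End FibreAlgebra.

Section TrivAlgebra.
Variables (E M : premfd R) (v : vbstr R E M).
Hypothesis F : fibres_are_vector_spaces v.
Variables (U : set M) (n : nat) (phi : E -> euclid R n) (psi : prod_mfd M (euclid R n) -> E).
Hypothesis T : trivialization v U phi psi.
Implicit Types x y : 'rV[R]_n.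

Lemma tprojK m x : U m -> vproj v (psi (m, x)) = m.
Proof. exact: (triv_projK T (p := (m, x))). Qed.

Lemma tcoordK m x : U m -> phi (psi (m, x)) = x.
Proof. exact: (triv_coordK T (p := (m, x))). Qed.

Lemma tinvK e m : U m -> vproj v e = m -> psi (m, phi e) = e.
Proof. by move=> Um em; rewrite -em in Um *; exact: (triv_invK T). Qed.

Lemma triv_phi_inj e f : U (vproj v e) -> vproj v e = vproj v f -> phi e = phi f -> e = f.
Proof. by move=> Ue ef pef; rewrite -(tinvK Ue erefl) pef tinvK. Qed.

Lemma triv_psiD m x y : U m -> vadd v (psi (m, x)) (psi (m, y)) = psi (m, x + y).
Proof.
move=> Um; have pm : vproj v (vadd v (psi (m, x)) (psi (m, y))) = m.
  by rewrite fprojD ?tprojK.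
apply: triv_phi_inj; rewrite ?pm ?tprojK //.
by rewrite (triv_add T) ?tprojK // !tcoordK.
Qed.

Lemma triv_psiZ m a x : U m -> vscale v a (psi (m, x)) = psi (m, a *: x).
Proof.
move=> Um; have pm : vproj v (vscale v a (psi (m, x))) = m.
  by rewrite fprojZ ?tprojK.
apply: triv_phi_inj; rewrite ?pm ?tprojK //.
by rewrite (triv_scale T) ?tprojK // !tcoordK.
Qed.

Lemma triv_psi0 m : U m -> vzero v m = psi (m, 0).
Proof.
by move=> Um; rewrite -(scale0r 0) -triv_psiZ // fscale0 // tprojK.
Qed.

Lemma triv_psiP m a x y : U m ->
  vadd v (vscale v a (psi (m, x))) (psi (m, y)) = psi (m, a *: x + y).
Proof. by move=> Um; rewrite triv_psiZ // triv_psiD. Qed.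

Lemma triv_phiP m a e f : U m -> vproj v e = m -> vproj v f = m ->
  phi (vadd v (vscale v a e) f) = a *: (phi e : 'rV[R]_n) + (phi f : 'rV[R]_n).
Proof.
move=> Um em fm; rewrite (triv_add T) ?fprojZ ?em ?fm //.
by rewrite (triv_scale T) ?em.
Qed.

Lemma linear_over_psi m (f : E -> R) : U m -> linear_over v m f ->
  forall a x y, f (psi (m, a *: x + y)) = a * f (psi (m, x)) + f (psi (m, y)).
Proof. by move=> Um lf a x y; rewrite -triv_psiP // lf ?tprojK. Qed.

Lemma linear_over_dot m (f : E -> R) y : U m -> linear_over v m f ->
  f (psi (m, y)) = dot (\row_j f (psi (m, delta_mx 0 j))) y.
Proof.
move=> Um lf; exact: (linear_dot (h := fun y => f (psi (m, y))) (linear_over_psi Um lf)).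
Qed.

(** Coordinates with respect to the dual frame. With the inverse [dvec] they form the trivialization
    of the dual bundle attached to ([phi], [psi]), as [dual_triv] verifies. *)
Definition dcoord (Phi : dual_mfd v) : euclid R n :=
  \row_j coform Phi (psi (cobase Phi, delta_mx 0 j)).

Definition dvec (p : prod_mfd M (euclid R n)) : dual_mfd v :=
  mkcovector v p.1 (fun e => dot p.2 (phi e)).

Lemma dot_linear_over m (y : 'rV[R]_n) : U m -> linear_over v m (fun e => dot y (phi e)).
Proof.
by move=> Um a e f em fm; rewrite (triv_phiP _ Um) // dotDr dotZr.
Qed.

Lemma dvecE m y e : U m -> vproj v e = m -> coform (dvec (m, y)) e = dot y (phi e).
Proof. by move=> Um em; rewrite mkcovectorE //; exact: dot_linear_over. Qed.

Lemma cobase_dvec p : cobase (dvec p) = p.1.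
Proof. exact: cobase_mk. Qed.

Lemma dcoordE (Phi : dual_mfd v) m x : U m -> cobase Phi = m ->
  coform Phi (psi (m, x)) = dot (dcoord Phi) x.
Proof.
move=> Um pm; subst m; apply: linear_over_dot => //; exact: coform_linear.
Qed.

Lemma dcoordK m y : U m -> dcoord (dvec (m, y)) = y.
Proof.
move=> Um; apply/rowP => j; rewrite mxE cobase_dvec dvecE ?tprojK //.
by rewrite tcoordK // dot_delta.
Qed.

Lemma dcoord_inj (Phi Psi : dual_mfd v) : U (cobase Phi) -> cobase Phi = cobase Psi ->
  dcoord Phi = dcoord Psi -> Phi = Psi.
Proof.
move=> Up pp pq; apply: covector_ext => // e em.
by rewrite -(tinvK Up em) (dcoordE _ Up) // (dcoordE _ Up) // pq.
Qed.

Lemma dvecK (Phi : dual_mfd v) : U (cobase Phi) -> dvec (cobase Phi, dcoord Phi) = Phi.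
Proof.
move=> Up; apply: dcoord_inj; rewrite ?cobase_dvec //.
by rewrite dcoordK.
Qed.

End TrivAlgebra.

Section DualFibres.
Variables (E M : premfd R) (v : vbstr R E M).
Hypothesis F : fibres_are_vector_spaces v.

Lemma dual_add_lin (Phi Psi : covector v) : cobase Phi = cobase Psi ->
  linear_over v (cobase Phi) (fun e => coform Phi e + coform Psi e).
Proof.
move=> pp a e f em fm; rewrite (colin _ erefl) // (colin _ (esym pp)) //.
by rewrite mulrDr addrACA.
Qed.

Lemma dual_scale_lin a (Phi : covector v) :
  linear_over v (cobase Phi) (fun e => a * coform Phi e).
Proof.
move=> b e f em fm; rewrite (colin _ erefl) // mulrDr; congr (_ + _).
by rewrite mulrCA.
Qed.

Lemma dual_addE (Phi Psi : dual_mfd v) e m : cobase Phi = m -> cobase Psi = m ->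
  vproj v e = m ->
  coform (vadd (dual_str v) Phi Psi : covector v) e = coform Phi e + coform Psi e.
Proof.
move=> pm qm em; rewrite /= mkcovectorE ?pm //; subst m.
exact: dual_add_lin.
Qed.

Lemma dual_scaleE a (Phi : dual_mfd v) e m : cobase Phi = m -> vproj v e = m ->
  coform (vscale (dual_str v) a Phi : covector v) e = a * coform Phi e.
Proof. by move=> pm em; rewrite /= mkcovectorE ?pm // -pm; exact: dual_scale_lin. Qed.

Lemma dual_zeroE e m : vproj v e = m ->
  coform (vzero (dual_str v) m : covector v) e = 0.
Proof. by move=> em; rewrite /= mkcovectorE //; exact: zero_linear_over. Qed.

Lemma dual_cobaseD (Phi Psi : dual_mfd v) :
  cobase (vadd (dual_str v) Phi Psi : covector v) = cobase Phi.
Proof. exact: cobase_mk. Qed.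

Lemma dual_cobaseZ a (Phi : dual_mfd v) :
  cobase (vscale (dual_str v) a Phi : covector v) = cobase Phi.
Proof. exact: cobase_mk. Qed.

Lemma dual_cobase0 m : cobase (vzero (dual_str v) m : covector v) = m.
Proof. exact: cobase_mk. Qed.

Lemma dual_fibres : fibres_are_vector_spaces (dual_str v).
Proof.
split; first split.
- exact: dual_cobase0.
- by move=> Phi Psi _; exact: dual_cobaseD.
- exact: dual_cobaseZ.
split; split.
- move=> Phi Psi pp; apply: covector_ext; rewrite ?dual_cobaseD // => e em.
  by rewrite !(dual_addE (m := cobase Phi)) // addrC.
- move=> Phi Psi Xi pp px; have px' : cobase Phi = cobase Xi by exact: etrans px.
  apply: covector_ext; rewrite !dual_cobaseD // => e em.
  by rewrite !(dual_addE (m := cobase Phi)) ?dual_cobaseD // addrA.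
- move=> Phi; apply: covector_ext; rewrite ?dual_cobaseD dual_cobase0 // => e em.
  by rewrite (dual_addE (m := cobase Phi)) ?dual_cobase0 // dual_zeroE // add0r.
- move=> Phi; apply: covector_ext; rewrite dual_cobaseD dual_cobaseZ ?dual_cobase0 // => e em.
  rewrite (dual_addE (m := cobase Phi)) ?dual_cobaseZ // dual_zeroE //.
  by rewrite (dual_scaleE _ (m := cobase Phi)) // mulN1r addNr.
- move=> Phi; apply: covector_ext; rewrite dual_cobaseZ // => e em.
  by rewrite (dual_scaleE _ (m := cobase Phi)) // mul1r.
- move=> a b Phi; apply: covector_ext; rewrite !dual_cobaseZ // => e em.
  by rewrite !(dual_scaleE _ (m := cobase Phi)) ?dual_cobaseZ // mulrA.
- move=> a Phi Psi pp.
  apply: covector_ext; rewrite !(dual_cobaseZ, dual_cobaseD) // => e em.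
  rewrite (dual_scaleE _ (m := cobase Phi)) ?dual_cobaseD //.
  by rewrite !(dual_addE (m := cobase Phi)) ?dual_cobaseZ //
     !(dual_scaleE _ (m := cobase Phi)) // mulrDr.
- move=> a b Phi; apply: covector_ext; rewrite !(dual_cobaseZ, dual_cobaseD) // => e em.
  by rewrite !(dual_addE (m := cobase Phi)) ?dual_cobaseZ //
     !(dual_scaleE _ (m := cobase Phi)) // mulrDl.
Qed.

End DualFibres.
End Fibres.

(** * Smoothness of the bundle operations and charts of the dual bundle *)

Section BundleSmooth.
Variables (R : realType) (E M : premfd R) (v : vbstr R E M).
Hypothesis V : is_vb v.

Let F := vb_fibres V.
Let pE := manifold_premanifold (vb_total V).
Let pM := manifold_premanifold (vb_base V).

Section Triv.
Variables (U : set M) (n : nat) (phi : E -> euclid R n) (psi : prod_mfd M (euclid R n) -> E).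
Hypothesis T : trivialization v U phi psi.

Section Along.
Variables (X : premfd R) (x : X).
Hypothesis pX : premanifold X.

Lemma smooth_psi (f : X -> M) (y : X -> euclid R n) : U (f x) ->
  smooth_at f x -> smooth_at y x -> smooth_at (fun t => psi (f t, y t)) x.
Proof.
move=> Uf sf sy; have pE' := premanifold_euclid R n.
apply: (smooth_comp pX (premanifold_prod pM pE') (smooth_pair pX sf sy)).
exact: (triv_inv_smooth T).
Qed.

Lemma smooth_phi (h : X -> E) : U (vproj v (h x)) -> smooth_at h x ->
  smooth_at (fun t => phi (h t)) x.
Proof. by move=> Uh sh; apply: (smooth_comp pX pE sh); exact: (triv_smooth T). Qed.

End Along.
End Triv.

Section Along.
Variables (X : premfd R) (x : X).
Hypothesis pX : premanifold X.

Lemma smooth_vproj (h : X -> E) : smooth_at h x -> smooth_at (fun t => vproj v (h t)) x.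
Proof. by move=> sh; apply: (smooth_comp pX pE sh); exact: (vb_proj_smooth V). Qed.

Lemma mnear_in (U : set M) (f : X -> M) : mopen U -> U (f x) -> smooth_at f x ->
  mnear x (fun t => U (f t)).
Proof. by move=> oU Uf sf; apply: (mnear_comp pM sf); exact: mopen_mnear. Qed.

Lemma smooth_vadd (f g : X -> E) : smooth_at f x -> smooth_at g x ->
  mnear x (fun t => vproj v (f t) = vproj v (g t)) ->
  smooth_at (fun t => vadd v (f t) (g t)) x.
Proof.
move=> sf sg fg; have [U [n [phi [psi [Ux T]]]]] := vb_triv V (vproj v (f x)).
have nU := mnear_in (triv_open T) Ux (smooth_vproj sf).
have fgx : vproj v (f x) = vproj v (g x) := mnear_self fg.
have s : smooth_at (fun t => psi (vproj v (f t),
    (phi (f t) : 'rV[R]_n) + (phi (g t) : 'rV[R]_n))) x.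
  apply: (smooth_psi T pX) => //; first exact: smooth_vproj.
  apply/(smooth_euclidP pX) => j; under eq_fun do rewrite mxE.
  have /(smooth_euclidP pX)/(_ j) h1 := smooth_phi T pX Ux sf.
  have Ug : U (vproj v (g x)) by rewrite -fgx.
  have /(smooth_euclidP pX)/(_ j) h2 := smooth_phi T pX Ug sg.
  exact: rsmoothD.
apply: smooth_ext s => //; apply: mnearS (mnearI pX nU fg) => t [Ut fgt].
rewrite -(triv_add T) // (tinvK T) //.
exact: fprojD.
Qed.

Lemma smooth_vscale (s : X -> R) (f : X -> E) : rsmooth s x -> smooth_at f x ->
  smooth_at (fun t => vscale v (s t) (f t)) x.
Proof.
move=> ss sf; have [U [n [phi [psi [Ux T]]]]] := vb_triv V (vproj v (f x)).
have nU := mnear_in (triv_open T) Ux (smooth_vproj sf).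
have sm : smooth_at (fun t => psi (vproj v (f t), s t *: (phi (f t) : 'rV[R]_n))) x.
  apply: (smooth_psi T pX) => //; first exact: smooth_vproj.
  apply/(smooth_euclidP pX) => j; under eq_fun do rewrite mxE.
  have /(smooth_euclidP pX)/(_ j) h1 := smooth_phi T pX Ux sf.
  exact: rsmoothM.
apply: smooth_ext sm => //; apply: mnearS nU => t Ut.
by rewrite -(triv_scale T) // (tinvK T) // fprojZ.
Qed.

Lemma smooth_vzero (f : X -> M) : smooth_at f x -> smooth_at (fun t => vzero v (f t)) x.
Proof.
move=> sf; have [U [n [phi [psi [Ux T]]]]] := vb_triv V (f x).
have nU := mnear_in (triv_open T) Ux sf.
have sm : smooth_at (fun t => psi (f t, 0 : 'rV[R]_n)) x.
  apply: (smooth_psi T pX) => //.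
  by apply/(smooth_euclidP pX) => j; exact: rsmooth_cst.
apply: smooth_ext sm => //; apply: mnearS nU => t Ut.
by rewrite -(triv_psi0 F T).
Qed.

End Along.

Lemma mopenI (O O' : set M) : mopen O -> mopen O' -> mopen (O `&` O').
Proof.
move=> oO oO'; apply: mopenP => // x [Ox O'x].
by apply: mnearI => //; exact: mopen_mnear.
Qed.

Lemma mopen_chart (c : chart R M) : atlas M c -> mopen (cdom c).
Proof. by move=> ac; apply: mopenP => // x cx; exact: mnear_chartdom. Qed.

Lemma triv_restrict (U U' : set M) n (phi : E -> euclid R n) psi :
  mopen U' -> U' `<=` U -> trivialization v U phi psi -> trivialization v U' phi psi.
Proof. by move=> oU' UU' [? ? ? ? ? ? ? ?]; split; auto. Qed.

Section DualChart.
Variables (c : chart R M) (U : set M) (n : nat) (phi : E -> euclid R n)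
  (psi : prod_mfd M (euclid R n) -> E).
Hypotheses (ac : atlas M c) (T : trivialization v U phi psi).

Local Notation dc := (dual_chart v c U psi).

Lemma dual_chart_atlas : atlas (dual_mfd v) dc.
Proof. by exists c, U, n, phi, psi. Qed.

Lemma dual_chart_inj (Phi Psi : covector v) : cdom dc Phi -> cdom dc Psi ->
  cmap dc Phi = cmap dc Psi -> Phi = Psi.
Proof.
move=> [cp Up] [cq Uq] /eq_row_mx[/(pm_inj pM ac cp cq) pq e].
exact: (dcoord_inj F T).
Qed.

Lemma cnear_cobase (Phi : covector v) P : U (cobase Phi) ->
  cnear c (cobase Phi) P -> cnear dc Phi (fun Psi => P (cobase Psi)).
Proof.
move=> Up [cp nP]; split; first by split.
have : \forall w \near cmap dc Phi, forall y, cdom c y -> cmap c y = lsubmx w -> P y.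
  have := @lsubmx_continuous R (cdim c) n (cmap dc Phi).
  by rewrite /continuous_at row_mxKl => C; exact: (C _ nP).
by apply: filterS => w h Psi [cq Uq] e; apply: h => //; rewrite -e row_mxKl.
Qed.

Lemma csmooth_cobase (Phi : covector v) f : U (cobase Phi) ->
  csmooth c f (cobase Phi) -> csmooth dc (fun Psi => f (cobase Psi)) Phi.
Proof.
move=> Up [g [sg ng]]; exists (fun w => g (lsubmx w)); split; first exact: gsmooth_lsub.
by apply: cnearS (cnear_cobase Up ng) => Psi _ /= ->; rewrite row_mxKl.
Qed.

Lemma csmooth_frame (Phi : covector v) j : cdom dc Phi ->
  csmooth dc (fun Psi => coform Psi (psi (cobase Psi, delta_mx 0 j))) Phi.
Proof.
move=> dp; have := @csmooth_coord _ _ dc _ (rshift (cdim c) j) dp.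
by apply: csmooth_ext; apply: cnear_true => // Psi _; rewrite /= row_mxEr mxE.
Qed.

End DualChart.

(** The image is the product of an open set of base coordinates with the whole of R^n, because
    [dvec] realizes every row of components. *)
Lemma dual_chart_image (c : chart R M) (U U' : set M) n (phi : E -> euclid R n) psi :
  atlas M c -> trivialization v U phi psi -> mopen U' ->
  open (cmap (dual_chart v c U psi) @`
    (cdom (dual_chart v c U psi) `&` [set Phi | U' (cobase Phi)])).
Proof.
move=> ac T oU'; have oW : open (cmap c @` (cdom c `&` (U `&` U'))).
  by apply: mopenI => //; exact: (triv_open T).
have := open_image_row oW (openT : open [set: 'rV[R]_n]).
suff -> : [set w | (cmap c @` (cdom c `&` (U `&` U'))) (lsubmx w) /\ setT (rsubmx w)] =
    cmap (dual_chart v c U psi) @`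
    (cdom (dual_chart v c U psi) `&` [set Phi | U' (cobase Phi)]) by [].
apply/seteqP; split => [w /= [[m [cm [Um U'm]] mw] _]|w [Phi /= [[cp Up] U'p] <-]].
  exists (dvec v phi (m, rsubmx w)); rewrite ?cobase_dvec //=.
  rewrite mw; have /= := dcoordK F T (rsubmx w) Um.
  by rewrite /dcoord cobase_dvec /= => ->; rewrite hsubmxK.
by rewrite row_mxKl; split => //; exists (cobase Phi).
Qed.

(** On an overlap the components of a covector in the new frame are linear combinations of the old
    ones; the coefficients are the old coordinates of the new frame, which are smooth functions on
    the base. *)
Lemma premanifold_dual : premanifold (dual_mfd v).
Proof.
split.
- by move=> _ [c [U [n [phi [psi [ac T ->]]]]]] Phi Psi; exact: (dual_chart_inj ac T).
- move=> _ _ [c [U [n [phi [psi [ac T ->]]]]]] [c' [U' [n' [phi' [psi' [ac' T' ->]]]]]].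
  apply: chart_compatP; first by move=> Phi Psi; exact: (dual_chart_inj ac T).
    apply: (@dual_chart_image c U (cdom c' `&` U') n phi psi ac T).
    by apply: mopenI; [exact: mopen_chart|exact: (triv_open T')].
  move=> Phi j dp [c'p U'p]; have [cp Up] := dp.
  case: (split_ordP j) => k -> /=.
    have s : csmooth (dual_chart v c U psi) (fun Psi : covector v => cmap c' (cobase Psi) 0 k) Phi.
      apply: (csmooth_cobase _ Up (f := fun m => cmap c' m 0 k)).
      by apply: (rsmooth_chart pM ac cp); exact: rsmooth_coord.
    by apply: csmooth_ext s; apply: cnear_true => // Psi _; rewrite row_mxEl.
  suff : csmooth (dual_chart v c U psi)
      (fun Psi : covector v => coform Psi (psi' (cobase Psi, delta_mx 0 k))) Phi.
    by apply: csmooth_ext; apply: cnear_true => // Psi _; rewrite row_mxEr mxE.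
  have s i : csmooth (dual_chart v c U psi) (fun Psi : covector v =>
      coform Psi (psi (cobase Psi, delta_mx 0 i)) *
      (phi (psi' (cobase Psi, delta_mx 0 k)) : 'rV[R]_n) 0 i) Phi.
    apply: csmoothM; first exact: csmooth_frame.
    apply: (csmooth_cobase _ Up (f := fun m => (phi (psi' (m, delta_mx 0 k)) : 'rV[R]_n) 0 i)).
    apply: (rsmooth_chart pM ac cp).
    have sp : smooth_at (fun m => psi' (m, delta_mx 0 k)) (cobase Phi).
      apply: (smooth_psi T' pM) => //; first exact: smooth_idP.
      by apply: smooth_cst => //; exact: premanifold_euclid.
    have Up' : U (vproj v (psi' (cobase Phi, delta_mx 0 k))) by rewrite (tprojK T').
    by have /(smooth_euclidP pM) := smooth_phi T pM Up' sp; apply.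
  have sS : csmooth (dual_chart v c U psi) (fun Psi : covector v => \sum_(i <- enum 'I_n)
      coform Psi (psi (cobase Psi, delta_mx 0 i)) *
      (phi (psi' (cobase Psi, delta_mx 0 k)) : 'rV[R]_n) 0 i) Phi.
    elim: (enum _) => [|i r IH].
      by under eq_fun do rewrite big_nil; exact: csmooth_cst.
    by under eq_fun do rewrite big_cons; exact: csmoothD.
  apply: csmooth_ext sS.
  have nU' : cnear c (cobase Phi) U'.
    by apply: mnear_chart => //; apply: mopen_mnear => //; exact: (triv_open T').
  apply: cnearS (cnear_cobase _ Up nU') => Psi [cq Uq] U'q.
  rewrite big_enum /=.
  have -> : psi' (cobase Psi, delta_mx 0 k) =
      psi (cobase Psi, phi (psi' (cobase Psi, delta_mx 0 k))).
    by rewrite (tinvK T) // (tprojK T').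
  rewrite (dcoordE F T _ Uq erefl); apply: eq_bigr => i _.
  by rewrite mxE (tcoordK T).
- move=> Phi; have [c [ac cp]] := pm_cover pM (cobase Phi).
  have [U [n [phi [psi [Ux T]]]]] := vb_triv V (cobase Phi).
  by exists (dual_chart v c U psi); split => //; exact: (dual_chart_atlas ac T).
Qed.

Lemma smooth_cobase (Phi : dual_mfd v) : smooth_at (@cobase R E M v : dual_mfd v -> M) Phi.
Proof.
have [c [ac cp]] := pm_cover pM (cobase Phi).
have [U [n [phi [psi [Ux T]]]]] := vb_triv V (cobase Phi).
have at' := dual_chart_atlas ac T.
apply/(smooth_atP premanifold_dual); exists c; split => //.
  exists (dual_chart v c U psi); split => //; apply: cnear_cobase => //.
  exact: cnear_true.
move=> j; exists (dual_chart v c U psi); split => //.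
by apply: (csmooth_cobase _ Ux (f := fun m => cmap c m 0 j)); exact: csmooth_coord.
Qed.

Section AlongDual.
Variables (X : premfd R) (x : X) (G : X -> dual_mfd v).
Hypothesis pX : premanifold X.

(** A chart of the dual records the base point and the values on one frame, so a map into the dual
    is tested on exactly these. *)
Lemma smooth_to_dual U n (phi : E -> euclid R n) psi : trivialization v U phi psi ->
  U (cobase (G x)) -> smooth_at (fun t => cobase (G t)) x ->
  (forall j, rsmooth (fun t => coform (G t) (psi (cobase (G t), delta_mx 0 j))) x) ->
  smooth_at G x.
Proof.
move=> T Ux sc sf; have [c [ac cp]] := pm_cover pM (cobase (G x)).
apply/(smooth_atP pX); exists (dual_chart v c U psi); split.
- exact: (dual_chart_atlas ac T).
- have n1 := mnear_in (f := fun t => cobase (G t)) (triv_open T) Ux sc.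
  have n2 := mnear_in (f := fun t => cobase (G t)) (mopen_chart ac) cp sc.
  by apply: mnearS (mnearI pX n2 n1) => t [].
- move=> j /=; case: (split_ordP j) => k ->.
    under eq_fun do rewrite row_mxEl.
    by apply: (rsmooth_comp pX pM sc (k := fun m => cmap c m 0 k)); exact: rsmooth_coord.
  by under eq_fun do rewrite row_mxEr mxE.
Qed.

Lemma smooth_dframe U n (phi : E -> euclid R n) psi j : trivialization v U phi psi ->
  smooth_at G x -> U (cobase (G x)) ->
  rsmooth (fun t => coform (G t) (psi (cobase (G t), delta_mx 0 j))) x.
Proof.
move=> T sG Ux; have [c [ac cp]] := pm_cover pM (cobase (G x)).
apply: (rsmooth_comp pX premanifold_dual sG
  (k := fun Phi : covector v => coform Phi (psi (cobase Phi, delta_mx 0 j)))).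
exists (dual_chart v c U psi); split; first exact: (dual_chart_atlas ac T).
exact: csmooth_frame.
Qed.

(** In a frame the value is the finite sum of the components of G times the coordinates of h. *)
Lemma smooth_eval (h : X -> E) : smooth_at G x -> smooth_at h x ->
  mnear x (fun t => vproj v (h t) = cobase (G t)) ->
  rsmooth (fun t => coform (G t) (h t)) x.
Proof.
move=> sG sh gh; have ghx := mnear_self gh.
have [U [n [phi [psi [Ux T]]]]] := vb_triv V (cobase (G x)).
have sc : smooth_at (fun t => cobase (G t)) x.
  by apply: (smooth_comp pX premanifold_dual sG); exact: smooth_cobase.
have nU := mnear_in (f := fun t => cobase (G t)) (triv_open T) Ux sc.
have s : rsmooth (fun t => \sum_(j < n) coform (G t) (psi (cobase (G t), delta_mx 0 j)) *
    (phi (h t) : 'rV[R]_n) 0 j) x.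
  apply: rsmooth_sum => // j; apply: rsmoothM => //; first exact: (smooth_dframe j T).
  have Uh : U (vproj v (h x)) by rewrite ghx.
  by have /(smooth_euclidP pX) := smooth_phi T pX Uh sh; apply.
apply: rsmooth_ext s => //; apply: mnearS (mnearI pX nU gh) => t [Ut e].
rewrite -{2}(tinvK T Ut e) (dcoordE F T _ Ut erefl).
by apply: eq_bigr => i _; rewrite mxE.
Qed.

End AlongDual.

Lemma dual_triv U n (phi : E -> euclid R n) psi : trivialization v U phi psi ->
  trivialization (dual_str v) U (dcoord psi) (dvec v phi).
Proof.
move=> T; have pD := premanifold_dual; have pn := premanifold_euclid R n; split.
- exact: (triv_open T).
- move=> Phi Up; apply/(smooth_euclidP pD) => j; under eq_fun do rewrite mxE.
  exact: (smooth_dframe (G := fun x => x) pD j T (smooth_idP pD Phi) Up).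
- move=> [m y] /= Um; have pP := premanifold_prod pM pn.
  have sc : smooth_at (fun t : prod_mfd M (euclid R n) => cobase (dvec v phi t)) (m, y).
    under eq_fun do rewrite cobase_dvec; exact: smooth_fst.
  apply: (smooth_to_dual pP T) => //; first by rewrite cobase_dvec.
  move=> j; have /(smooth_euclidP pP)/(_ j) := smooth_snd pM pn (m, y).
  apply: rsmooth_ext => //; have := mnear_in (triv_open T) _ sc.
  rewrite cobase_dvec => /(_ Um); apply: mnearS => -[m' y']; rewrite cobase_dvec /= => Um'.
  by rewrite (dvecE F T) ?(tprojK T) // (tcoordK T) // dot_delta.
- by move=> p Up /=; rewrite cobase_dvec.
- by move=> [m y] Um; rewrite (dcoordK F T).
- by move=> Phi Up; rewrite (dvecK F T).
- move=> Phi Psi Up /= pq; apply/rowP => j; rewrite !mxE cobase_mk.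
  by rewrite (dual_addE F (m := cobase Phi)) ?(tprojK T) // pq.
- move=> a Phi Up /=; apply/rowP => j; rewrite !mxE cobase_mk.
  by rewrite (dual_scaleE F _ (m := cobase Phi)) ?(tprojK T).
Qed.

End BundleSmooth.

(** * Hausdorff and countability axioms for the dual bundle *)

Section Topology.
Variable R : realType.

Lemma row_separated n (a b : 'rV[R]_n) : a <> b ->
  exists A B : set 'rV[R]_n, [/\ open A, open B, A a, B b & A `&` B = set0].
Proof.
move=> ab; have e0 : 0 < `|a - b| / 2.
  by rewrite divr_gt0 // normr_gt0 subr_eq0; exact/eqP.
exists (ball a (`|a - b| / 2)), (ball b (`|a - b| / 2)); split.
- exact: ball_open.
- exact: ball_open.
- exact: ballxx.
- exact: ballxx.
- apply/seteqP; split => // z [az bz].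
  have := ball_splitl az bz.
  by rewrite -ball_normE /ball_ /= ltxx.
Qed.

(** Points over different base points are separated by preimages of open sets of the base; two
    points of one fibre share a chart and are separated inside it. *)
Lemma hausdorff_fibred (X M : premfd R) (p : X -> M) : premanifold X -> is_manifold M ->
  smooth p -> (forall x y, p x = p y -> exists c, [/\ atlas X c, cdom c x & cdom c y]) ->
  forall x y : X, x <> y -> exists O O' : set X,
    [/\ mopen O, mopen O', O x, O' y & O `&` O' = set0].
Proof.
move=> pX mM sp common x y xy; have pM := manifold_premanifold mM.
have [pxy|pxy] := pselect (p x = p y).
  have [c [ac cx cy]] := common _ _ pxy.
  have cxy : cmap c x <> cmap c y by move=> /(pm_inj pX ac cx cy).
  have [A [B [oA oB Ax By AB]]] := row_separated cxy.
  have oC (C : set _) : open C -> mopen [set z : X | cdom c z /\ C (cmap c z)].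
    move=> oC; apply: mopenP => // z [cz Cz]; exists c; split => //.
    have nC : \forall w \near cmap c z, C w by apply: open_nbhs_nbhs.
    exact: cnearS (cnear_map cz nC).
  exists [set z : X | cdom c z /\ A (cmap c z)], [set z : X | cdom c z /\ B (cmap c z)].
  split; rewrite //=; try exact: oC.
  apply/seteqP; split => // z [[_ Az] [_ Bz]].
  by have : (A `&` B) (cmap c z) by []; rewrite AB.
have [A [B [oA oB Ax By AB]]] := mfd_hausdorff mM pxy.
have oC (C : set M) : mopen C -> mopen [set z : X | C (p z)].
  move=> oC; apply: mopenP => // z Cz; apply: (mnear_comp pM (sp z)).
  exact: mopen_mnear.
exists [set z : X | A (p z)], [set z : X | B (p z)]; split; rewrite //=; try exact: oC.
apply/seteqP; split => // z [Az Bz].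
by have : (A `&` B) (p z) by []; rewrite AB.
Qed.

Lemma rat_ball n (w : 'rV[R]_n) e : 0 < e -> exists (q : 'rV[rat]_n) (r : rat),
  ball (map_mx ratr q : 'rV[R]_n) (ratr r) w /\
  ball (map_mx ratr q : 'rV[R]_n) (ratr r) `<=` ball w e.
Proof.
move=> e0; have e2 : 0 < e / 2 by rewrite divr_gt0.
have [r] := rat_in_itvoo e2; rewrite in_itv /= => /andP[r0 re].
have ex j : exists q : rat, `|w 0 j - ratr q| < ratr r.
  have lt : w 0 j - ratr r < w 0 j + ratr r.
    by rewrite ltrD2l (lt_trans _ r0) // oppr_lt0.
  have [q] := rat_in_itvoo lt; rewrite in_itv /= => /andP[q1 q2].
  exists q; rewrite ltr_norml; apply/andP; split.
    by rewrite ltrBrDl -ltrBrDr opprK.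
  by rewrite ltrBlDl -ltrBlDr.
have [q hq] := choice ex.
exists (\row_j q j), r.
have b : ball (map_mx ratr (\row_j q j) : 'rV[R]_n) (ratr r) w.
  split => // i j; rewrite (ord1 i) !mxE; apply: ball_sym.
  by rewrite -ball_normE; exact: hq.
split => // z bz; apply: (@le_ball _ _ w (ratr r + ratr r)).
  by rewrite (splitr e) lerD ?ltW.
exact: ball_triangle (ball_sym b) bz.
Qed.

(** The base consists of the balls with rational centre and radius in countably many charts. The
    code is decoded in two stages because the type of the centre depends on the dimension of the
    chart selected first. *)
Lemma second_countable_charts (X : premfd R) (A : nat -> Prop) (c : nat -> chart R X) :
  premanifold X -> (forall n, A n -> atlas X (c n)) ->
  (forall x, exists n, A n /\ cdom (c n) x) ->
  exists W : nat -> set X, (forall n, mopen (W n)) /\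
    forall O, mopen O -> forall x, O x -> exists n, W n x /\ W n `<=` O.
Proof.
move=> pX ac cov.
pose W k := [set x | exists n l (q : 'rV[rat]_(cdim (c n))) (r : rat),
  [/\ unpickle k = Some (n, l), unpickle l = Some (q, r) , A n, cdom (c n) x &
     ball (map_mx ratr q : 'rV[R]__) (ratr r) (cmap (c n) x)]].
exists W; split.
  move=> k; apply: mopenP => // x [n [l [q [r [e1 e2 An cx b]]]]].
  exists (c n); split; first exact: ac.
  have nb : \forall w \near cmap (c n) x, ball (map_mx ratr q : 'rV[R]__) (ratr r) w.
    by apply: open_nbhs_nbhs; split => //; exact: ball_open.
  apply: cnearS (cnear_map cx nb) => y cy by_.
  by exists n, l, q, r.
move=> V oV x Vx; have [n [An cx]] := cov x.
have : nbhs (cmap (c n) x) (cmap (c n) @` (cdom (c n) `&` V)).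
  by apply: open_nbhs_nbhs; split; [exact/oV/ac|exists x].
move=> /nbhs_ballP[e /= e0 eV].
have [q [r [b1 b2]]] := rat_ball (cmap (c n) x) e0.
exists (pickle (n, pickle (q, r))); split.
  by exists n, (pickle (q, r)), q, r; rewrite !pickleK.
move=> y [n' [l [q' [r' [+ + An' cy b']]]]]; rewrite pickleK => -[? ?]; subst n' l.
rewrite pickleK => -[? ?]; subst q' r'.
have [z [cz Vz] zy] := eV _ (b2 _ b').
by rewrite -(pm_inj pX (ac _ An) cz cy zy).
Qed.

Lemma dual_manifold (E M : premfd R) (v : vbstr R E M) : is_vb v ->
  is_manifold (dual_mfd v).
Proof.
move=> V; have pD := premanifold_dual V; have mM := vb_base V; have pM := manifold_premanifold mM.
split.
- exact: pm_inj.
- exact: pm_compat.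
- exact: pm_cover.
- apply: (hausdorff_fibred pD mM (smooth_cobase V)) => Phi Psi pq.
  have [c [ac cp]] := pm_cover pM (cobase Phi).
  have [U [n [phi [psi [Ux T]]]]] := vb_triv V (cobase Phi).
  exists (dual_chart v c U psi); split; first exact: (dual_chart_atlas ac T).
    by split.
  by split; rewrite -pq.
have [W [oW bW]] := mfd_second_countable mM.
(* For each basic open set W k of the base, one chart of the dual defined over all of W k is chosen,
   if there is any, and an empty chart otherwise. These countably many charts cover the dual, as
   every point of the base has some W k inside a chart domain that trivializes the bundle. *)
pose P k (d : chart R (covector v)) := atlas (dual_mfd v) d /\
  forall Phi : covector v, W k (cobase Phi) -> cdom d Phi.
have ex k : exists d, (exists d', P k d') -> P k d.
  have [[d Pd]|nP] := pselect (exists d', P k d'); first by exists d.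
  by exists (@Chart R (covector v) 0 set0 (fun=> 0)) => /nP.
have [d hd] := choice ex.
apply: (@second_countable_charts (dual_mfd v) (fun k => exists d', P k d') d) => //.
  by move=> k /hd[].
move=> Phi; have [c [ac cp]] := pm_cover pM (cobase Phi).
have [U [n [phi [psi [Ux T]]]]] := vb_triv V (cobase Phi).
have oV := mopenI V (mopen_chart V ac) (triv_open T).
have [k [Wk WV]] := bW _ oV _ (conj cp Ux).
have Pk : exists d', P k d'.
  exists (dual_chart v c U psi); split; first exact: (dual_chart_atlas ac T).
  by move=> Psi /WV.
by exists k; split => //; case: (hd k Pk) => _; apply.
Qed.

Lemma dual_is_vb (E M : premfd R) (v : vbstr R E M) : is_vb v -> is_vb (dual_str v).
Proof.
move=> V; split.
- exact: dual_manifold.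
- exact: (vb_base V).
- exact: smooth_cobase.
- exact/dual_fibres/(vb_fibres V).
- move=> m; have [U [n [phi [psi [Ux T]]]]] := vb_triv V m.
  by exists U, n, (dcoord psi), (dvec v phi); split => //; exact: dual_triv.
Qed.

End Topology.

(** * Decompositions of double vector bundles *)

Section DTriv.
Variables (R : realType) (M : premfd R).

Record ltriv (q : prevb M) (U : set M) := LTriv {
  trk : nat;
  tphi : q -> euclid R trk;
  tpsi : prod_mfd M (euclid R trk) -> q;
  tP : trivialization q U tphi tpsi }.

Arguments tphi {q U} l : rename.
Arguments tpsi {q U} l : rename.
Arguments trk {q U} l : rename.
Arguments tP {q U} l : rename.

Definition smooth_row (X : premfd R) n (f : X -> 'rV[R]_n) (x : X) :=
  forall j, rsmooth (fun t => f t 0 j) x.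

Section Def.
Variables (A B K : prevb M) (D : predvb A B K) (U : set M).
Variables (tA : ltriv A U) (tB : ltriv B U) (tK : ltriv K U).

Local Notation D1 := (dstr1 D).
Local Notation D2 := (dstr2 D).

(* A decomposition of D over U: psi m x y z has sides x, y and core part z with
   respect to the frames of A, B, K, and zeta reads off the core part. *)
Record dtriv (psi : M -> 'rV[R]_(trk tA) -> 'rV[R]_(trk tB) -> 'rV[R]_(trk tK) -> D)
    (zeta : D -> 'rV[R]_(trk tK)) : Prop := DTriv {
  dt_com : forall d, vproj A (vproj D1 d) = vproj B (vproj D2 d);
  dt_p1 : forall m x y z, U m -> vproj D1 (psi m x y z) = tpsi tA (m, x);
  dt_p2 : forall m x y z, U m -> vproj D2 (psi m x y z) = tpsi tB (m, y);
  dt_z : forall m x y z, U m -> zeta (psi m x y z) = z;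
  dt_surj : forall m d, U m -> vproj A (vproj D1 d) = m ->
    exists x y z, d = psi m x y z;
  dt_add1 : forall m x y y' z z', U m ->
    vadd D1 (psi m x y z) (psi m x y' z') = psi m x (y + y') (z + z');
  dt_add2 : forall m x x' y z z', U m ->
    vadd D2 (psi m x y z) (psi m x' y z') = psi m (x + x') y (z + z');
  dt_scale1 : forall m a x y z, U m ->
    vscale D1 a (psi m x y z) = psi m x (a *: y) (a *: z);
  dt_scale2 : forall m a x y z, U m ->
    vscale D2 a (psi m x y z) = psi m (a *: x) y (a *: z);
  dt_zero1 : forall m x, U m -> vzero D1 (tpsi tA (m, x)) = psi m x 0 0;
  dt_zero2 : forall m y, U m -> vzero D2 (tpsi tB (m, y)) = psi m 0 y 0;
  dt_bar : forall kappa : dual_vb K, U (cobase kappa) ->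
    dbar D kappa = psi (cobase kappa) 0 0 (dcoord (tpsi tK) kappa);
  dt_smooth : forall (X : premfd R) (t : X) (m : X -> M) x y z, premanifold X ->
    U (m t) -> smooth_at m t -> smooth_row x t -> smooth_row y t -> smooth_row z t ->
    smooth_at (fun s => psi (m s) (x s) (y s) (z s)) t;
  dt_zsmooth : forall d : D, U (vproj A (vproj D1 d)) -> smooth_row zeta d;
  dt_sm1 : forall d : D, U (vproj A (vproj D1 d)) -> smooth_at (vproj D1) d;
  dt_sm2 : forall d : D, U (vproj A (vproj D1 d)) -> smooth_at (vproj D2) d }.

End Def.

Definition dlocal (A B K : prevb M) (D : predvb A B K) := forall m : M,
  exists (U : set M) (tA : ltriv A U) (tB : ltriv B U) (tK : ltriv K U) psi zeta,
    U m /\ @dtriv A B K D U tA tB tK psi zeta.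

Section Facts.
Variables (A B K : prevb M) (D : predvb A B K) (U : set M).
Variables (tA : ltriv A U) (tB : ltriv B U) (tK : ltriv K U).
Variables (psi : M -> 'rV[R]_(trk tA) -> 'rV[R]_(trk tB) -> 'rV[R]_(trk tK) -> D)
    (zeta : D -> 'rV[R]_(trk tK)).
Hypothesis H : dtriv psi zeta.

Local Notation D1 := (dstr1 D).
Local Notation D2 := (dstr2 D).

Lemma tpsi_inj (q : prevb M) (t : ltriv q U) m :
  U m -> injective (fun x : 'rV[R]_(trk t) => tpsi t (m, x)).
Proof.
by move=> Um x y /= e; rewrite -(tcoordK (tP t) x Um) e (tcoordK (tP t)).
Qed.

Lemma dt_base1 m x y z : U m -> vproj A (vproj D1 (psi m x y z)) = m.
Proof. by move=> Um; rewrite (dt_p1 H) // (tprojK (tP tA)). Qed.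

Lemma dt_elem1 m x d : U m -> vproj D1 d = tpsi tA (m, x) ->
  exists y z, d = psi m x y z.
Proof.
move=> Um dx; have dm : vproj A (vproj D1 d) = m by rewrite dx (tprojK (tP tA)).
have [x' [y [z e]]] := dt_surj H Um dm.
by move: dx; rewrite e (dt_p1 H) // => /(tpsi_inj Um) <-; exists y, z.
Qed.

Lemma dt_coordsK m d : U m -> vproj A (vproj D1 d) = m ->
  psi m (tphi tA (vproj D1 d)) (tphi tB (vproj D2 d)) (zeta d) = d.
Proof.
move=> Um dm; have [x [y [z ->]]] := dt_surj H Um dm.
by rewrite (dt_p1 H) // (dt_p2 H) // (dt_z H) // (tcoordK (tP tA)) // (tcoordK (tP tB)).
Qed.

(** Exchanging the two structures only exchanges the side coordinates, so every fact about the first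
    structure also yields the one about the second. *)
Lemma dtriv_flip : @dtriv B A K (flip D) U tB tA tK (fun m y x z => psi m x y z) zeta.
Proof.
split => /=; try by [case: H | move=> *; case: H; auto].
- move=> m d Um; rewrite -(dt_com H) => dm.
  by have [x [y [z ->]]] := dt_surj H Um dm; exists y, x, z.
- by move=> d; rewrite -(dt_com H); exact: (dt_zsmooth H).
- by move=> d; rewrite -(dt_com H); exact: (dt_sm2 H).
- by move=> d; rewrite -(dt_com H); exact: (dt_sm1 H).
Qed.

Definition dphi1 (d : D) : euclid R (trk tB + trk tK) :=
  row_mx (tphi tB (vproj D2 d)) (zeta d).

Definition dpsi1 (p : prod_mfd A (euclid R (trk tB + trk tK))) : D :=
  psi (vproj A p.1) (tphi tA p.1) (lsubmx (p.2 : 'rV[R]_(trk tB + trk tK)))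
    (rsubmx (p.2 : 'rV[R]_(trk tB + trk tK))).

Lemma dpsi1E m x y z : U m -> dpsi1 (tpsi tA (m, x), row_mx y z) = psi m x y z.
Proof.
by move=> Um; rewrite /dpsi1 /= (tprojK (tP tA)) // (tcoordK (tP tA)) // row_mxKl row_mxKr.
Qed.

Lemma dphi1E m x y z : U m -> dphi1 (psi m x y z) = row_mx y z.
Proof.
by move=> Um; rewrite /dphi1 (dt_p2 H) // (tcoordK (tP tB)) // (dt_z H).
Qed.

Hypotheses (VA : is_vb A) (VB : is_vb B).

(** Over A the pair (y, z) is a linear fibre coordinate, while the base point and x are determined
    by the point of A. *)
Lemma dt_triv1 : premanifold D -> trivialization D1 [set a | U (vproj A a)] dphi1 dpsi1.
Proof.
move=> pD; have pA := manifold_premanifold (vb_total VA).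
have pe := premanifold_euclid R (trk tB + trk tK).
split.
- apply: mopenP => // a Ua.
  apply: (mnear_comp (manifold_premanifold (vb_base VA)) (vb_proj_smooth VA a)).
  exact: (mopen_mnear (manifold_premanifold (vb_base VA)) (triv_open (tP tA))).
- move=> d /= Ud; apply/(smooth_euclidP pD) => j; rewrite /dphi1.
  case: (split_ordP j) => k ->.
    under eq_fun do rewrite row_mxEl.
    have Ud2 : U (vproj B (vproj D2 d)) by rewrite -(dt_com H).
    have := smooth_phi VB (tP tB) pD Ud2 (dt_sm2 H Ud).
    by move/(smooth_euclidP pD); apply.
  under eq_fun do rewrite row_mxEr; exact: (dt_zsmooth H Ud).
- move=> [a w] /= Ua; have pP := premanifold_prod pA pe.
  have s1 := smooth_fst pA pe (a, w).
  apply: (dt_smooth H pP) => //.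
  + by apply: (smooth_vproj VA pP).
  + pose aw : prod_mfd A (euclid R (trk tB + trk tK)) := (a, w).
    by have /(smooth_euclidP pP) := smooth_phi VA (tP tA) pP (x := aw) (h := fst) Ua s1.
  + move=> j; under eq_fun do rewrite mxE.
    by have /(smooth_euclidP pP) := smooth_snd pA pe (a, w); apply.
  + move=> j; under eq_fun do rewrite mxE.
    by have /(smooth_euclidP pP) := smooth_snd pA pe (a, w); apply.
- move=> [a w] /= Ua; rewrite /dpsi1 (dt_p1 H) //= (tinvK (tP tA)) //.
- move=> [a w] /= Ua; rewrite /dpsi1 dphi1E //= hsubmxK //.
- move=> d /= Ud; rewrite /dpsi1 /dphi1 /= row_mxKl row_mxKr dt_coordsK //.
- move=> d e /= Ud de; have Um := Ud.
  have [x [y [z ed]]] := dt_surj H Um erefl.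
  have := de; rewrite {1}ed (dt_p1 H) // => /esym /(dt_elem1 Um)[y' [z' ee]].
  move: (vproj A _) Um ed ee => m Um -> ->.
  by rewrite (dt_add1 H) // !dphi1E // add_row_mx.
- move=> a d /= Ud; have Um := Ud.
  have [x [y [z ed]]] := dt_surj H Um erefl.
  move: (vproj A _) Um ed => m Um ->.
  by rewrite (dt_scale1 H) // !dphi1E // scale_row_mx.
Qed.

End Facts.

(** * From local decompositions to the axioms of a double vector bundle *)

Section LocalToGlobal.
Variables (A B K : prevb M) (D : predvb A B K).
Hypotheses (VA : is_vb A) (VB : is_vb B) (VK : is_vb K).

Lemma dlocal_flip : dlocal D -> dlocal (flip D).
Proof.
move=> L m; have [U [tA [tB [tK [psi [zeta [Um H]]]]]]] := L m.
exists U, tB, tA, tK, (fun m y x z => psi m x y z), zeta; split => //; exact: dtriv_flip.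
Qed.

Hypotheses (mD : is_manifold D) (L : dlocal D).

Let pD := manifold_premanifold mD.

Lemma dlocal_com d : vproj A (vproj (dstr1 D) d) = vproj B (vproj (dstr2 D) d).
Proof.
have [U [tA [tB [tK [psi [zeta [Um H]]]]]]] := L (vproj A (vproj (dstr1 D) d)).
exact: (dt_com H).
Qed.

Lemma dlocal_fibres : fibres_are_vector_spaces (dstr1 D).
Proof.
split; first split.
- move=> a; have [U [tA [tB [tK [psi [zeta [Um H]]]]]]] := L (vproj A a).
  by rewrite -(tinvK (tP tA) Um erefl) (dt_zero1 H) // (dt_p1 H).
- move=> e f; have [U [tA [tB [tK [psi [zeta [Um H]]]]]]] := L (vproj A (vproj (dstr1 D) e)).
  have [x [y [z ed]]] := dt_surj H Um erefl.
  rewrite {1}ed (dt_p1 H) // => /esym /(dt_elem1 H Um)[y' [z' ee]].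
  move: (vproj A _) Um ed ee => m Um -> ->.
  by rewrite (dt_add1 H) // !(dt_p1 H).
- move=> a e; have [U [tA [tB [tK [psi [zeta [Um H]]]]]]] := L (vproj A (vproj (dstr1 D) e)).
  have [x [y [z ed]]] := dt_surj H Um erefl.
  move: (vproj A _) Um ed => m Um ->.
  by rewrite (dt_scale1 H) // !(dt_p1 H).
split; split.
- move=> e f; have [U [tA [tB [tK [psi [zeta [Um H]]]]]]] := L (vproj A (vproj (dstr1 D) e)).
  have [x [y [z ed]]] := dt_surj H Um erefl.
  rewrite {1}ed (dt_p1 H) // => /esym /(dt_elem1 H Um)[y' [z' ee]].
  move: (vproj A _) Um ed ee => m Um -> ->.
  by rewrite !(dt_add1 H) // (addrC y) (addrC z).
- move=> e f h; have [U [tA [tB [tK [psi [zeta [Um H]]]]]]] := L (vproj A (vproj (dstr1 D) e)).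
  have [x [y [z ed]]] := dt_surj H Um erefl.
  move=> ef fh; have ex : vproj (dstr1 D) e = tpsi tA (vproj A (vproj (dstr1 D) e), x).
    by rewrite {1}ed (dt_p1 H).
  have [y' [z' ee]] := dt_elem1 H Um (etrans (esym ef) ex).
  have [y2 [z2 eh]] := dt_elem1 H Um (etrans (esym fh) (etrans (esym ef) ex)).
  move: (vproj A _) Um ed ee eh => m Um {ef fh ex} -> -> ->.
  by rewrite !(dt_add1 H) // !addrA.
- move=> e; have [U [tA [tB [tK [psi [zeta [Um H]]]]]]] := L (vproj A (vproj (dstr1 D) e)).
  have [x [y [z ed]]] := dt_surj H Um erefl.
  move: (vproj A _) Um ed => m Um ->.
  by rewrite (dt_p1 H) // (dt_zero1 H) // (dt_add1 H) // !add0r.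
- move=> e; have [U [tA [tB [tK [psi [zeta [Um H]]]]]]] := L (vproj A (vproj (dstr1 D) e)).
  have [x [y [z ed]]] := dt_surj H Um erefl.
  move: (vproj A _) Um ed => m Um ->.
  by rewrite (dt_p1 H) // (dt_zero1 H) // (dt_scale1 H) // (dt_add1 H) // !scaleN1r !addNr.
- move=> e; have [U [tA [tB [tK [psi [zeta [Um H]]]]]]] := L (vproj A (vproj (dstr1 D) e)).
  have [x [y [z ed]]] := dt_surj H Um erefl.
  move: (vproj A _) Um ed => m Um ->.
  by rewrite (dt_scale1 H) // !scale1r.
- move=> a b e; have [U [tA [tB [tK [psi [zeta [Um H]]]]]]] := L (vproj A (vproj (dstr1 D) e)).
  have [x [y [z ed]]] := dt_surj H Um erefl.
  move: (vproj A _) Um ed => m Um ->.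
  by rewrite !(dt_scale1 H) // !scalerA.
- move=> a e f; have [U [tA [tB [tK [psi [zeta [Um H]]]]]]] := L (vproj A (vproj (dstr1 D) e)).
  have [x [y [z ed]]] := dt_surj H Um erefl.
  rewrite {1}ed (dt_p1 H) // => /esym /(dt_elem1 H Um)[y' [z' ee]].
  move: (vproj A _) Um ed ee => m Um -> ->.
  by rewrite !(dt_add1 H, dt_scale1 H) // !scalerDr.
- move=> a b e; have [U [tA [tB [tK [psi [zeta [Um H]]]]]]] := L (vproj A (vproj (dstr1 D) e)).
  have [x [y [z ed]]] := dt_surj H Um erefl.
  move: (vproj A _) Um ed => m Um ->.
  by rewrite !(dt_add1 H, dt_scale1 H) // !scalerDl.
Qed.

Lemma dlocal_vb : is_vb (dstr1 D).
Proof.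
split => //; first exact: (vb_total VA).
- move=> d; have [U [tA [tB [tK [psi [zeta [Um H]]]]]]] := L (vproj A (vproj (dstr1 D) d)).
  exact: (dt_sm1 H).
- exact: dlocal_fibres.
- move=> a; have [U [tA [tB [tK [psi [zeta [Um H]]]]]]] := L (vproj A a).
  exists [set a | U (vproj A a)], (trk tB + trk tK)%N, (dphi1 tB zeta), (dpsi1 psi).
  by split => //; exact: dt_triv1.
Qed.

Lemma dlocal_proj : is_vbmor (dstr2 D) A (vproj (dstr1 D)) (vproj B).
Proof.
split.
- move=> d; have [U [tA [tB [tK [psi [zeta [Um H]]]]]]] := L (vproj A (vproj (dstr1 D) d)).
  exact: (dt_sm1 H).
- exact: dlocal_com.
- move=> e f; have [U [tA [tB [tK [psi [zeta [Um H]]]]]]] := L (vproj A (vproj (dstr1 D) e)).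
  have H' := dtriv_flip H.
  have [x [y [z ed]]] := dt_surj H Um erefl.
  rewrite {1}ed (dt_p2 H) // => /esym /(dt_elem1 H' Um)[x' [z' /= ee]].
  move: (vproj A _) Um ed ee => m Um -> ->.
  by rewrite (dt_add2 H) // !(dt_p1 H) // (triv_psiD (vb_fibres VA) (tP tA)).
- move=> a e; have [U [tA [tB [tK [psi [zeta [Um H]]]]]]] := L (vproj A (vproj (dstr1 D) e)).
  have [x [y [z ed]]] := dt_surj H Um erefl.
  move: (vproj A _) Um ed => m Um ->.
  by rewrite (dt_scale2 H) // !(dt_p1 H) // (triv_psiZ (vb_fibres VA) (tP tA)).
Qed.

Lemma dlocal_scale a : is_vbmor (dstr2 D) (dstr2 D) (vscale (dstr1 D) a) (vscale B a).
Proof.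
split.
- move=> d; apply: (smooth_vscale dlocal_vb pD (f := fun x => x)).
    exact: rsmooth_cst.
  exact: smooth_idP.
- move=> e; have [U [tA [tB [tK [psi [zeta [Um H]]]]]]] := L (vproj A (vproj (dstr1 D) e)).
  have [x [y [z ed]]] := dt_surj H Um erefl.
  move: (vproj A _) Um ed => m Um ->.
  by rewrite (dt_scale1 H) // !(dt_p2 H) // (triv_psiZ (vb_fibres VB) (tP tB)).
- move=> e f; have [U [tA [tB [tK [psi [zeta [Um H]]]]]]] := L (vproj A (vproj (dstr1 D) e)).
  have H' := dtriv_flip H.
  have [x [y [z ed]]] := dt_surj H Um erefl.
  rewrite {1}ed (dt_p2 H) // => /esym /(dt_elem1 H' Um)[x' [z' /= ee]].
  move: (vproj A _) Um ed ee => m Um -> ->.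
  by rewrite !(dt_add2 H, dt_scale1 H) // scalerDr.
- move=> b e; have [U [tA [tB [tK [psi [zeta [Um H]]]]]]] := L (vproj A (vproj (dstr1 D) e)).
  have [x [y [z ed]]] := dt_surj H Um erefl.
  move: (vproj A _) Um ed => m Um ->.
  by rewrite !(dt_scale2 H, dt_scale1 H) // !scalerA mulrC.
Qed.

Lemma dlocal_core : is_core D.
Proof.
have FK := vb_fibres VK; have pK := premanifold_dual VK.
split.
- move=> k; have [U [tA [tB [tK [psi [zeta [Um H]]]]]]] := L (cobase k).
  have sc : smooth_at (fun t : dual_vb K => cobase t) k := smooth_cobase VK k.
  have s : smooth_at (fun kap : dual_vb K =>
      psi (cobase kap) 0 0 (dcoord (tpsi tK) kap)) k.
    apply: (dt_smooth H pK) => //; try by move=> j; exact: rsmooth_cst.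
    move=> j; under eq_fun do rewrite mxE.
    exact: (smooth_dframe VK (G := fun x => x) pK j (tP tK) (smooth_idP pK k) Um).
  apply: smooth_ext s => //.
  have := mnear_in VK (f := fun t : dual_vb K => cobase t) (triv_open (tP tK)) Um sc.
  by apply: mnearS => kap Uk; rewrite -(dt_bar H).
- move=> k; have [U [tA [tB [tK [psi [zeta [Um H]]]]]]] := L (cobase k).
  by rewrite (dt_bar H) // (dt_p1 H) // (triv_psi0 (vb_fibres VA) (tP tA)).
- move=> k; have [U [tA [tB [tK [psi [zeta [Um H]]]]]]] := L (cobase k).
  by rewrite (dt_bar H) // (dt_p2 H) // (triv_psi0 (vb_fibres VB) (tP tB)).
- move=> k l kl; have [U [tA [tB [tK [psi [zeta [Um H]]]]]]] := L (cobase k).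
  have Ul : U (cobase l) by rewrite -kl.
  have Ua : U (cobase (vadd (dual_vb K) k l : dual_vb K)) by rewrite cobase_mk.
  have e : dcoord (tpsi tK) (vadd (dual_vb K) k l) =
      (dcoord (tpsi tK) k : 'rV[R]__) + dcoord (tpsi tK) l.
    exact: (triv_add (dual_triv VK (tP tK)) Um kl).
  rewrite !(dt_bar H) // cobase_mk e -kl.
  by rewrite (dt_add1 H) // (dt_add2 H) // !addr0.
- move=> a k; have [U [tA [tB [tK [psi [zeta [Um H]]]]]]] := L (cobase k).
  have Ua : U (cobase (vscale (dual_vb K) a k : dual_vb K)) by rewrite cobase_mk.
  have e : dcoord (tpsi tK) (vscale (dual_vb K) a k) =
      a *: (dcoord (tpsi tK) k : 'rV[R]__).
    exact: (triv_scale (dual_triv VK (tP tK)) a Um).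
  rewrite !(dt_bar H) // cobase_mk e.
  by rewrite (dt_scale1 H) // (dt_scale2 H) // !scaler0.
- move=> k l; have [U [tA [tB [tK [psi [zeta [Um H]]]]]]] := L (cobase k).
  (* A priori k and l may lie over different points, so each gets its own decomposition; their base
     points are then recovered from the common image in D. *)
  have [U' [tA' [tB' [tK' [psi' [zeta' [Um' H']]]]]]] := L (cobase l).
  move=> e; have kl : cobase k = cobase l.
    rewrite -(dt_base1 H 0 0 (dcoord (tpsi tK) k) Um) -(dt_bar H) // e.
    by rewrite (dt_bar H') // (dt_base1 H').
  apply: (dcoord_inj FK (tP tK)) => //.
  have Ul : U (cobase l) by rewrite -kl.
  by move: e; rewrite !(dt_bar H) // => /(congr1 zeta); rewrite !(dt_z H).
- move=> d m d1 d2; have [U [tA [tB [tK [psi [zeta [Um H]]]]]]] := L m.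
  have dm : vproj A (vproj (dstr1 D) d) = m by rewrite d1 (fproj0 (vb_fibres VA)).
  exists (dvec K (tphi tK) (m, zeta d)); rewrite (dt_bar H) cobase_dvec //.
  rewrite (dcoordK FK (tP tK)) //= -(dt_coordsK H Um dm) d1 d2 (dt_z H) //.
  rewrite (triv_psi0 (vb_fibres VA) (tP tA)) // (triv_psi0 (vb_fibres VB) (tP tB)) //.
  by rewrite (tcoordK (tP tA)) // (tcoordK (tP tB)).
Qed.

End LocalToGlobal.

(** Every algebraic axiom concerns elements over a single point of M, hence is an identity of row
    vectors in one decomposition. This is how the dual, whose second structure is defined by choice,
    is seen to be a double vector bundle. *)
Lemma dvb_of_dlocal (A B K : prevb M) (D : predvb A B K) :
  is_vb A -> is_vb B -> is_vb K -> is_manifold D -> dlocal D -> is_dvb D.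
Proof.
move=> VA VB VK mD L; have L' := dlocal_flip L.
split => //.
- exact: dlocal_vb.
- by apply: (@dlocal_vb B A K (flip D)).
- exact: dlocal_com.
- exact: dlocal_proj.
- by apply: (@dlocal_proj B A K (flip D)).
- exact: dlocal_scale.
- by apply: (@dlocal_scale B A K (flip D)).
- move=> d1 d2 d3 d4 p12 p34 p13 p24.
  have [U [tA [tB [tK [psi [zeta [Um H]]]]]]] := L (vproj A (vproj (dstr1 D) d1)).
  have H' := dtriv_flip H.
  have [x [y [z e1]]] := dt_surj H Um erefl.
  move: p12; rewrite {1}e1 (dt_p1 H) // => /esym /(dt_elem1 H Um)[y' [z2 e2]].
  move: p13; rewrite {1}e1 (dt_p2 H) // => /esym /(dt_elem1 H' Um)[x' [z3 /= e3]].
  move: p34; rewrite {1}e3 (dt_p1 H) // => /esym /(dt_elem1 H Um)[y4 [z4 e4]].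
  move: p24; rewrite {1}e2 {1}e4 !(dt_p2 H) // => /(tpsi_inj Um) yy; subst y4.
  move: (vproj A _) Um e1 e2 e3 e4 => m Um -> -> -> ->.
  by rewrite !(dt_add1 H, dt_add2 H) // addrACA.
- exact: dlocal_core.
Qed.

(** A map that preserves the coordinates of two decompositions over the same frames is the identity
    in coordinates, so it respects both structures and the core and is bijective. *)
Lemma iso_of_dtriv (A B K : prevb M) (D D' : predvb A B K) (F : D -> D') :
  is_vb A -> is_vb B -> is_vb K -> is_manifold D -> is_manifold D' ->
  (forall m : M, exists (U : set M) (tA : ltriv A U) (tB : ltriv B U) (tK : ltriv K U)
    psi zeta psi' zeta', [/\ U m, @dtriv A B K D U tA tB tK psi zeta,
      @dtriv A B K D' U tA tB tK psi' zeta' &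
      forall m x y z, U m -> F (psi m x y z) = psi' m x y z]) ->
  is_dvb_iso F.
Proof.
move=> VA VB VK mD mD' L.
have pD := manifold_premanifold mD; have pD' := manifold_premanifold mD'.
(* Stated for an arbitrary map between arbitrary bundles, so that it yields the smoothness of F and,
   later, of its inverse. *)
have coords (D0 D1 : predvb A B K) (G : D0 -> D1) (U : set M) (tA : ltriv A U)
    (tB : ltriv B U) (tK : ltriv K U) psi zeta psi' zeta' :
    premanifold D0 -> @dtriv A B K D0 U tA tB tK psi zeta ->
    @dtriv A B K D1 U tA tB tK psi' zeta' ->
    (forall m x y z, U m -> G (psi m x y z) = psi' m x y z) ->
    forall d, U (vproj A (vproj (dstr1 D0) d)) -> smooth_at G d.
  move=> p0 H H' e d Ud.
  have s1 := dt_sm1 H Ud.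
  have sb : smooth_at (fun d : D0 => vproj A (vproj (dstr1 D0) d)) d.
    exact: (smooth_vproj VA p0 s1).
  have s : smooth_at (fun d => psi' (vproj A (vproj (dstr1 D0) d))
     (tphi tA (vproj (dstr1 D0) d)) (tphi tB (vproj (dstr2 D0) d)) (zeta d)) d.
    apply: (dt_smooth H' p0) => //.
    - by have /(smooth_euclidP p0) := smooth_phi VA (tP tA) p0 Ud s1.
    - have Ud2 : U (vproj B (vproj (dstr2 D0) d)) by rewrite -(dt_com H).
      by have /(smooth_euclidP p0) := smooth_phi VB (tP tB) p0 Ud2 (dt_sm2 H Ud).
    - exact: (dt_zsmooth H Ud).
  apply: smooth_ext s => //.
  have := mnear_in VA (f := fun d : D0 => vproj A (vproj (dstr1 D0) d)) (triv_open (tP tA)) Ud sb.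
  by apply: mnearS => d' Ud'; rewrite -{5}(dt_coordsK H Ud' erefl) e.
have pr d : vproj (dstr1 D') (F d) = vproj (dstr1 D) d /\
    vproj (dstr2 D') (F d) = vproj (dstr2 D) d.
  have [U [tA [tB [tK [psi [zeta [psi' [zeta' [Um H H' e]]]]]]]]] :=
    L (vproj A (vproj (dstr1 D) d)).
  have [x [y [z ed]]] := dt_surj H Um erefl.
  move: (vproj A _) Um ed => m Um ->.
  by rewrite e // !(dt_p1 H, dt_p1 H', dt_p2 H, dt_p2 H').
have sF : smooth F.
  move=> d; have [U [tA [tB [tK [psi [zeta [psi' [zeta' [Um H H' e]]]]]]]]] :=
    L (vproj A (vproj (dstr1 D) d)).
  exact: (coords _ _ F _ _ _ _ _ _ _ _ pD H H' e).
have injF d d' : F d = F d' -> d = d'.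
  move=> ff; have [p1 p2] := pr d; have [p1' p2'] := pr d'.
  have [U [tA [tB [tK [psi [zeta [psi' [zeta' [Um H H' e]]]]]]]]] :=
    L (vproj A (vproj (dstr1 D) d)).
  have [x [y [z ed]]] := dt_surj H Um erefl.
  have := p1'; rewrite -ff p1 {1}ed (dt_p1 H) // => /esym /(dt_elem1 H Um)[y' [z' ed']].
  move: (vproj A _) Um ed ed' ff => m Um -> ->; rewrite !e // => /[dup].
  move=> /(congr1 zeta'); rewrite !(dt_z H') // => ->.
  by move=> /(congr1 (vproj (dstr2 D'))); rewrite !(dt_p2 H') // => /(tpsi_inj Um) ->.
have surF d' : exists d, F d = d'.
  have [U [tA [tB [tK [psi [zeta [psi' [zeta' [Um H H' e]]]]]]]]] :=
    L (vproj A (vproj (dstr1 D') d')).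
  have [x [y [z ed]]] := dt_surj H' Um erefl.
  by exists (psi (vproj A (vproj (dstr1 D') d')) x y z); rewrite e.
split.
- split => //.
  + by move=> d; case: (pr d).
  + move=> d d' dd'; have [U [tA [tB [tK [psi [zeta [psi' [zeta' [Um H H' e]]]]]]]]] :=
      L (vproj A (vproj (dstr1 D) d)).
    have [x [y [z ed]]] := dt_surj H Um erefl.
    move: dd'; rewrite {1}ed (dt_p1 H) // => /esym /(dt_elem1 H Um)[y' [z' ed']].
    move: (vproj A _) Um ed ed' => m Um -> ->.
    by rewrite (dt_add1 H) // !e // (dt_add1 H').
  + move=> a d; have [U [tA [tB [tK [psi [zeta [psi' [zeta' [Um H H' e]]]]]]]]] :=
      L (vproj A (vproj (dstr1 D) d)).
    have [x [y [z ed]]] := dt_surj H Um erefl.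
    move: (vproj A _) Um ed => m Um ->.
    by rewrite (dt_scale1 H) // !e // (dt_scale1 H').
- split => //.
  + by move=> d; case: (pr d).
  + move=> d d' dd'; have [U [tA [tB [tK [psi [zeta [psi' [zeta' [Um H H' e]]]]]]]]] :=
      L (vproj A (vproj (dstr1 D) d)).
    have [x [y [z ed]]] := dt_surj H Um erefl.
    move: dd'; rewrite {1}ed (dt_p2 H) // => /esym /(dt_elem1 (dtriv_flip H) Um)[x' [z' /= ed']].
    move: (vproj A _) Um ed ed' => m Um -> ->.
    by rewrite (dt_add2 H) // !e // (dt_add2 H').
  + move=> a d; have [U [tA [tB [tK [psi [zeta [psi' [zeta' [Um H H' e]]]]]]]]] :=
      L (vproj A (vproj (dstr1 D) d)).
    have [x [y [z ed]]] := dt_surj H Um erefl.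
    move: (vproj A _) Um ed => m Um ->.
    by rewrite (dt_scale2 H) // !e // (dt_scale2 H').
- move=> k; have [U [tA [tB [tK [psi [zeta [psi' [zeta' [Um H H' e]]]]]]]]] := L (cobase k).
  by rewrite (dt_bar H) // (dt_bar H') // e.
(* The inverse is picked pointwise from surjectivity; injectivity of F then shows that it preserves
   coordinates as well. *)
- have [G GF] := choice surF; exists G; split.
  + move=> d'; have [U [tA [tB [tK [psi [zeta [psi' [zeta' [Um H H' e]]]]]]]]] :=
      L (vproj A (vproj (dstr1 D') d')).
    apply: (coords _ _ G _ _ _ _ _ _ _ _ pD' H' H _ _ Um) => m x y z Vm.
    by apply: injF; rewrite GF e.
  + by move=> d; apply: injF; rewrite GF.
  + exact: GF.
Qed.

End DTriv.

Arguments tphi {R M q U} l : rename.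
Arguments tpsi {R M q U} l : rename.
Arguments trk {R M q U} l : rename.
Arguments tP {R M q U} l : rename.

(** * The dual in a decomposition *)

Section DualDTriv.
Variables (R : realType) (M : premfd R).

(** A description with exactly one solution makes the default irrelevant. All operations obtained by
    choice are computed through this. *)
Lemma choose_or_unique (T : Type) (x0 a : T) (P : set T) :
  P a -> (forall b, P b -> b = a) -> choose_or x0 P = a.
Proof.
move=> Pa uP; rewrite /choose_or; case: pselect => [h|]; last by case; exists a.
by case: cid => b /= /uP.
Qed.

Variables (A B K : prevb M) (D : predvb A B K).

(** Both outcomes of the choice, the default zero vector included, lie over the base point of
    Phi. *)
Lemma dual_dvb_com (Phi : dual_dvb D) : is_vb K ->
  vproj A (cobase Phi) = vproj K (dual_proj2 Phi).
Proof.
move=> VK; rewrite /dual_proj2 /choose_or; case: pselect => [h|_].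
  by case: cid => k /= [-> _].
by rewrite (fproj0 (vb_fibres VK)).
Qed.

Variables (U : set M) (tA : ltriv A U) (tB : ltriv B U) (tK : ltriv K U).
Variables (psi : M -> 'rV[R]_(trk tA) -> 'rV[R]_(trk tB) -> 'rV[R]_(trk tK) -> D)
    (zeta : D -> 'rV[R]_(trk tK)).

Local Notation D1 := (dstr1 D).
Local Notation D2 := (dstr2 D).

(* In the dual the core coordinate z of D becomes a side and y becomes the core. *)
Definition dpsi (m : M) (x : 'rV[R]_(trk tA)) (z : 'rV[R]_(trk tK)) (y : 'rV[R]_(trk tB)) :
    dual_dvb D :=
  mkcovector D1 (tpsi tA (m, x))
    (fun d => dot y (tphi tB (vproj D2 d)) + dot z (zeta d)).

(** The core coordinate of the dual is read off by evaluation at the elements with second side a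
    frame vector of B and core part 0. *)
Definition dzeta (Phi : dual_dvb D) : 'rV[R]_(trk tB) :=
  \row_i coform Phi (psi (vproj A (cobase Phi)) (tphi tA (cobase Phi)) (delta_mx 0 i) 0).

Hypotheses (VA : is_vb A) (VB : is_vb B) (VK : is_vb K) (V1 : is_vb D1).
Hypothesis H : dtriv psi zeta.

Let F := vb_fibres V1.

Lemma dpsi_cobase m x z y : cobase (dpsi m x z y) = tpsi tA (m, x).
Proof. exact: cobase_mk. Qed.

Lemma dpsiE m x z y y' z' : U m ->
  coform (dpsi m x z y) (psi m x y' z') = dot y y' + dot z z'.
Proof.
move=> Um; rewrite mkcovectorE //.
- by rewrite (dt_p2 H) // (tcoordK (tP tB)) // (dt_z H).
- move=> a e f /(dt_elem1 H Um)[y1 [z1 ->]] /(dt_elem1 H Um)[y2 [z2 ->]].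
  rewrite (dt_scale1 H) // (dt_add1 H) // !(dt_p2 H) // !(dt_z H) // !(tcoordK (tP tB)) //.
  by rewrite !dotDr !dotZr mulrDr addrACA.
- exact: (dt_p1 H).
Qed.

Lemma dual_psi_ext (Phi Psi : dual_dvb D) m x : U m ->
  cobase Phi = tpsi tA (m, x) -> cobase Psi = tpsi tA (m, x) ->
  (forall y z, coform Phi (psi m x y z) = coform Psi (psi m x y z)) -> Phi = Psi.
Proof.
move=> Um px qx pq; apply: covector_ext; first by rewrite px.
by move=> e; rewrite px => /(dt_elem1 H Um)[y [z ->]].
Qed.

(** Over A one has (x, y, z) = (x, y, 0) + (x, 0, z), and the form is linear in y on the first
    summand and in z on the second. *)
Lemma coform_psi (Phi : dual_dvb D) m x y z : U m -> cobase Phi = tpsi tA (m, x) ->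
  coform Phi (psi m x y z) =
  dot (\row_i coform Phi (psi m x (delta_mx 0 i) 0)) y +
  dot (\row_i coform Phi (psi m x 0 (delta_mx 0 i))) z.
Proof.
move=> Um px.
have e : psi m x y z = vadd D1 (psi m x y 0) (psi m x 0 z).
  by rewrite (dt_add1 H) // addr0 add0r.
rewrite e (coformD F px) ?(dt_p1 H) //; congr (_ + _).
  apply: (linear_dot (h := fun y => coform Phi (psi m x y 0))) => a u v.
  by rewrite -(colin a px) ?(dt_p1 H) // (dt_scale1 H) // (dt_add1 H) // scaler0 addr0.
apply: (linear_dot (h := fun y => coform Phi (psi m x 0 y))) => a u v.
by rewrite -(colin a px) ?(dt_p1 H) // (dt_scale1 H) // (dt_add1 H) // scaler0 addr0.
Qed.

Lemma dual_elem1 (Phi : dual_dvb D) m x : U m -> cobase Phi = tpsi tA (m, x) ->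
  exists z y, Phi = dpsi m x z y.
Proof.
move=> Um px; eexists; eexists; apply: (dual_psi_ext Um px (dpsi_cobase _ _ _ _)) => y z.
by rewrite (coform_psi _ _ Um px) dpsiE.
Qed.

Lemma dual_elem (Phi : dual_dvb D) m : U m -> vproj A (cobase Phi) = m ->
  exists x z y, Phi = dpsi m x z y.
Proof.
move=> Um pm; exists (tphi tA (cobase Phi)); apply: dual_elem1 => //.
by rewrite (tinvK (tP tA)).
Qed.

(** The element at which the description evaluates is (x, 0, kappa), so only z is paired with kappa;
    letting kappa run over all covectors of K at m determines z. *)
Lemma dual_proj2E m x z y : U m -> dual_proj2 (dpsi m x z y) = tpsi tK (m, z).
Proof.
move=> Um; have FK := vb_fibres VK.
have bE : vproj A (cobase (dpsi m x z y)) = m by rewrite dpsi_cobase (tprojK (tP tA)).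
have val (kappa : dual_vb K) : cobase kappa = m ->
    coform (dpsi m x z y) (vadd D2 (vzero D1 (cobase (dpsi m x z y))) (dbar D kappa)) =
    dot z (dcoord (tpsi tK) kappa).
  move=> km; rewrite dpsi_cobase (dt_zero1 H) // (dt_bar H) km //.
  by rewrite (dt_add2 H) // addr0 add0r dpsiE // dot0r add0r.
apply: choose_or_unique => /=; rewrite bE.
  split; first by rewrite (tprojK (tP tK)).
  by move=> kappa km; rewrite val // (dcoordE FK (tP tK) _ Um km) dotC.
move=> k [km kv]; rewrite -(tinvK (tP tK) Um km); congr (tpsi tK (m, _)).
apply: dot_inj => w; have := kv (dvec K (tphi tK) (m, w)).
rewrite cobase_dvec => /(_ erefl); rewrite val ?cobase_dvec // (dcoordK FK (tP tK)) //.
by rewrite (dvecE FK (tP tK)) // dotC.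
Qed.

Lemma dual_zero2E m z : U m -> dual_zero2 D (tpsi tK (m, z)) = dpsi m 0 z 0.
Proof.
move=> Um; have FK := vb_fibres VK; have FA := vb_fibres VA.
have z0 : vzero A m = tpsi tA (m, 0) by rewrite (triv_psi0 FA (tP tA)).
have bz y : vzero D2 (tpsi tB (m, y)) = psi m 0 y 0 by exact: (dt_zero2 H).
apply: choose_or_unique => /=; rewrite (tprojK (tP tK)) // z0.
  split; first exact: dpsi_cobase.
    move=> b bm; rewrite -(tinvK (tP tB) Um bm) bz dpsiE // dot0l dot0r addr0 //.
  move=> kappa km; rewrite (dt_bar H) km // dpsiE // dot0l add0r.
  by rewrite (dcoordE FK (tP tK) _ Um km) dotC.
move=> Psi [p0 pB pK]; have [z' [y' e]] := dual_elem1 Um p0; subst Psi.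
have -> : y' = 0.
  apply: dot_inj => w; have := pB (tpsi tB (m, w)); rewrite (tprojK (tP tB)) // => /(_ erefl).
  by rewrite bz dpsiE // dot0r addr0 dot0l.
suff -> : z' = z by [].
apply: dot_inj => w; have := pK (dvec K (tphi tK) (m, w)).
rewrite cobase_dvec => /(_ erefl); rewrite (dt_bar H) cobase_dvec // dpsiE // dot0r add0r.
by rewrite (dcoordK FK (tP tK)) // (dvecE FK (tP tK)) ?(tprojK (tP tK)) // (tcoordK (tP tK)) //
  (dotC w).
Qed.

Lemma dual_add2E m x x' z y y' : U m ->
  dual_add2 (dpsi m x z y) (dpsi m x' z y') = dpsi m (x + x') z (y + y').
Proof.
move=> Um; have FA := vb_fibres VA.
have bA : vadd A (cobase (dpsi m x z y)) (cobase (dpsi m x' z y')) = tpsi tA (m, x + x').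
  by rewrite !dpsi_cobase (triv_psiD FA (tP tA)).
apply: choose_or_unique => /=.
  rewrite bA dpsi_cobase; split => // d1 d2; rewrite !dpsi_cobase.
  move=> /(dt_elem1 H Um)[y1 [z1 ->]] /(dt_elem1 H Um)[y2 [z2 ->]].
  rewrite !(dt_p2 H) // => /(tpsi_inj Um) <-.
  by rewrite (dt_add2 H) // !dpsiE // dotDl dotDr addrACA.
rewrite bA => Psi [px pv]; apply: (dual_psi_ext Um px (dpsi_cobase _ _ _ _)) => w1 w2.
(* Every element over x + x' splits over B into one over x and one over x'; the whole core part is
   assigned to the first. *)
have := pv (psi m x w1 w2) (psi m x' w1 0).
rewrite (dt_add2 H) // addr0 => -> //; rewrite ?dpsi_cobase ?(dt_p1 H) ?(dt_p2 H) //.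
by rewrite !dpsiE // dot0r addr0 dotDl addrAC.
Qed.

(** The values at core part 0 determine the core coordinate of the result. Its side in K is taken
    from the condition on [dual_proj2], since for s = 0 the values contain no information about
    it. *)
Lemma dual_scale2E s m x z y : U m ->
  dual_scale2 s (dpsi m x z y) = dpsi m (s *: x) z (s *: y).
Proof.
move=> Um; have FA := vb_fibres VA.
have bA : vscale A s (cobase (dpsi m x z y)) = tpsi tA (m, s *: x).
  by rewrite !dpsi_cobase (triv_psiZ FA (tP tA)).
apply: choose_or_unique => /=.
  rewrite bA !dual_proj2E // dpsi_cobase; split => // d; rewrite dpsi_cobase.
  move=> /(dt_elem1 H Um)[y1 [z1 ->]].
  by rewrite (dt_scale2 H) // !dpsiE // dotZl dotZr mulrDr.
rewrite bA => Psi [/(dual_elem1 Um)[z' [y' ->]]].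
rewrite !dual_proj2E // => /(tpsi_inj Um) -> pv.
suff -> : y' = s *: y by [].
apply: dot_inj => w; have := pv (psi m x w 0).
rewrite dpsi_cobase (dt_p1 H) // => /(_ erefl).
by rewrite (dt_scale2 H) // !dpsiE // scaler0 !dot0r !addr0 dotZl.
Qed.

Hypothesis mD : is_manifold D.

Let pD := manifold_premanifold mD.

Lemma smooth_tphi (q : prevb M) (t : ltriv q U) (X : premfd R) (f : X -> q) x :
  is_vb q -> premanifold X -> U (vproj q (f x)) -> smooth_at f x ->
  smooth_row (fun s => tphi t (f s)) x.
Proof.
move=> Vq pX Uf sf; have /(smooth_euclidP pX) := smooth_phi Vq (tP t) pX Uf sf.
exact.
Qed.

Lemma smooth_row_cst (X : premfd R) n (a : 'rV[R]_n) (x : X) :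
  premanifold X -> smooth_row (fun=> a) x.
Proof. by move=> pX j; exact: rsmooth_cst. Qed.

Lemma rsmooth_dot (X : premfd R) n (f g : X -> 'rV[R]_n) (x : X) : premanifold X ->
  smooth_row f x -> smooth_row g x -> rsmooth (fun t => dot (f t) (g t)) x.
Proof. by move=> pX sf sg; apply: rsmooth_sum => // j; exact: rsmoothM. Qed.

Lemma rsmooth_coform_psi (Phi : dual_dvb D) (y0 : 'rV[R]_(trk tB)) (z0 : 'rV[R]_(trk tK)) :
  U (vproj A (cobase Phi)) ->
  rsmooth (fun Psi : dual_dvb D => coform Psi
    (psi (vproj A (cobase Psi)) (tphi tA (cobase Psi)) y0 z0)) Phi.
Proof.
move=> Up; have pS := premanifold_dual V1.
have sc : smooth_at (fun Psi : dual_dvb D => cobase Psi) Phi := smooth_cobase V1 Phi.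
have sb := smooth_vproj VA pS sc.
apply: (smooth_eval V1 pS (G := fun Psi => Psi)); first exact: smooth_idP.
  apply: (dt_smooth H pS) => //; [exact: smooth_tphi|exact: smooth_row_cst|exact: smooth_row_cst].
have := mnear_in VA (f := fun Psi : dual_dvb D => vproj A (cobase Psi)) (triv_open (tP tA)) Up sb.
by apply: mnearS => Psi Uq; rewrite (dt_p1 H) // (tinvK (tP tA)).
Qed.

(** In these coordinates the pairing of the dual with D is the sum of two dot products, which turns
    each defining property of the dual operations into linear algebra. *)
Lemma dual_dtriv : @dtriv R M A K B (dual_dvb D) U tA tK tB dpsi dzeta.
Proof.
have pS := premanifold_dual V1.
split.
- by move=> Phi; exact: dual_dvb_com.
- by move=> m x z y Um /=; rewrite dpsi_cobase.
- by move=> m x z y Um /=; rewrite dual_proj2E.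
- move=> m x z y Um; apply/rowP => i; rewrite mxE dpsi_cobase (tprojK (tP tA)) //.
  by rewrite (tcoordK (tP tA)) // dpsiE // dot0r addr0 dot_delta.
- by move=> m Phi Um pm; exact: dual_elem.
- move=> m x z z' y y' Um; apply: (dual_psi_ext Um (x := x)); rewrite ?cobase_mk //.
  move=> w1 w2; rewrite (dual_addE F (m := tpsi tA (m, x))) ?dpsi_cobase ?(dt_p1 H) //.
  by rewrite !dpsiE // !dotDl addrACA.
- by move=> m x x' z y y' Um; exact: dual_add2E.
- move=> m a x z y Um; apply: (dual_psi_ext Um (x := x)); rewrite ?cobase_mk //.
  move=> w1 w2; rewrite (dual_scaleE F _ (m := tpsi tA (m, x))) ?dpsi_cobase ?(dt_p1 H) //.
  by rewrite !dpsiE // !dotZl mulrDr.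
- by move=> m a x z y Um; exact: dual_scale2E.
- move=> m x Um; apply: (dual_psi_ext Um (x := x)); rewrite ?cobase_mk // => w1 w2.
  by rewrite (dual_zeroE F) ?(dt_p1 H) // dpsiE // !dot0l addr0.
- by move=> m z Um; exact: dual_zero2E.
- move=> beta Ub /=; rewrite /dual_bar (triv_psi0 (vb_fibres VA) (tP tA)) //.
  apply: (dual_psi_ext Ub (x := 0)); rewrite ?cobase_mk // => w1 w2.
  rewrite dpsiE // dot0l addr0 mkcovectorE ?(dt_p1 H) // ?(dt_p2 H) //.
    by rewrite (dcoordE (vb_fibres VB) (tP tB) _ Ub erefl).
  move=> a e f /(dt_elem1 H Ub)[y1 [z1 ->]] /(dt_elem1 H Ub)[y2 [z2 ->]].
  rewrite (dt_scale1 H) // (dt_add1 H) // !(dt_p2 H) //.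
  by rewrite !(dcoordE (vb_fibres VB) (tP tB) _ Ub erefl) dotDr dotZr.
- move=> X t m x z y pX Um sm sx sz sy.
  have T1 := dt_triv1 H VA VB pD.
  have sA : smooth_at (fun s => tpsi tA (m s, x s)) t.
    by apply: (smooth_psi VA (tP tA) pX) => //; apply/(smooth_euclidP pX).
  have nU := mnear_in VA (f := m) (triv_open (tP tA)) Um sm.
  apply: (smooth_to_dual V1 pX T1).
  + by rewrite /= dpsi_cobase (tprojK (tP tA)).
  + by under eq_fun do rewrite dpsi_cobase.
  + move=> j; set dj := delta_mx 0 j.
    have s : rsmooth (fun s => dot (y s) (lsubmx dj) + dot (z s) (rsubmx dj)) t.
      by apply: rsmoothD => //; apply: rsmooth_dot => //; exact: smooth_row_cst.
    apply: rsmooth_ext s => //; apply: mnearS nU => s Us.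
    by rewrite dpsi_cobase -{3}(hsubmxK dj) dpsi1E // dpsiE.
- move=> Phi /= Up j; rewrite /dzeta; under eq_fun do rewrite mxE.
  exact: rsmooth_coform_psi.
- by move=> Phi _; exact: smooth_cobase.
- move=> Phi /= Up.
  have sc : smooth_at (fun Psi : dual_dvb D => cobase Psi) Phi := smooth_cobase V1 Phi.
  have sb := smooth_vproj VA pS sc.
  have s : smooth_at (fun Psi : dual_dvb D => tpsi tK (vproj A (cobase Psi),
    \row_i coform Psi
      (psi (vproj A (cobase Psi)) (tphi tA (cobase Psi)) 0 (delta_mx 0 i)))) Phi.
    apply: (smooth_psi VK (tP tK) pS) => //; apply/(smooth_euclidP pS) => j.
    under eq_fun do rewrite mxE; exact: rsmooth_coform_psi.
  apply: smooth_ext s => //.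
  have := mnear_in VA (f := fun Psi : dual_dvb D => vproj A (cobase Psi)) (triv_open (tP tA)) Up sb.
  apply: mnearS => Psi Uq; have [x [z [y e]]] := dual_elem Uq erefl.
  move: (vproj A _) Uq e => m Um ->; rewrite dual_proj2E //.
  rewrite dpsi_cobase (tcoordK (tP tA)) //; congr (tpsi tK (m, _)).
  by apply/rowP => i; rewrite mxE dpsiE // dot0r add0r dot_delta.
Qed.

End DualDTriv.

(** * Existence of decompositions *)

Section SmoothMatrices.
Variables (R : realType) (X : premfd R) (x0 : X).
Hypothesis pX : premanifold X.

Definition smooth_mx n k (P : X -> 'M[R]_(n, k)) := forall i j, rsmooth (fun t => P t i j) x0.

Lemma smooth_mx_cst n k (P : 'M[R]_(n, k)) : smooth_mx (fun=> P).
Proof. by move=> i j; exact: rsmooth_cst. Qed.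

Lemma smooth_mxM n k l (P : X -> 'M[R]_(n, k)) (Q : X -> 'M[R]_(k, l)) :
  smooth_mx P -> smooth_mx Q -> smooth_mx (fun t => P t *m Q t).
Proof.
move=> sP sQ i j; under eq_fun do rewrite mxE.
by apply: rsmooth_sum => // r; exact: rsmoothM.
Qed.

Lemma rsmooth_det n (P : X -> 'M[R]_n) : smooth_mx P -> rsmooth (fun t => \det (P t)) x0.
Proof.
move=> sP; apply: rsmooth_sum => // s; apply: rsmoothM => //; first exact: rsmooth_cst.
exact: rsmooth_prod.
Qed.

Lemma smooth_mx_adj n (P : X -> 'M[R]_n) : smooth_mx P -> smooth_mx (fun t => \adj (P t)).
Proof.
move=> sP i j; under eq_fun do rewrite mxE.
apply: rsmoothM => //; first exact: rsmooth_cst.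
by apply: rsmooth_det => k l; under eq_fun do rewrite !mxE; exact: sP.
Qed.

(** Near x0 the square matrix S0 P stays invertible, and (S0 P)^-1 S0 is a left inverse of P; it is
    smooth by the adjugate formula. *)
Lemma smooth_linv n k (P : X -> 'M[R]_(n, k)) (S0 : 'M[R]_(k, n)) :
  smooth_mx P -> S0 *m P x0 = 1%:M ->
  exists T : X -> 'M[R]_(k, n), smooth_mx T /\ mnear x0 (fun t => T t *m P t = 1%:M).
Proof.
move=> sP S1; have sSP := smooth_mxM (smooth_mx_cst S0) sP; have sd := rsmooth_det sSP.
exists (fun t => (\det (S0 *m P t))^-1 *: \adj (S0 *m P t) *m S0); split.
  apply: smooth_mxM; last exact: smooth_mx_cst.
  move=> i j; under eq_fun do rewrite mxE.
  apply: rsmoothM => //; last exact: smooth_mx_adj.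
  by apply: rsmoothV => //; rewrite S1 det1 oner_neq0.
have : mnear x0 (fun t => \det (S0 *m P t) != 0).
  by apply: rsmooth_neq0 => //; rewrite S1 det1 oner_neq0.
apply: mnearS => t d0; rewrite -mulmxA -scalemxAl mul_adj_mx.
by rewrite scale_scalar_mx mulVf.
Qed.

Lemma smooth_rinv n k (P : X -> 'M[R]_(n, k)) (S0 : 'M[R]_(k, n)) :
  smooth_mx P -> P x0 *m S0 = 1%:M ->
  exists T : X -> 'M[R]_(k, n), smooth_mx T /\ mnear x0 (fun t => P t *m T t = 1%:M).
Proof.
move=> sP S1; have sPT : smooth_mx (fun t => (P t)^T).
  by move=> i j; under eq_fun do rewrite mxE; exact: sP.
have [|T [sT nT]] := smooth_linv (S0 := S0^T) sPT; first by rewrite -trmx_mul S1 trmx1.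
exists (fun t => (T t)^T); split.
  by move=> i j; under eq_fun do rewrite mxE; exact: sT.
by apply: mnearS nT => t e; rewrite -(trmxK (P t)) -trmx_mul e trmx1.
Qed.

End SmoothMatrices.

Section MoreFibre.
Variables (R : realType).

Lemma linear_mulmx n k (L : 'rV[R]_n -> 'rV[R]_k) :
  (forall a x y, L (a *: x + y) = a *: L x + L y) ->
  forall w, L w = w *m \matrix_(i, j) L (delta_mx 0 i) 0 j.
Proof.
move=> hL w; apply/rowP => j; rewrite mxE.
have := @linear_dot R n (fun w => L w 0 j) _ w; rewrite dotC => ->.
  by apply: eq_bigr => i _; rewrite !mxE.
by move=> a x y; rewrite hL !mxE.
Qed.

Lemma faddACA (E M : Type) (v : vbstr R E M) : fibres_are_vector_spaces v ->
  forall m a b c d, vproj v a = m -> vproj v b = m -> vproj v c = m -> vproj v d = m ->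
  vadd v (vadd v a b) (vadd v c d) = vadd v (vadd v a c) (vadd v b d).
Proof.
move=> F m a b c d am bm cm dm.
have bc : vadd v b c = vadd v c b by rewrite (faddC F) // bm.
rewrite -(faddA F) ?(fprojD F) ?am ?bm ?cm ?dm //.
rewrite (faddA F (e := b)) ?(fprojD F) ?am ?bm ?cm ?dm // bc.
by rewrite -(faddA F (e := c)) ?(fprojD F) ?am ?bm ?cm ?dm // (faddA F)
  ?(fprojD F) ?am ?bm ?cm ?dm.
Qed.

Lemma vbmor_zero (E M E' M' : premfd R) (v : vbstr R E M) (v' : vbstr R E' M') G f :
  fibres_are_vector_spaces v -> fibres_are_vector_spaces v' -> is_vbmor v v' G f ->
  forall m, G (vzero v m) = vzero v' (f m).
Proof.
move=> F F' mor m; have := vbmor_scale mor 0 (vzero v m).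
by rewrite (fscale0 F) (fscale0 F') (vbmor_proj mor) !(fproj0 F).
Qed.

Lemma mnear_open (X : premfd R) (x : X) P : premanifold X -> mnear x P ->
  exists O : set X, [/\ mopen O, O x & forall y, O y -> P y].
Proof.
move=> pX nP; exists [set y | mnear y P]; split => //.
  by apply: mopenP => // y hy; exact: mnear_mnear.
by move=> y hy; exact: (mnear_self hy).
Qed.

(** Supplies the nonzero scalar of the scaling argument: 0 is not isolated in the line. *)
Lemma mnear_punctured P : mnear (0 : euclid R 1) P ->
  exists s : R, s != 0 /\ P (const_mx s : 'rV[R]_1).
Proof.
move=> nP; have a0 : atlas (euclid R 1) (@Chart R 'rV[R]_1 1 setT id) by [].
have [_ /nbhs_ballP[e /= e0 he]] := mnear_chart (premanifold_euclid R 1) a0 I nP.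
exists (e / 2); split; first by rewrite gt_eqF // divr_gt0.
apply: (he (const_mx (e / 2))) => //; split => // i j.
rewrite -ball_normE /ball_ /= !mxE sub0r normrN gtr0_norm ?divr_gt0 //.
by rewrite ltr_pdivrMr // ltr_pMr // ltr1n.
Qed.

End MoreFibre.

(** * Sections of D over A that are linear over B *)

Section Existence.
Variables (R : realType) (M : premfd R) (A B K : prevb M) (D : predvb A B K).
Hypothesis H : is_dvb D.
Variables (U : set M) (tA : ltriv A U) (tB : ltriv B U) (tK : ltriv K U).

Local Notation D1 := (dstr1 D).
Local Notation D2 := (dstr2 D).

Let FA := vb_fibres (dvb_A H).
Let FB := vb_fibres (dvb_B H).
Let FK := vb_fibres (dvb_K H).
Let F1 := vb_fibres (dvb_1 H).
Let F2 := vb_fibres (dvb_2 H).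
Let pD := manifold_premanifold (vb_total (dvb_1 H)).
Let pB := manifold_premanifold (vb_total (dvb_B H)).
Let pM := manifold_premanifold (vb_base (dvb_A H)).

Lemma dvb_proj2_zero1 a : vproj D2 (vzero D1 a) = vzero B (vproj A a).
Proof. exact: (vbmor_zero F1 FB (dvb_proj2 H)). Qed.

(** The zero section over A is scaling over A by 0, and that scaling is additive over B. *)
Lemma dvb_zero1D a a' : vproj A a = vproj A a' ->
  vadd D2 (vzero D1 a) (vzero D1 a') = vzero D1 (vadd A a a').
Proof.
move=> aa; have e : vproj D2 (vzero D1 a) = vproj D2 (vzero D1 a').
  by rewrite !dvb_proj2_zero1 aa.
have := vbmor_add (dvb_scale1 H 0) e.
rewrite !(fscale0 F1) (vbmor_add (dvb_proj1 H) e) !(fproj0 F1) => ->.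
by [].
Qed.

Lemma dvb_zero1Z s a : vscale D2 s (vzero D1 a) = vzero D1 (vscale A s a).
Proof. exact: (vbmor_zero F1 F1 (dvb_scale2 H s)). Qed.

(** Scaling the zero element over [vzero A m] by 0 over B can be evaluated in both structures. *)
Lemma dvb_zero12 m : vzero D1 (vzero A m) = vzero D2 (vzero B m).
Proof.
have := dvb_zero1Z 0 (vzero A m).
by rewrite (fscale0 F2) (fscale0 FA) dvb_proj2_zero1 (fproj0 FA).
Qed.

Section Projection.
Variables (V : set B) (N : nat) (phi2 : D -> euclid R N)
  (psi2 : prod_mfd B (euclid R N) -> D).
Hypothesis T2 : trivialization D2 V phi2 psi2.

(** The matrix of the linear map from D_b to the fibre of A below it, in a trivialization of D over
    B and the frame of A. Vectors are rows, so it acts from the right. *)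
Definition proj1_mx (b : B) : 'M[R]_(N, trk tA) :=
  \matrix_(i, j) (tphi tA (vproj D1 (psi2 (b, delta_mx 0 i))) : 'rV[R]__) 0 j.

Lemma proj1_base b (w : 'rV[R]_N) : V b -> vproj A (vproj D1 (psi2 (b, w))) = vproj B b.
Proof. by move=> Vb; rewrite (dvb_commutes H) (tprojK T2). Qed.

Lemma proj1_mxE b (w : 'rV[R]_N) : V b -> U (vproj B b) ->
  tphi tA (vproj D1 (psi2 (b, w))) = w *m proj1_mx b.
Proof.
move=> Vb Ub; apply: (linear_mulmx (L := fun w => tphi tA (vproj D1 (psi2 (b, w))))).
move=> a x y; rewrite -(triv_psiP F2 T2) //.
rewrite (vbmor_add (dvb_proj1 H)) ?(fprojZ F2) ?(tprojK T2) //.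
rewrite (vbmor_scale (dvb_proj1 H)).
by rewrite (triv_phiP FA (tP tA) _ Ub) ?proj1_base.
Qed.

Lemma smooth_proj1_mx (X : premfd R) (f : X -> B) x : premanifold X -> V (f x) ->
  U (vproj B (f x)) -> smooth_at f x -> smooth_mx x (fun t => proj1_mx (f t)).
Proof.
move=> pX Vf Uf sf i j; under eq_fun do rewrite mxE.
have s : smooth_at (fun t => psi2 (f t, delta_mx 0 i : 'rV[R]_N)) x.
  apply: (smooth_psi (dvb_2 H) T2 pX) => //.
  by apply: smooth_cst => //; exact: premanifold_euclid.
have s1 := smooth_vproj (dvb_1 H) pX s.
have U1 : U (vproj A (vproj D1 (psi2 (f x, delta_mx 0 i)))) by rewrite proj1_base.
by have /(smooth_euclidP pX) := smooth_phi (dvb_A H) (tP tA) pX U1 s1; apply.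
Qed.

(** Surjectivity is required at the one point f x only. Preimages of the frame vectors are the rows
    of a matrix S0 with S0 *m [proj1_mx] (f x) = 1, and [smooth_linv] extends it to nearby points;
    for row vectors a section of the projection is a left inverse matrix. *)
Lemma proj1_section (X : premfd R) (f : X -> B) x : premanifold X -> V (f x) ->
  U (vproj B (f x)) -> smooth_at f x ->
  (forall w, exists d, vproj D1 d = tpsi tA (vproj B (f x), w) /\ vproj D2 d = f x) ->
  exists T : X -> 'M[R]_(trk tA, N), smooth_mx x T /\
    mnear x (fun t => [/\ V (f t), U (vproj B (f t)) & forall w,
      vproj D1 (psi2 (f t, w *m T t)) = tpsi tA (vproj B (f t), w)]).
Proof.
move=> pX Vf Uf sf sur.
have [d hd] := choice sur.
pose S0 := \matrix_(i, j) (phi2 (d (delta_mx 0 i)) : 'rV[R]_N) 0 j.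
have S1 : S0 *m proj1_mx (f x) = 1%:M.
  apply/row_matrixP => i; rewrite row_mul row1 -proj1_mxE //.
  have -> : row i S0 = phi2 (d (delta_mx 0 i)).
    by apply/rowP => j; rewrite !mxE.
  have [d1 d2] := hd (delta_mx 0 i).
  by rewrite (tinvK T2) // d1 (tcoordK (tP tA)).
have [T [sT nT]] := smooth_linv pX (smooth_proj1_mx pX Vf Uf sf) S1.
exists T; split => //.
have sb := smooth_vproj (dvb_B H) pX sf.
have nU := mnear_in (dvb_A H) (f := fun t => vproj B (f t)) (triv_open (tP tA)) Uf sb.
have nV := mnear_in (dvb_2 H) (f := f) (triv_open T2) Vf sf.
apply: mnearS (mnearI pX nT (mnearI pX nV nU)) => t [e [Vt Ut]]; split => // w.
rewrite -(tinvK (tP tA) Ut (proj1_base (w *m T t) Vt)) proj1_mxE //.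
by rewrite -mulmxA e mulmx1.
Qed.

End Projection.

(* At b = 0 the zero section gives a lift; surjectivity is open, hence holds at s b
   for some s != 0, and scaling over A carries it to b. *)
Lemma dvb_lift m x b : U m -> vproj B b = m ->
  exists d, vproj D1 d = tpsi tA (m, x) /\ vproj D2 d = b.
Proof.
move=> Um bm.
have [V [N [phi2 [psi2 [V0 T2]]]]] := vb_triv (dvb_2 H) (vzero B m).
have pe := premanifold_euclid R 1.
pose f (t : euclid R 1) : B := vscale B ((t : 'rV[R]_1) 0 0) b.
have sf : smooth_at f (0 : euclid R 1).
  apply: (smooth_vscale (dvb_B H) pe (f := fun=> b)); last exact: smooth_cst.
  by have /(smooth_euclidP pe) := smooth_idP pe (0 : euclid R 1); apply.
have f0 : f (0 : euclid R 1) = vzero B m by rewrite /f mxE (fscale0 FB) bm.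
have fm t : vproj B (f t) = m by rewrite /f (fprojZ FB).
have [||w|T [_ nT]] := proj1_section (f := f) (x := (0 : euclid R 1)) T2 pe _ _ sf.
- by rewrite f0.
- by rewrite fm.
- exists (vzero D1 (tpsi tA (m, w))); rewrite fm f0 (fproj0 F1); split => //.
  by rewrite dvb_proj2_zero1 (tprojK (tP tA)).
have [s [s0 [Vs _ hs]]] := mnear_punctured nT.
exists (vscale D1 s^-1 (psi2 (f (const_mx s), x *m T (const_mx s)))); split.
  by rewrite (fprojZ F1) hs fm.
rewrite (vbmor_scale (dvb_proj2 H)) (tprojK T2) // /f mxE (fscaleA FB) mulVf //.
exact: (fscale1 FB).
Qed.

(** A section of D -> A over the vector of B with coordinates y, linear over B. Every clause is a
    condition at the single point m, so the whole can be asserted near a point; smoothness is tested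
    along maps through m because x ranges over coordinates and not over a manifold. *)
Definition lift_at (y : 'rV[R]_(trk tB)) (h : M -> 'rV[R]_(trk tA) -> D) (m : M) :=
  [/\ forall x, vproj D1 (h m x) = tpsi tA (m, x),
      forall x, vproj D2 (h m x) = tpsi tB (m, y),
      forall x x', vadd D2 (h m x) (h m x') = h m (x + x'),
      forall a x, vscale D2 a (h m x) = h m (a *: x) &
      forall (X : premfd R) (t : X) (f : X -> M) x, premanifold X -> f t = m ->
        smooth_at f t -> smooth_row x t -> smooth_at (fun s => h (f s) (x s)) t].

Lemma linear_lift m0 y : U m0 -> exists h, mnear m0 (lift_at y h).
Proof.
move=> Um0; pose f m := tpsi tB (m, y).
have sf m : U m -> smooth_at f m.
  move=> Um; apply: (smooth_psi (dvb_B H) (tP tB) pM) => //; first exact: smooth_idP.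
  by apply: smooth_cst => //; exact: premanifold_euclid.
have fm m : U m -> vproj B (f m) = m by move=> Um; rewrite (tprojK (tP tB)).
have [V [N [phi2 [psi2 [V0 T2]]]]] := vb_triv (dvb_2 H) (f m0).
have [|w|T [sT nT]] := proj1_section (f := f) (x := m0) T2 pM V0 _ (sf m0 Um0).
- by rewrite fm.
- by apply: dvb_lift; rewrite ?fm.
exists (fun m x => psi2 (f m, x *m T m)).
have nU := mopen_mnear pM (triv_open (tP tA)) Um0.
(* [lift_at] is to hold at all m near m0, so T must be smooth at these points and not only at m0. *)
have nsT : mnear m0 (fun m => smooth_mx m T).
  by apply: mnear_forall => // i; apply: mnear_forall => // j; exact: rsmooth_near.
apply: mnearS (mnearI pM nU (mnearI pM nT nsT)) => m [Um [[Vm _ hm] sTm]].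
split.
- by move=> x; rewrite hm fm.
- by move=> x; rewrite (tprojK T2).
- by move=> x x'; rewrite (triv_psiD F2 T2) // mulmxDl.
- by move=> a x; rewrite (triv_psiZ F2 T2) // scalemxAl.
- move=> X t g x pX gt sg sx; apply: (smooth_psi (dvb_2 H) T2 pX).
  + by rewrite gt.
  + by apply: (smooth_comp pX pM sg); apply: sf; rewrite gt.
  + apply/(smooth_euclidP pX) => j; under eq_fun do rewrite mxE.
    apply: rsmooth_sum => // i.
    apply: (rsmoothM pX (f := fun s => x s 0 i) (g := fun s => T (g s) i j)); first exact: sx.
    by apply: (rsmooth_comp pX pM sg (k := fun m => T m i j)); rewrite gt.
Qed.

Section Decomposition.
Variables (h : 'I_(trk tB) -> M -> 'rV[R]_(trk tA) -> D).

(* The sum over A of the y_i h_i(x): as the fibres are not types, bigops do not apply. *)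
Fixpoint hsum (r : seq 'I_(trk tB)) (m : M) (x : 'rV[R]_(trk tA)) (y : 'rV[R]_(trk tB)) : D :=
  if r is i :: r' then vadd D1 (vscale D1 (y 0 i) (h i m x)) (hsum r' m x y)
  else vzero D1 (tpsi tA (m, x)).

(** The element with sides x and 0 and core part z: over the zero of B, the core is added to the
    zero section of A. *)
Definition core_part (m : M) (x : 'rV[R]_(trk tA)) (z : 'rV[R]_(trk tK)) : D :=
  vadd D2 (vzero D1 (tpsi tA (m, x))) (dbar D (dvec K (tphi tK) (m, z))).

Section At.
Variable m : M.
Hypotheses (Um : U m) (hm : forall i, lift_at (delta_mx 0 i) (h i) m).

Let h1 i x : vproj D1 (h i m x) = tpsi tA (m, x). Proof. by case: (hm i). Qed.
Let h2 i x : vproj D2 (h i m x) = tpsi tB (m, delta_mx 0 i). Proof. by case: (hm i). Qed.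
Let hA i x x' : vadd D2 (h i m x) (h i m x') = h i m (x + x'). Proof. by case: (hm i). Qed.
Let hZ i a x : vscale D2 a (h i m x) = h i m (a *: x). Proof. by case: (hm i). Qed.

Lemma hsum_proj1 r x y : vproj D1 (hsum r m x y) = tpsi tA (m, x).
Proof.
elim: r => [|i r IH] /=; first exact: (fproj0 F1).
by rewrite (fprojD F1) (fprojZ F1) ?IH h1.
Qed.

Lemma hsum_proj2 r x y :
  vproj D2 (hsum r m x y) = tpsi tB (m, \sum_(i <- r) y 0 i *: delta_mx 0 i).
Proof.
elim: r => [|i r IH] /=.
  by rewrite dvb_proj2_zero1 (tprojK (tP tA)) // big_nil (triv_psi0 FB (tP tB)).
rewrite (vbmor_add (dvb_proj2 H)) ?(fprojZ F1) ?hsum_proj1 ?h1 //.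
by rewrite (vbmor_scale (dvb_proj2 H)) h2 IH big_cons (triv_psiP FB (tP tB)).
Qed.

Lemma hsumD1 r x y y' :
  vadd D1 (hsum r m x y) (hsum r m x y') = hsum r m x (y + y').
Proof.
elim: r => [|i r IH] /=; first by rewrite (fadd0l F1) // (fproj0 F1).
rewrite (faddACA F1 (m := tpsi tA (m, x))) ?(fprojZ F1) ?hsum_proj1 //.
by rewrite IH -(fscaleDl F1) mxE.
Qed.

Lemma hsumZ1 r a x y : vscale D1 a (hsum r m x y) = hsum r m x (a *: y).
Proof.
elim: r => [|i r IH] /=; first by rewrite (fscale_zero F1).
rewrite (fscaleDr F1) ?(fprojZ F1) ?hsum_proj1 //.
by rewrite IH (fscaleA F1) mxE.
Qed.

(** The interchange law moves the sum over B inside the sum over A, where each summand is linear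
    over B: the lift is, and so is scaling over A. *)
Lemma hsumD2 r x x' y :
  vadd D2 (hsum r m x y) (hsum r m x' y) = hsum r m (x + x') y.
Proof.
elim: r => [|i r IH] /=.
  by rewrite dvb_zero1D ?(tprojK (tP tA)) // (triv_psiD FA (tP tA)).
rewrite (dvb_interchange H) ?(fprojZ F1) ?hsum_proj1 ?hsum_proj2 //.
  rewrite IH -(vbmor_add (dvb_scale1 H _)) ?h2 //.
  by rewrite hA.
by rewrite !(vbmor_proj (dvb_scale1 H _)) !h2.
Qed.

Lemma hsumZ2 r a x y : vscale D2 a (hsum r m x y) = hsum r m (a *: x) y.
Proof.
elim: r => [|i r IH] /=; first by rewrite dvb_zero1Z (triv_psiZ FA (tP tA)).
rewrite (vbmor_add (dvb_scale2 H a)) ?(fprojZ F1) ?hsum_proj1 //.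
by rewrite IH -(vbmor_scale (dvb_scale1 H _)) hZ.
Qed.

Lemma smooth_hsum r (X : premfd R) (t : X) (f : X -> M) x y : premanifold X -> f t = m ->
  mnear t (fun s => U (f s) /\ forall i, lift_at (delta_mx 0 i) (h i) (f s)) ->
  smooth_at f t -> smooth_row x t -> smooth_row y t ->
  smooth_at (fun s => hsum r (f s) (x s) (y s)) t.
Proof.
move=> pX ft nf sf sx sy; elim: r => [|i r IH] /=.
  apply: (smooth_vzero (dvb_1 H) pX).
  apply: (smooth_psi (dvb_A H) (tP tA) pX) => //; first by rewrite ft.
  exact/(smooth_euclidP pX).
apply: (smooth_vadd (dvb_1 H) pX) => //.
  apply: (smooth_vscale (dvb_1 H) pX); first exact: sy.
  by case: (hm i) => _ _ _ _; apply.
move: nf; apply: mnearS => s [Us hs].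
rewrite (fprojZ F1); case: (hs i) => -> _ _ _ _.
elim: r {IH} => [|j r IH] /=; first by rewrite (fproj0 F1).
rewrite (fprojD F1) (fprojZ F1); by case: (hs j) => -> _ _ _ _.
Qed.

Let C := dvb_core H.

Let bar z := dbar D (dvec K (tphi tK) (m, z)).

Let bar1 z : vproj D1 (bar z) = tpsi tA (m, 0).
Proof. by rewrite (core_proj1 C) cobase_dvec (triv_psi0 FA (tP tA)). Qed.

Let bar2 z : vproj D2 (bar z) = tpsi tB (m, 0).
Proof. by rewrite (core_proj2 C) cobase_dvec (triv_psi0 FB (tP tB)). Qed.

Let z2 x : vproj D2 (vzero D1 (tpsi tA (m, x))) = tpsi tB (m, 0).
Proof. by rewrite dvb_proj2_zero1 (tprojK (tP tA)) // (triv_psi0 FB (tP tB)). Qed.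

Let TK := dual_triv (dvb_K H) (tP tK).

Let barD z z' : bar (z + z') = vadd D1 (bar z) (bar z') /\
  bar (z + z') = vadd D2 (bar z) (bar z').
Proof.
rewrite /bar -(triv_psiD (dual_fibres FK) TK) //.
by apply: (core_add C); rewrite !cobase_dvec.
Qed.

Let barZ a z : bar (a *: z) = vscale D1 a (bar z) /\ bar (a *: z) = vscale D2 a (bar z).
Proof. by rewrite /bar -(triv_psiZ (dual_fibres FK) TK) //; exact: (core_scale C). Qed.

Lemma core_part_proj1 x z : vproj D1 (core_part m x z) = tpsi tA (m, x).
Proof.
rewrite (vbmor_add (dvb_proj1 H)) ?z2 ?bar2 // (fproj0 F1) bar1.
by rewrite (triv_psiD FA (tP tA)) // addr0.
Qed.

Lemma core_part_proj2 x z : vproj D2 (core_part m x z) = tpsi tB (m, 0).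
Proof. by rewrite (fprojD F2) ?z2 ?bar2. Qed.

Lemma core_partD1 x z z' :
  vadd D1 (core_part m x z) (core_part m x z') = core_part m x (z + z').
Proof.
rewrite -(dvb_interchange H) ?(fproj0 F1) ?bar1 ?z2 ?bar2 //.
by rewrite (fadd0l F1) ?(fproj0 F1) // /core_part -/(bar (z + z')); case: (barD z z') => ->.
Qed.

Lemma core_partZ1 a x z : vscale D1 a (core_part m x z) = core_part m x (a *: z).
Proof.
rewrite (vbmor_add (dvb_scale1 H a)) ?z2 ?bar2 // (fscale_zero F1).
by rewrite /core_part -/(bar (a *: z)); case: (barZ a z) => ->.
Qed.

Lemma core_partD2 x x' z z' :
  vadd D2 (core_part m x z) (core_part m x' z') = core_part m (x + x') (z + z').
Proof.
rewrite (faddACA F2 (m := tpsi tB (m, 0))) ?z2 ?bar2 //.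
rewrite dvb_zero1D ?(tprojK (tP tA)) // (triv_psiD FA (tP tA)) //.
by rewrite /core_part -/(bar (z + z')); case: (barD z z') => _ ->.
Qed.

Lemma core_partZ2 a x z : vscale D2 a (core_part m x z) = core_part m (a *: x) (a *: z).
Proof.
rewrite (fscaleDr F2) ?z2 ?bar2 // dvb_zero1Z (triv_psiZ FA (tP tA)) //.
by rewrite /core_part -/(bar (a *: z)); case: (barZ a z) => _ ->.
Qed.

End At.
End Decomposition.
End Existence.

Lemma faddKN (R : realType) (E M : Type) (v : vbstr R E M) a b :
  fibres_are_vector_spaces v -> vproj v a = vproj v b ->
  vadd v (vadd v a b) (vscale v (-1) a) = b.
Proof.
move=> F ab; rewrite (faddC F (e := a)) // -(faddA F) ?(fprojZ F) //.
by rewrite (faddC F (e := a)) ?(fprojZ F) // (faddN F) (fadd0r F).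
Qed.

(** * The decomposition assembled from the lifts and the core *)

Section GoodSet.
Variables (R : realType) (M : premfd R) (A B K : prevb M) (D : predvb A B K).
Hypothesis H : is_dvb D.
Variables (U : set M) (tA : ltriv A U) (tB : ltriv B U) (tK : ltriv K U).
Variable h : 'I_(trk tB) -> M -> 'rV[R]_(trk tA) -> D.
Variables (V : set A) (N : nat) (phi1 : D -> euclid R N)
  (psi1 : prod_mfd A (euclid R N) -> D).
Hypothesis T1 : trivialization (dstr1 D) V phi1 psi1.
Variable S : M -> 'M[R]_(N, trk tK).

Local Notation D1 := (dstr1 D).
Local Notation D2 := (dstr2 D).

Let FA := vb_fibres (dvb_A H).
Let FB := vb_fibres (dvb_B H).
Let FK := vb_fibres (dvb_K H).
Let F1 := vb_fibres (dvb_1 H).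
Let F2 := vb_fibres (dvb_2 H).
Let pD := manifold_premanifold (vb_total (dvb_1 H)).
Let pM := manifold_premanifold (vb_base (dvb_A H)).
Let C := dvb_core H.
Let TK := dual_triv (dvb_K H) (tP tK).

(** The matrix of the core inclusion into the fibre of D over the zero of A at m, in the frame of
    the core dual to that of K and a trivialization of D over A. *)
Definition core_mx (m : M) : 'M[R]_(trk tK, N) :=
  \matrix_(i, j) (phi1 (dbar D (dvec K (tphi tK) (m, delta_mx 0 i))) : 'rV[R]_N) 0 j.

Lemma core_bar_proj1 m z : vproj D1 (dbar D (dvec K (tphi tK) (m, z))) = vzero A m.
Proof. by rewrite (core_proj1 C) cobase_dvec. Qed.

Lemma core_bar_proj2 m z : vproj D2 (dbar D (dvec K (tphi tK) (m, z))) = vzero B m.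
Proof. by rewrite (core_proj2 C) cobase_dvec. Qed.

Lemma core_mxE m z : U m -> V (vzero A m) ->
  phi1 (dbar D (dvec K (tphi tK) (m, z))) = z *m core_mx m.
Proof.
move=> Um Vm; apply: (linear_mulmx (L := fun z => phi1 (dbar D (dvec K (tphi tK) (m, z))))).
move=> a x y.
have -> : dvec K (tphi tK) (m, a *: x + y) = vadd (dual_vb K)
    (vscale (dual_vb K) a (dvec K (tphi tK) (m, x))) (dvec K (tphi tK) (m, y)).
  by rewrite (triv_psiP (dual_fibres FK) TK).
have [-> _] : dbar D (vadd (dual_vb K) (vscale (dual_vb K) a (dvec K (tphi tK) (m, x)))
    (dvec K (tphi tK) (m, y))) =
    vadd D1 (dbar D (vscale (dual_vb K) a (dvec K (tphi tK) (m, x))))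
      (dbar D (dvec K (tphi tK) (m, y))) /\ True.
  split => //; apply: (proj1 (core_add C _)).
  by rewrite cobase_mk !cobase_dvec.
have [-> _] := core_scale C a (dvec K (tphi tK) (m, x)).
by rewrite (triv_phiP F1 T1 _ Vm) ?core_bar_proj1.
Qed.

Lemma smooth_core_bar (X : premfd R) (f : X -> M) z t : premanifold X -> U (f t) -> smooth_at f t ->
  smooth_row z t -> smooth_at (fun s => dbar D (dvec K (tphi tK) (f s, z s))) t.
Proof.
move=> pX Uf sf sz.
apply: (smooth_comp pX (premanifold_dual (dvb_K H))); last exact: (core_smooth C).
by apply: (smooth_psi (dual_is_vb (dvb_K H)) TK pX) => //; apply/(smooth_euclidP pX).
Qed.

Lemma smooth_core_mx m : U m -> V (vzero A m) -> smooth_mx m core_mx.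
Proof.
move=> Um Vm i j; under eq_fun do rewrite mxE.
have s := smooth_core_bar (f := fun x : M => x) (z := fun=> delta_mx 0 i) pM Um
  (smooth_idP pM m) (fun=> rsmooth_cst pM _ _).
have Vm' : V (vproj D1 (dbar D (dvec K (tphi tK) (m, delta_mx 0 i)))).
  by rewrite core_bar_proj1.
by have /(smooth_euclidP pM) := smooth_phi (dvb_1 H) T1 pM Vm' s; apply.
Qed.

(** The core inclusion is injective, so its matrix has independent rows. A right inverse recovers a
    core element from its coordinates in D. *)
Lemma core_mx_rinv m : U m -> V (vzero A m) ->
  exists S0 : 'M[R]_(N, trk tK), core_mx m *m S0 = 1%:M.
Proof.
move=> Um Vm; apply/row_freeP; rewrite -kermx_eq0; apply/rowV0P => z /sub_kermxP z0.
have := core_mxE 0 Um Vm; rewrite mul0mx => e0.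
have := core_mxE z Um Vm; rewrite z0 -e0 => e.
have /(core_inj C) : dbar D (dvec K (tphi tK) (m, z)) = dbar D (dvec K (tphi tK) (m, 0)).
  by apply: (triv_phi_inj T1); rewrite ?core_bar_proj1.
by move=> /(congr1 (dcoord (tpsi tK))); rewrite !(dcoordK FK (tP tK)).
Qed.

Definition psiD m x y z : D :=
  vadd D1 (hsum h (enum 'I_(trk tB)) m x y) (@core_part _ _ _ _ _ D U tA tK m x z).

(* d minus the lift of its two sides, an element of the core. *)
Definition errD (d : D) : D :=
  vadd D2 (vadd D1 d (vscale D1 (-1) (hsum h (enum 'I_(trk tB)) (vproj A (vproj D1 d))
     (tphi tA (vproj D1 d)) (tphi tB (vproj D2 d)))))
   (vscale D2 (-1) (vzero D1 (vproj D1 d))).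

(** The coordinates of the core element [errD d] are z *m [core_mx], and S undoes this
    multiplication. *)
Definition zetaD (d : D) : 'rV[R]_(trk tK) :=
  (phi1 (errD d) : 'rV[R]_N) *m S (vproj A (vproj D1 d)).

Hypothesis good_lift : forall m, U m -> forall i, lift_at (delta_mx 0 i) (h i) m.
Hypothesis good_V : forall m, U m -> V (vzero A m).
Hypothesis good_S : forall m, U m -> core_mx m *m S m = 1%:M.
Hypothesis good_smooth : forall m, U m -> smooth_mx m S.

Let hs2 m x y : U m -> vproj D2 (hsum h (enum 'I_(trk tB)) m x y) = tpsi tB (m, y).
Proof.
move=> Um; rewrite (hsum_proj2 H Um (good_lift Um)); congr (tpsi tB (m, _)).
by rewrite big_enum -row_sum_delta.
Qed.

Let hs1 m x y : U m -> vproj D1 (hsum h (enum 'I_(trk tB)) m x y) = tpsi tA (m, x).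
Proof. by move=> Um; rewrite (hsum_proj1 H (good_lift Um)). Qed.

Let cp1 m (x : 'rV_(trk tA)) (z : 'rV_(trk tK)) : U m ->
  vproj D1 (core_part D m x z) = tpsi tA (m, x).
Proof. by move=> Um; rewrite (core_part_proj1 H tB Um). Qed.

Let cp2 m (x : 'rV_(trk tA)) (z : 'rV_(trk tK)) : U m ->
  vproj D2 (core_part D m x z) = tpsi tB (m, 0).
Proof. by move=> Um; rewrite (core_part_proj2 H tB Um). Qed.

Lemma psiD_proj1 m x y z : U m -> vproj D1 (psiD m x y z) = tpsi tA (m, x).
Proof. by move=> Um; rewrite (fprojD F1) ?hs1 ?cp1. Qed.

Lemma psiD_proj2 m x y z : U m -> vproj D2 (psiD m x y z) = tpsi tB (m, y).
Proof.
move=> Um; rewrite (vbmor_add (dvb_proj2 H)) ?hs1 ?cp1 // hs2 // cp2 //.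
by rewrite (triv_psiD FB (tP tB)) // addr0.
Qed.

Lemma psiDZ1 m a x y z : U m -> vscale D1 a (psiD m x y z) = psiD m x (a *: y) (a *: z).
Proof.
move=> Um; rewrite (fscaleDr F1) ?hs1 ?cp1 //.
by rewrite (hsumZ1 H (good_lift Um)) (core_partZ1 H tB Um).
Qed.

Lemma psiDZ2 m a x y z : U m -> vscale D2 a (psiD m x y z) = psiD m (a *: x) y (a *: z).
Proof.
move=> Um; rewrite (vbmor_add (dvb_scale2 H a)) ?hs1 ?cp1 //.
by rewrite (hsumZ2 H Um (good_lift Um)) (core_partZ2 H tB Um).
Qed.

Lemma errD_psiD m x y z : U m ->
  errD (psiD m x y z) = dbar D (dvec K (tphi tK) (m, z)).
Proof.
move=> Um; rewrite /errD psiD_proj1 // psiD_proj2 // (tprojK (tP tA)) //.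
rewrite (tcoordK (tP tA)) // (tcoordK (tP tB)) //.
rewrite faddKN ?hs1 ?cp1 // faddKN //.
by rewrite (dvb_proj2_zero1 H) (tprojK (tP tA)) // core_bar_proj2.
Qed.

Lemma psiD_surj m d : U m -> vproj A (vproj D1 d) = m -> exists x y z, d = psiD m x y z.
Proof.
move=> Um dm; set x := tphi tA (vproj D1 d); set y := tphi tB (vproj D2 d).
have dm2 : vproj B (vproj D2 d) = m by rewrite -(dvb_commutes H).
have ax : tpsi tA (m, x) = vproj D1 d by rewrite (tinvK (tP tA)).
have by_ : tpsi tB (m, y) = vproj D2 d by rewrite (tinvK (tP tB)).
set hs := hsum h (enum 'I_(trk tB)) m x y.
have hsd : vproj D1 d = vproj D1 hs by rewrite hs1.
set e := vadd D1 d (vscale D1 (-1) hs).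
have e1 : vproj D1 e = vproj D1 d by rewrite (fprojD F1) ?(fprojZ F1).
have e2 : vproj D2 e = vzero B m.
  rewrite (vbmor_add (dvb_proj2 H)) ?(fprojZ F1) // (vbmor_scale (dvb_proj2 H)).
  rewrite hs2 // by_ (faddC FB) ?(fprojZ FB) //.
  by rewrite (faddN FB) dm2.
have z2 : vproj D2 (vzero D1 (vproj D1 d)) = vzero B m.
  by rewrite (dvb_proj2_zero1 H) dm.
have f1 : vproj D1 (errD d) = vzero A m.
  rewrite /errD dm -/x -/y -/hs -/e (vbmor_add (dvb_proj1 H)) ?(fprojZ F2) ?e2 ?z2 //.
  rewrite (vbmor_scale (dvb_proj1 H)) e1 (fproj0 F1) (faddC FA) ?(fprojZ FA) //.
  by rewrite (faddN FA) dm.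
have f2 : vproj D2 (errD d) = vzero B m.
  by rewrite /errD dm -/x -/y -/hs -/e (fprojD F2) ?(fprojZ F2) ?e2 ?z2.
(* Both projections of the error vanish, so it is a core element; adding back what was subtracted
   exhibits d in the required form. *)
have [k kd] := core_surj C f1 f2.
have km : cobase k = m.
  by rewrite -(fproj0 FA (cobase k)) -(core_proj1 C) kd f1 (fproj0 FA).
have Uk : U (cobase k) by rewrite km.
exists x, y, (dcoord (tpsi tK) k).
rewrite /psiD /core_part.
have := dvecK FK (tP tK) Uk; rewrite {1}km => ->; rewrite kd.
rewrite /errD dm -/x -/y -/hs -/e ax.
rewrite (faddC F2 (e := vzero D1 _)); last first.
  by rewrite (fprojD F2) ?(fprojZ F2) ?e2 ?z2.
rewrite (fsubK F2) ?e2 ?z2 // (faddC F1) ?e1 //.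
by rewrite /e (fsubK F1).
Qed.

Lemma zetaD_psiD m x y z : U m -> zetaD (psiD m x y z) = z.
Proof.
move=> Um; rewrite /zetaD errD_psiD // psiD_proj1 // (tprojK (tP tA)) //.
transitivity (z *m core_mx m *m S m); first by rewrite -(core_mxE z Um (good_V Um)).
by rewrite -mulmxA good_S // mulmx1.
Qed.

Let nearU (X : premfd R) (f : X -> M) t : U (f t) -> smooth_at f t ->
  mnear t (fun s => U (f s) /\ forall i, lift_at (delta_mx 0 i) (h i) (f s)).
Proof.
move=> Uf sf; have := mnear_in (dvb_A H) (f := f) (triv_open (tP tA)) Uf sf.
by apply: mnearS => s Us; split => //; exact: good_lift.
Qed.

Lemma smooth_psiD (X : premfd R) (t : X) (m : X -> M) x y z : premanifold X ->
  U (m t) -> smooth_at m t -> smooth_row x t -> smooth_row y t -> smooth_row z t ->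
  smooth_at (fun s => psiD (m s) (x s) (y s) (z s)) t.
Proof.
move=> pX Um sm sx sy sz; have nU := nearU Um sm.
apply: (smooth_vadd (dvb_1 H) pX).
- exact: (smooth_hsum H Um (good_lift Um) _ pX).
- apply: (smooth_vadd (dvb_2 H) pX).
  + apply: (smooth_vzero (dvb_1 H) pX).
    by apply: (smooth_psi (dvb_A H) (tP tA) pX) => //; apply/(smooth_euclidP pX).
  + exact: smooth_core_bar.
  + apply: mnearS nU => s [Us _].
    by rewrite (dvb_proj2_zero1 H) (tprojK (tP tA)) // core_bar_proj2.
- by apply: mnearS nU => s [Us _]; rewrite hs1 // cp1.
Qed.

Lemma smooth_errD d : U (vproj A (vproj D1 d)) -> smooth_at errD d.
Proof.
move=> Ud.
have s1 := smooth_vproj (dvb_1 H) pD (smooth_idP pD d).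
have s2 := smooth_vproj (dvb_2 H) pD (smooth_idP pD d).
have sb := smooth_vproj (dvb_A H) pD s1.
have nU := nearU (f := fun d => vproj A (vproj D1 d)) Ud sb.
have Ud2 : U (vproj B (vproj D2 d)) by rewrite -(dvb_commutes H).
have sh : smooth_at (fun d => hsum h (enum 'I_(trk tB)) (vproj A (vproj D1 d))
     (tphi tA (vproj D1 d)) (tphi tB (vproj D2 d))) d.
  apply: (smooth_hsum H Ud (good_lift Ud) _ pD (f := fun d => vproj A (vproj D1 d))) => //.
    by have /(smooth_euclidP pD) := smooth_phi (dvb_A H) (tP tA) pD Ud s1.
  by have /(smooth_euclidP pD) := smooth_phi (dvb_B H) (tP tB) pD Ud2 s2.
apply: (smooth_vadd (dvb_2 H) pD).
- apply: (smooth_vadd (dvb_1 H) pD); first exact: smooth_idP.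
    by apply: (smooth_vscale (dvb_1 H) pD) => //; exact: rsmooth_cst.
  apply: mnearS nU => e [Ue _]; rewrite (fprojZ F1) hs1 //.
  by rewrite (tinvK (tP tA)).
- apply: (smooth_vscale (dvb_2 H) pD); first exact: rsmooth_cst.
  exact: (smooth_vzero (dvb_1 H) pD).
- apply: mnearS nU => e [Ue _]; rewrite (fprojZ F2) (dvb_proj2_zero1 H).
  have e1 : vproj D1 e = tpsi tA (vproj A (vproj D1 e), tphi tA (vproj D1 e)).
    by rewrite (tinvK (tP tA)).
  have Ue2 : vproj B (vproj D2 e) = vproj A (vproj D1 e) by rewrite (dvb_commutes H).
  rewrite (vbmor_add (dvb_proj2 H)) ?(fprojZ F1) ?hs1 //.
  rewrite (vbmor_scale (dvb_proj2 H)) hs2 // (tinvK (tP tB)) //.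
  by rewrite (faddC FB) ?(fprojZ FB) // (faddN FB) Ue2.
Qed.

Lemma good_dtriv : dtriv psiD zetaD.
Proof.
split.
- exact: (dvb_commutes H).
- by move=> *; exact: psiD_proj1.
- by move=> *; exact: psiD_proj2.
- by move=> *; exact: zetaD_psiD.
- by move=> *; exact: psiD_surj.
- move=> m x y y' z z' Um.
  rewrite /psiD (faddACA F1 (m := tpsi tA (m, x))) ?hs1 ?cp1 //.
  by rewrite (hsumD1 H (good_lift Um)) (core_partD1 H tB Um).
- move=> m x x' y z z' Um.
  rewrite /psiD (dvb_interchange H) ?hs1 ?cp1 ?hs2 ?cp2 //.
  by rewrite (hsumD2 H Um (good_lift Um)) (core_partD2 H tB Um).
- by move=> *; exact: psiDZ1.
- by move=> *; exact: psiDZ2.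
(* Each zero section is scaling by 0 in its structure, so its formula is a case of compatibility
   with scaling. *)
- move=> m x Um; have := psiDZ1 0 x 0 0 Um.
  by rewrite (fscale0 F1) psiD_proj1 // !scaler0.
- move=> m y Um; have := psiDZ2 0 0 y 0 Um.
  by rewrite (fscale0 F2) psiD_proj2 // !scaler0.
- move=> k Uk.
  have e0 : hsum h (enum 'I_(trk tB)) (cobase k) 0 0 = vzero D1 (vzero A (cobase k)).
    have := hsumZ1 H (good_lift Uk) (enum 'I_(trk tB)) 0 0 0.
    by rewrite scaler0 (fscale0 F1) hs1 // (triv_psi0 FA (tP tA)).
  rewrite /psiD e0 (fadd0l F1); last by rewrite cp1 // (triv_psi0 FA (tP tA)).
  rewrite /core_part -(triv_psi0 FA (tP tA)) // (dvb_zero12 H) (fadd0l F2) ?core_bar_proj2 //.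
  by rewrite (dvecK FK (tP tK)).
- by move=> *; exact: smooth_psiD.
- move=> d Ud j; under eq_fun do rewrite mxE.
  have s1 := smooth_vproj (dvb_1 H) pD (smooth_idP pD d).
  have sb := smooth_vproj (dvb_A H) pD s1.
  have [x [y [z e]]] := psiD_surj Ud erefl.
  (* The error always lies over a zero of A, so the trivialization of D need only be defined around
     the zero section. *)
  have Ve : V (vproj D1 (errD d)).
    by rewrite e errD_psiD // core_bar_proj1; exact: good_V.
  have /(smooth_euclidP pD) sp := smooth_phi (dvb_1 H) T1 pD Ve (smooth_errD Ud).
  apply: rsmooth_sum => // i.
  apply: (rsmoothM pD (f := fun d => (phi1 (errD d) : 'rV[R]_N) 0 i)
    (g := fun d => S (vproj A (vproj D1 d)) i j)); first exact: sp.
  exact: (rsmooth_comp pD pM sb (k := fun m => S m i j) (good_smooth Ud i j)).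
- by move=> d _; exact: (vb_proj_smooth (dvb_1 H)).
- by move=> d _; exact: (vb_proj_smooth (dvb_2 H)).
Qed.

End GoodSet.

Section DTrivExists.
Variables (R : realType) (M : premfd R).

Definition lsub (q : prevb M) (U U' : set M) (oU' : mopen U') (s : U' `<=` U)
  (t : ltriv q U) : ltriv q U' := LTriv (triv_restrict oU' s (tP t)).

(** The frames are prescribed and only their domain shrinks. Thus one frame of Q can serve both
    sides of an involutive bundle, or a side and the core of a metric one. *)
Lemma dtriv_exists (A B K : prevb M) (D : predvb A B K) (U : set M) (tA : ltriv A U)
    (tB : ltriv B U) (tK : ltriv K U) m0 : is_dvb D -> U m0 ->
  exists (U' : set M) (oU' : mopen U') (s : U' `<=` U), U' m0 /\
    exists psi zeta, @dtriv R M A B K D U' (lsub oU' s tA) (lsub oU' s tB) (lsub oU' s tK) psi zeta.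
Proof.
move=> H Um0; have pM := manifold_premanifold (vb_base (dvb_A H)).
have [h hh] := choice (fun i => linear_lift H tA (delta_mx 0 i : 'rV[R]_(trk tB)) Um0).
have [V [N [phi1 [psi1 [V0 T1]]]]] := vb_triv (dvb_1 H) (vzero A m0).
have [S0 S1] := core_mx_rinv H tK T1 Um0 V0.
have [S [sS nS]] := smooth_rinv pM (smooth_core_mx (tK := tK) H T1 Um0 V0) S1.
have nV : mnear m0 (fun m => V (vzero A m)).
  apply: (mnear_in (dvb_1 H) (triv_open T1) V0).
  by apply: (smooth_vzero (dvb_A H) pM (f := fun x => x)); exact: smooth_idP.
have nU := mopen_mnear pM (triv_open (tP tA)) Um0.
have nsS : mnear m0 (fun m => smooth_mx m S).
  by apply: mnear_forall => // i; apply: mnear_forall => // j; exact: rsmooth_near.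
have [U' [oU' U'm0 hU']] := mnear_open pM (mnearI pM nU (mnearI pM
  (mnear_forall pM hh) (mnearI pM nV (mnearI pM nS nsS)))).
have s : U' `<=` U by move=> m /hU'[].
exists U', oU', s; split => //.
exists (@psiD R M A B K D U' (lsub oU' s tA) (lsub oU' s tB) (lsub oU' s tK) h),
  (@zetaD R M A B K D U' (lsub oU' s tA) (lsub oU' s tB) (lsub oU' s tK) h N phi1 S).
apply: (good_dtriv H T1).
- by move=> m /hU'[_ []].
- by move=> m /hU'[_ [_ []]].
- by move=> m /hU'[_ [_ [_ []]]].
- by move=> m /hU'[_ [_ [_ []]]].
Qed.

End DTrivExists.

(** * Normal forms of involutions and metrics *)

Section Shear.
Variables (R : realType) (M : premfd R) (A B K : prevb M) (D : predvb A B K) (U : set M).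
Variables (tA : ltriv A U) (tB : ltriv B U) (tK : ltriv K U).
Variables (psi : M -> 'rV[R]_(trk tA) -> 'rV[R]_(trk tB) -> 'rV[R]_(trk tK) -> D)
    (zeta : D -> 'rV[R]_(trk tK)).
Variable eta : M -> 'rV[R]_(trk tA) -> 'rV[R]_(trk tB) -> 'rV[R]_(trk tK).
Hypotheses (VA : is_vb A) (VB : is_vb B) (mD : is_manifold D) (H : dtriv psi zeta).
Hypothesis etaDl : forall m x x' y, U m -> eta m (x + x') y = eta m x y + eta m x' y.
Hypothesis etaDr : forall m x y y', U m -> eta m x (y + y') = eta m x y + eta m x y'.
Hypothesis etaZl : forall m a x y, U m -> eta m (a *: x) y = a *: eta m x y.
Hypothesis etaZr : forall m a x y, U m -> eta m x (a *: y) = a *: eta m x y.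
Hypothesis eta_smooth : forall (X : premfd R) (t : X) (m : X -> M) x y, premanifold X ->
  U (m t) -> smooth_at m t -> smooth_row x t -> smooth_row y t ->
  smooth_row (fun s => eta (m s) (x s) (y s)) t.

(** For fixed x the shift is linear in y and for fixed y linear in x, so it respects both
    structures; by bilinearity it vanishes on both zero sections and on the core. *)
Lemma dtriv_shear : dtriv (fun m x y z => psi m x y (z + eta m x y))
  (fun d => zeta d - eta (vproj A (vproj (dstr1 D) d)) (tphi tA (vproj (dstr1 D) d))
     (tphi tB (vproj (dstr2 D) d))).
Proof.
have pD := manifold_premanifold mD.
have e0l m y : U m -> eta m 0 y = 0 by move=> Um; rewrite -(scale0r 0) etaZl // scale0r.
have e0r m x : U m -> eta m x 0 = 0 by move=> Um; rewrite -(scale0r 0) etaZr // scale0r.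
split.
- exact: (dt_com H).
- by move=> *; rewrite (dt_p1 H).
- by move=> *; rewrite (dt_p2 H).
- move=> m x y z Um; rewrite (dt_z H) // (dt_p1 H) // (dt_p2 H) //.
  by rewrite (tprojK (tP tA)) // (tcoordK (tP tA)) // (tcoordK (tP tB)) // addrK.
- move=> m d Um dm; have [x [y [z ->]]] := dt_surj H Um dm.
  by exists x, y, (z - eta m x y); rewrite subrK.
- by move=> m x y y' z z' Um; rewrite (dt_add1 H) // etaDr // addrACA.
- by move=> m x x' y z z' Um; rewrite (dt_add2 H) // etaDl // addrACA.
- by move=> m a x y z Um; rewrite (dt_scale1 H) // etaZr // scalerDr.
- by move=> m a x y z Um; rewrite (dt_scale2 H) // etaZl // scalerDr.
- by move=> m x Um; rewrite (dt_zero1 H) // e0r // addr0.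
- by move=> m y Um; rewrite (dt_zero2 H) // e0l // addr0.
- by move=> k Uk; rewrite (dt_bar H) // e0l // addr0.
- move=> X t m x y z pX Um sm sx sy sz; apply: (dt_smooth H pX) => // j.
  have se := eta_smooth pX Um sm sx sy.
  by under eq_fun do rewrite mxE; apply: rsmoothD.
- move=> d Ud j; under eq_fun do rewrite !mxE.
  have s1 := dt_sm1 H Ud; have sb := smooth_vproj VA pD s1.
  have Ud2 : U (vproj B (vproj (dstr2 D) d)) by rewrite -(dt_com H).
  apply: rsmoothB => //; first exact: (dt_zsmooth H Ud).
  apply: (eta_smooth pD Ud sb).
    by have /(smooth_euclidP pD) := smooth_phi VA (tP tA) pD Ud s1.
  by have /(smooth_euclidP pD) := smooth_phi VB (tP tB) pD Ud2 (dt_sm2 H Ud).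
- exact: (dt_sm1 H).
- exact: (dt_sm2 H).
Qed.

End Shear.

(** * Duals and double duals of double vector bundles *)

Section DualDvb.
Variables (R : realType) (M : premfd R) (A B K : prevb M).

Lemma ltriv_exists (q q' : prevb M) (m : M) : is_vb q -> is_vb q' ->
  exists (U : set M) (_ : ltriv q U) (_ : ltriv q' U), U m.
Proof.
move=> V V'; have [U [n [phi [psi [Um T]]]]] := vb_triv V m.
have [U' [n' [phi' [psi' [Um' T']]]]] := vb_triv V' m.
have o : mopen (U `&` U') by apply: (mopenI V); [exact: (triv_open T)|exact: (triv_open T')].
by exists (U `&` U'), (LTriv (triv_restrict o (@subIsetl _ U U') T)),
  (LTriv (triv_restrict o (@subIsetr _ U U') T')).
Qed.

Variable D : predvb A B K.

Lemma dvb_dlocal : is_dvb D -> dlocal D.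
Proof.
move=> H m; have [U [tA [tB Um]]] := ltriv_exists m (dvb_A H) (dvb_B H).
have [W [tK [_ Wm]]] := ltriv_exists m (dvb_K H) (dvb_K H).
have o : mopen (U `&` W).
  by apply: (mopenI (dvb_A H)); [exact: (triv_open (tP tA))|exact: (triv_open (tP tK))].
have [U' [oU' [s [U'm [psi [zeta h]]]]]] := dtriv_exists (lsub o (@subIsetl _ U W) tA)
  (lsub o (@subIsetl _ U W) tB) (lsub o (@subIsetr _ U W) tK) H (conj Um Wm : (U `&` W) m).
by do 6 eexists; split; last exact: h.
Qed.

Lemma dual_is_dvb : is_dvb D -> is_dvb (dual_dvb D).
Proof.
move=> H; apply: dvb_of_dlocal.
- exact: (dvb_A H).
- exact: (dvb_K H).
- exact: (dvb_B H).
- exact: (dual_manifold (dvb_1 H)).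
- move=> m; have [U [tA [tB [tK [psi [zeta [Um h]]]]]]] := dvb_dlocal H m.
  exists U, tA, tK, tB, (@dpsi R M A B K D U tA tB tK zeta), (dzeta psi); split => //.
  exact: (dual_dtriv (dvb_A H) (dvb_B H) (dvb_K H) (dvb_1 H) h (vb_total (dvb_1 H))).
Qed.

(** Evaluated at the covector with coordinates (x, z0, y0), both sides give y.y0 + z.z0. The two
    dualizations exchange second side and core twice, so evaluation is the identity in
    coordinates. *)
Lemma ev_psi U (tA : ltriv A U) (tB : ltriv B U) (tK : ltriv K U) psi zeta m x y z :
  is_dvb D -> @dtriv R M A B K D U tA tB tK psi zeta -> U m ->
  ev (dstr1 D) (psi m x y z) =
  dpsi (D := dual_dvb D) (tA := tA) (tB := tK) (tK := tB) (dzeta psi) m x y z.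
Proof.
move=> H h Um; have H' := dual_is_dvb H.
have F1 := vb_fibres (dvb_1 H).
have h' := dual_dtriv (dvb_A H) (dvb_B H) (dvb_K H) (dvb_1 H) h (vb_total (dvb_1 H)).
have cx : cobase (ev (dstr1 D) (psi m x y z)) = tpsi tA (m, x).
  by rewrite cobase_mk (dt_p1 h).
apply: (dual_psi_ext (D := dual_dvb D) h' Um cx); first exact: dpsi_cobase.
move=> z0 y0; rewrite (dpsiE (dvb_1 H') h') //.
rewrite mkcovectorE; first last.
- by rewrite (dt_p1 h') // (dt_p1 h).
- move=> a Phi Psi pm qm.
  have pm' : cobase Phi = tpsi tA (m, x) := etrans pm (dt_p1 h x y z Um).
  have qm' : cobase Psi = tpsi tA (m, x) := etrans qm (dt_p1 h x y z Um).
  rewrite (dual_addE F1 (m := tpsi tA (m, x))) ?dual_cobaseZ ?(dt_p1 h) //.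
  by rewrite (dual_scaleE F1 _ (m := tpsi tA (m, x))) ?(dt_p1 h).
- exact: (vb_fibres (dvb_1 H')).
by rewrite (dpsiE (dvb_1 H) h) // (dotC y0) (dotC z0) addrC.
Qed.

Lemma ev_iso : is_dvb D -> @is_dvb_iso R M A B K D (dual_dvb (dual_dvb D)) (ev (dstr1 D)).
Proof.
move=> H; have H' := dual_is_dvb H; have H2 := dual_manifold (dvb_1 H').
apply: (@iso_of_dtriv R M A B K D (dual_dvb (dual_dvb D)) (ev (dstr1 D))) => //.
- exact: (dvb_A H).
- exact: (dvb_B H).
- exact: (dvb_K H).
- exact: (vb_total (dvb_1 H)).
- move=> m; have [U [tA [tB [tK [psi [zeta [Um h]]]]]]] := dvb_dlocal H m.
  have h' := dual_dtriv (dvb_A H) (dvb_B H) (dvb_K H) (dvb_1 H) h (vb_total (dvb_1 H)).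
  have h2 := dual_dtriv (dvb_A H) (dvb_K H) (dvb_B H) (dvb_1 H') h' (vb_total (dvb_1 H')).
  do 8 eexists; split; [exact: Um|exact: h|exact: h2|].
  by move=> n x y z Un; exact: (ev_psi _ _ _ H h Un).
Qed.

End DualDvb.

(** * Decompositions adapted to an involution or a metric *)

Section Adapted.
Variables (R : realType) (M : premfd R) (Q B : prevb M).

Definition inv_adapted (D : predvb Q Q B) (I : D -> D) U (tQ : ltriv Q U) (tB : ltriv B U)
    psi zeta :=
  @dtriv R M Q Q B D U tQ tQ tB psi zeta /\
  forall m x y z, U m -> I (psi m x y z) = psi m y x (- z).

Definition metric_adapted (E : predvb Q B Q) (g : E -> E -> R) U (tQ : ltriv Q U)
    (tB : ltriv B U) psi zeta :=
  @dtriv R M Q B Q E U tQ tB tQ psi zeta /\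
  forall m x x' b t t', U m -> g (psi m x b t) (psi m x' b t') = dot t x' + dot t' x.

Section Existence.
Variables (D : predvb Q Q B) (I : D -> D) (U : set M) (tQ : ltriv Q U) (tB : ltriv B U).
Variables (psi : M -> 'rV[R]_(trk tQ) -> 'rV[R]_(trk tQ) -> 'rV[R]_(trk tB) -> D)
    (zeta : D -> 'rV[R]_(trk tB)).
Hypotheses (HI : involutive_dvb I) (h : dtriv psi zeta).

Let H : is_dvb D := proj1 HI.
Let J := proj2 HI.
Let F1 := vb_fibres (dvb_1 H).
Let F2 := vb_fibres (dvb_2 H).

Definition inv_form m x y := zeta (I (psi m x y 0)).

Lemma inv_psi m x y z : U m -> I (psi m x y z) = psi m y x (zeta (I (psi m x y z))).
Proof.
move=> Um.
have p1 : vproj (dstr1 D) (I (psi m x y z)) = tpsi tQ (m, y).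
  by rewrite (inv_proj1 J) (dt_p2 h).
have p2 : vproj (dstr2 D) (I (psi m x y z)) = tpsi tQ (m, x).
  by rewrite (inv_proj2 J) (dt_p1 h).
have dm : vproj Q (vproj (dstr1 D) (I (psi m x y z))) = m by rewrite p1 (tprojK (tP tQ)).
by rewrite -{1}(dt_coordsK h Um dm) p1 p2 !(tcoordK (tP tQ)).
Qed.

(** Write (x, y, z) as (x, y, 0) + (x, 0, z) over the first side, and (x, 0, z) as (x, 0, 0) + (0,
    0, z) over the second. The involution exchanges the two zero sections and is -1 on the core, so
    z only enters through -z. *)
Lemma inv_psi_core m x y z : U m -> I (psi m x y z) = psi m y x (inv_form m x y - z).
Proof.
move=> Um.
have e1 : I (psi m x 0 0) = psi m 0 x 0.
  by rewrite -(dt_zero1 h) // (vbmor_zero F1 F2 (inv_mor12 J)) (dt_zero2 h).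
have e2 : I (psi m 0 0 z) = psi m 0 0 (- z).
  have FB := vb_fibres (dvb_K H).
  have b0 : dbar D (dvec B (tphi tB) (m, z)) = psi m 0 0 z.
    by rewrite (dt_bar h) cobase_dvec // (dcoordK FB (tP tB)).
  rewrite -b0 (inv_core J) (dt_bar h) cobase_mk ?cobase_dvec //.
  set k : dual_vb B := dvec B (tphi tB) (m, z).
  have Uk : U (cobase k) by rewrite cobase_dvec.
  have -> : dcoord (tpsi tB) (vscale (dual_vb B) (-1) k) = -1 *: (dcoord (tpsi tB) k : 'rV[R]__).
    exact: (triv_scale (dual_triv (dvb_K H) (tP tB)) (-1) Uk).
  by rewrite (dcoordK FB (tP tB)) // scaleN1r.
have e3 : I (psi m x 0 z) = psi m 0 x (- z).
  have -> : psi m x 0 z = vadd (dstr2 D) (psi m x 0 0) (psi m 0 0 z).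
    by rewrite (dt_add2 h) // addr0 add0r.
  rewrite (vbmor_add (inv_mor21 J)) ?(dt_p2 h) // e1 e2 (dt_add1 h) //.
  by rewrite addr0 add0r.
have -> : psi m x y z = vadd (dstr1 D) (psi m x y 0) (psi m x 0 z).
  by rewrite (dt_add1 h) // addr0 add0r.
rewrite (vbmor_add (inv_mor12 J)) ?(dt_p1 h) // e3 inv_psi // (dt_add2 h) //.
by rewrite addr0.
Qed.

Lemma inv_psi0 m x y : U m -> I (psi m x y 0) = psi m y x (inv_form m x y).
Proof. by move=> Um; rewrite inv_psi_core // subr0. Qed.

(** Applying I twice to (x, y, 0) leaves the core part w(y, x) - w(x, y), which must be 0. *)
Lemma inv_form_sym m x y : U m -> inv_form m x y = inv_form m y x.
Proof.
move=> Um; have := inv_invol J (psi m x y 0).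
rewrite inv_psi0 // inv_psi_core // => /(congr1 zeta); rewrite !(dt_z h) //.
by move=> /eqP; rewrite subr_eq0 => /eqP ->.
Qed.

Lemma inv_formDr m x y y' : U m -> inv_form m x (y + y') = inv_form m x y + inv_form m x y'.
Proof.
move=> Um; rewrite {1}/inv_form.
have -> : psi m x (y + y') 0 = vadd (dstr1 D) (psi m x y 0) (psi m x y' 0).
  by rewrite (dt_add1 h) // addr0.
rewrite (vbmor_add (inv_mor12 J)) ?(dt_p1 h) // !inv_psi0 // (dt_add2 h) //.
by rewrite (dt_z h).
Qed.

Lemma inv_formZr m a x y : U m -> inv_form m x (a *: y) = a *: inv_form m x y.
Proof.
move=> Um; rewrite {1}/inv_form.
have -> : psi m x (a *: y) 0 = vscale (dstr1 D) a (psi m x y 0).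
  by rewrite (dt_scale1 h) // scaler0.
by rewrite (vbmor_scale (inv_mor12 J)) inv_psi0 // (dt_scale2 h) // (dt_z h).
Qed.

Lemma smooth_inv_form (X : premfd R) (t : X) (m : X -> M) x y : premanifold X -> U (m t) ->
  smooth_at m t -> smooth_row x t -> smooth_row y t ->
  smooth_row (fun s => inv_form (m s) (x s) (y s)) t.
Proof.
move=> pX Um sm sx sy j; have pD := manifold_premanifold (vb_total (dvb_1 H)).
have s1 : smooth_at (fun s => psi (m s) (x s) (y s) 0) t.
  by apply: (dt_smooth h pX) => //; exact: smooth_row_cst.
have s2 : smooth_at (fun s => I (psi (m s) (x s) (y s) 0)) t.
  by apply: (smooth_comp pX pD s1); exact: (vbmor_smooth (inv_mor12 J)).
apply: (rsmooth_comp pX pD s2 (k := fun d => zeta d 0 j)).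
apply: (dt_zsmooth h); rewrite (inv_proj1 J) (dt_p2 h) //.
by rewrite (tprojK (tP tQ)).
Qed.

(* As I psi(x,y,z) = psi(y,x,w(x,y) - z) with w symmetric, shifting z by w/2 absorbs w. *)
Lemma inv_adapt : inv_adapted I
  (fun m x y z => psi m x y (z + 2^-1 *: inv_form m x y))
  (fun d => zeta d - 2^-1 *: inv_form (vproj Q (vproj (dstr1 D) d))
     (tphi tQ (vproj (dstr1 D) d)) (tphi tQ (vproj (dstr2 D) d))).
Proof.
split.
  apply: (dtriv_shear (eta := fun m x y => 2^-1 *: inv_form m x y) (dvb_A H) (dvb_A H)
    (vb_total (dvb_1 H)) h).
  - move=> m x x' y Um; rewrite !(inv_form_sym _ y) // inv_formDr // scalerDr.
    by rewrite !(inv_form_sym y).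
  - by move=> m x y y' Um; rewrite inv_formDr // scalerDr.
  - move=> m a x y Um; rewrite !(inv_form_sym _ y) // inv_formZr // (inv_form_sym y) //.
    by rewrite !scalerA mulrC.
  - by move=> m a x y Um; rewrite inv_formZr // !scalerA mulrC.
  - move=> X t m x y pX Um sm sx sy j; under eq_fun do rewrite mxE.
    by apply: rsmoothM => //; [exact: rsmooth_cst|exact: smooth_inv_form].
move=> m x y z Um; rewrite inv_psi_core // (inv_form_sym y x) //.
congr (psi m y x _); rewrite opprD addrCA; congr (_ + _).
by rewrite -{1}(scale1r (inv_form m x y)) -scalerBl; congr (_ *: _); lra.
Qed.

End Existence.

Lemma inv_adapted_exists (D : predvb Q Q B) (I : D -> D) m : involutive_dvb I ->
  exists U (tQ : ltriv Q U) (tB : ltriv B U) psi zeta,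
    U m /\ @inv_adapted D I U tQ tB psi zeta.
Proof.
move=> HI; have H := proj1 HI.
have [U [tQ [tB Um]]] := ltriv_exists m (dvb_A H) (dvb_K H).
have [U' [oU' [s [U'm [psi [zeta h]]]]]] := dtriv_exists tQ tQ tB H Um.
exists U', (lsub oU' s tQ), (lsub oU' s tB); do 2 eexists; split => //.
exact: (inv_adapt HI h).
Qed.

(** The formula (x, y, z) -> (y, x, -z) exchanges the two structures, squares to the identity and
    negates the core; each axiom concerns elements over one point of M, so one decomposition at a
    time suffices. *)
Lemma adapted_involution (D : predvb Q Q B) (I : D -> D) : is_dvb D ->
  (forall m, exists U (tQ : ltriv Q U) (tB : ltriv B U) psi zeta,
    U m /\ @inv_adapted D I U tQ tB psi zeta) -> involutive_dvb I.
Proof.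
move=> H L; have pD := manifold_premanifold (vb_total (dvb_1 H)).
have p1 d : vproj (dstr1 D) (I d) = vproj (dstr2 D) d.
  have [U [tQ [tB [psi [zeta [Um [h a]]]]]]] := L (vproj Q (vproj (dstr1 D) d)).
  have [x [y [z ed]]] := dt_surj h Um erefl.
  move: (vproj Q _) Um ed => m Um ->.
  by rewrite a // (dt_p1 h) // (dt_p2 h).
have p2 d : vproj (dstr2 D) (I d) = vproj (dstr1 D) d.
  have [U [tQ [tB [psi [zeta [Um [h a]]]]]]] := L (vproj Q (vproj (dstr1 D) d)).
  have [x [y [z ed]]] := dt_surj h Um erefl.
  move: (vproj Q _) Um ed => m Um ->.
  by rewrite a // (dt_p1 h) // (dt_p2 h).
have sI : smooth I.
  move=> d; have [U [tQ [tB [psi [zeta [Um [h a]]]]]]] := L (vproj Q (vproj (dstr1 D) d)).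
  have s1 := dt_sm1 h Um; have s2 := dt_sm2 h Um.
  have sb := smooth_vproj (dvb_A H) pD s1.
  have Um2 : U (vproj Q (vproj (dstr2 D) d)) by rewrite -(dt_com h).
  have s : smooth_at (fun d => psi (vproj Q (vproj (dstr1 D) d))
      (tphi tQ (vproj (dstr2 D) d)) (tphi tQ (vproj (dstr1 D) d)) (- zeta d)) d.
    apply: (dt_smooth h pD) => //.
    - by have /(smooth_euclidP pD) := smooth_phi (dvb_A H) (tP tQ) pD Um2 s2.
    - by have /(smooth_euclidP pD) := smooth_phi (dvb_A H) (tP tQ) pD Um s1.
    - move=> j; under eq_fun do rewrite mxE.
      by apply: rsmoothN => //; exact: (dt_zsmooth h Um).
  apply: smooth_ext s => //.
  have := mnear_in (dvb_A H) (f := fun d => vproj Q (vproj (dstr1 D) d))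
    (triv_open (tP tQ)) Um sb.
  by apply: mnearS => d' Ud'; rewrite -a // (dt_coordsK h).
split => //; split => //.
- split => //.
  + move=> d d'; have [U [tQ [tB [psi [zeta [Um [h a]]]]]]] := L (vproj Q (vproj (dstr1 D) d)).
    have [x [y [z ed]]] := dt_surj h Um erefl.
    rewrite {1}ed (dt_p1 h) // => /esym /(dt_elem1 h Um)[y' [z' ed']].
    move: (vproj Q _) Um ed ed' => m Um -> ->.
    by rewrite (dt_add1 h) // !a // (dt_add2 h) // opprD.
  + move=> s d; have [U [tQ [tB [psi [zeta [Um [h a]]]]]]] := L (vproj Q (vproj (dstr1 D) d)).
    have [x [y [z ed]]] := dt_surj h Um erefl.
    move: (vproj Q _) Um ed => m Um ->.
    by rewrite (dt_scale1 h) // !a // (dt_scale2 h) // scalerN.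
- split => //.
  + move=> d d'; have [U [tQ [tB [psi [zeta [Um [h a]]]]]]] := L (vproj Q (vproj (dstr1 D) d)).
    have [x [y [z ed]]] := dt_surj h Um erefl.
    rewrite {1}ed (dt_p2 h) // => /esym /(dt_elem1 (dtriv_flip h) Um)[x' [z' /= ed']].
    move: (vproj Q _) Um ed ed' => m Um -> ->.
    by rewrite (dt_add2 h) // !a // (dt_add1 h) // opprD.
  + move=> s d; have [U [tQ [tB [psi [zeta [Um [h a]]]]]]] := L (vproj Q (vproj (dstr1 D) d)).
    have [x [y [z ed]]] := dt_surj h Um erefl.
    move: (vproj Q _) Um ed => m Um ->.
    by rewrite (dt_scale2 h) // !a // (dt_scale1 h) // scalerN.
- move=> d; have [U [tQ [tB [psi [zeta [Um [h a]]]]]]] := L (vproj Q (vproj (dstr1 D) d)).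
  have [x [y [z ed]]] := dt_surj h Um erefl.
  move: (vproj Q _) Um ed => m Um ->.
  by rewrite !a // opprK.
- move=> b; have [U [tQ [tB [psi [zeta [Um [h a]]]]]]] := L (cobase b).
  have Ub : U (cobase (vscale (dual_vb B) (-1) b : dual_vb B)) by rewrite cobase_mk.
  have e : dcoord (tpsi tB) (vscale (dual_vb B) (-1) b) = -1 *: (dcoord (tpsi tB) b : 'rV[R]__).
    exact: (triv_scale (dual_triv (dvb_K H) (tP tB)) (-1) Um).
  by rewrite !(dt_bar h) // a // cobase_mk e scaleN1r.
Qed.

Section MetricExistence.
Variables (E : predvb Q B Q) (g : E -> E -> R) (U : set M) (tQ : ltriv Q U) (tB : ltriv B U).
Variables (psi : M -> 'rV[R]_(trk tQ) -> 'rV[R]_(trk tB) -> 'rV[R]_(trk tQ) -> E)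
    (zeta : E -> 'rV[R]_(trk tQ)).
Hypotheses (HG : metric_dvb g) (h : dtriv psi zeta).

Let H : is_dvb E := proj1 HG.
Let G := proj2 HG.
Let F2 := vb_fibres (dvb_2 H).
Let hf := dtriv_flip h.
Let hd := dual_dtriv (D := flip E) (dvb_B H) (dvb_A H) (dvb_A H) (dvb_2 H) hf
  (vb_total (dvb_1 H)).
Let dpsif := dpsi (D := flip E) (tA := tB) (tB := tQ) (tK := tQ) zeta.
Let dzetaf := dzeta (D := flip E) (tA := tB) (tB := tQ) (tK := tQ)
  (fun m y x z => psi m x y z).

Lemma metric_linr (e : E) : linear_over (dstr2 E) (vproj (dstr2 E) e) (g e).
Proof.
move=> a f f' fm f'm.
have pm : vproj (dstr2 E) (vadd (dstr2 E) (vscale (dstr2 E) a f) f') = vproj (dstr2 E) e.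
  by rewrite (fprojD F2) ?(fprojZ F2) ?fm ?f'm.
rewrite (Defs.metric_sym G (esym pm)) (metric_lin G) //.
by congr (a * _ + _); exact: (Defs.metric_sym G).
Qed.

Lemma metric_betaE e f : vproj (dstr2 E) f = vproj (dstr2 E) e ->
  coform (metric_beta g e) f = g e f.
Proof. by move=> fe; rewrite mkcovectorE //; exact: metric_linr. Qed.

Definition metric_coord m x b t := dzetaf (metric_beta g (psi m x b t)).

(** The map [metric_beta g] covers the identity of Q, so the side of the covector in Q is again x
    and only its core coordinate remains unknown. *)
Lemma metric_beta_psi m x b t : U m ->
  metric_beta g (psi m x b t) = dpsif m b x (metric_coord m x b t).
Proof.
move=> Um; have [m1 m2 _ _] := metric_iso G.
have c : cobase (metric_beta g (psi m x b t)) = tpsi tB (m, b).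
  by rewrite cobase_mk (dt_p2 h).
have [z [y e]] := dual_elem1 (D := flip E) (dvb_2 H) hf Um c.
have := vbmor_proj m2 (psi m x b t); rewrite /= (dt_p1 h) // {1}e.
rewrite (dual_proj2E (D := flip E) (dvb_A H) (dvb_2 H) hf) // => /(tpsi_inj Um) zx.
by rewrite /metric_coord /dzetaf e zx (dt_z hd).
Qed.

Definition metric_form m x b := metric_coord m x b 0.

Lemma metric_psi m x x' b t t' : U m ->
  g (psi m x b t) (psi m x' b t') = dot (metric_coord m x b t) x' + dot x t'.
Proof.
move=> Um; rewrite -metric_betaE ?(dt_p2 h) // metric_beta_psi //.
by rewrite (dpsiE (D := flip E) (dvb_2 H) hf).
Qed.

Lemma metric_psi_sym m x x' b t t' : U m ->
  dot (metric_coord m x b t) x' + dot x t' = dot (metric_coord m x' b t') x + dot x' t.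
Proof.
by move=> Um; rewrite -!metric_psi // (Defs.metric_sym G) // !(dt_p2 h).
Qed.

Lemma metric_form_sym m x x' b : U m ->
  dot (metric_form m x b) x' = dot (metric_form m x' b) x.
Proof.
by move=> Um; have := metric_psi_sym x x' b 0 0 Um; rewrite !dot0r !addr0.
Qed.

(** The unknown dependence of [metric_coord] on t is removed by symmetry: in the exchanged pairing t
    is the core part of the second argument, where it is already known to contribute t.x'. *)
Lemma metric_psiE m x x' b t t' : U m ->
  g (psi m x b t) (psi m x' b t') = dot (metric_form m x b) x' + dot t x' + dot t' x.
Proof.
move=> Um; rewrite metric_psi // (dotC x); congr (_ + _).
have := metric_psi_sym x x' b t 0 Um; rewrite dot0r addr0 => ->.
by rewrite (dotC x') -metric_form_sym.
Qed.

Lemma metric_formDl m x x' b : U m ->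
  metric_form m (x + x') b = metric_form m x b + metric_form m x' b.
Proof.
move=> Um; have [m1 m2 _ _] := metric_iso G.
have e : psi m (x + x') b 0 = vadd (dstr2 E) (psi m x b 0) (psi m x' b 0).
  by rewrite (dt_add2 h) // addr0.
have p : vproj (dstr1 (flip E)) (psi m x b 0) = vproj (dstr1 (flip E)) (psi m x' b 0).
  by rewrite /= !(dt_p2 h).
have be := vbmor_add m1 p; rewrite -[vadd (dstr1 (flip E)) _ _]e in be.
rewrite {1}/metric_form /metric_coord be !metric_beta_psi // (dt_add1 hd) //.
by rewrite /dzetaf (dt_z hd).
Qed.

Lemma metric_formZl m a x b : U m -> metric_form m (a *: x) b = a *: metric_form m x b.
Proof.
move=> Um; have [m1 m2 _ _] := metric_iso G.
have e : psi m (a *: x) b 0 = vscale (dstr2 E) a (psi m x b 0).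
  by rewrite (dt_scale2 h) // scaler0.
have be := vbmor_scale m1 a (psi m x b 0); rewrite -[vscale (dstr1 (flip E)) _ _]e in be.
rewrite {1}/metric_form /metric_coord be !metric_beta_psi // (dt_scale1 hd) //.
by rewrite /dzetaf (dt_z hd).
Qed.

(** Linearity in b expresses linearity of the metric over Q: here [metric_beta g] is used as a
    morphism for the structures over Q, whereas linearity in x uses those over B. *)
Lemma metric_formDr m x b b' : U m ->
  metric_form m x (b + b') = metric_form m x b + metric_form m x b'.
Proof.
move=> Um; have [m1 m2 _ _] := metric_iso G.
have e : psi m x (b + b') 0 = vadd (dstr1 E) (psi m x b 0) (psi m x b' 0).
  by rewrite (dt_add1 h) // addr0.
have p : vproj (dstr2 (flip E)) (psi m x b 0) = vproj (dstr2 (flip E)) (psi m x b' 0).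
  by rewrite /= !(dt_p1 h).
have be := vbmor_add m2 p; rewrite -[vadd (dstr2 (flip E)) _ _]e in be.
rewrite {1}/metric_form /metric_coord be !metric_beta_psi // (dt_add2 hd) //.
by rewrite /dzetaf (dt_z hd).
Qed.

Lemma metric_formZr m a x b : U m -> metric_form m x (a *: b) = a *: metric_form m x b.
Proof.
move=> Um; have [m1 m2 _ _] := metric_iso G.
have e : psi m x (a *: b) 0 = vscale (dstr1 E) a (psi m x b 0).
  by rewrite (dt_scale1 h) // scaler0.
have be := vbmor_scale m2 a (psi m x b 0); rewrite -[vscale (dstr2 (flip E)) _ _]e in be.
rewrite {1}/metric_form /metric_coord be !metric_beta_psi // (dt_scale2 hd) //.
by rewrite /dzetaf (dt_z hd).
Qed.

Lemma smooth_metric_form (X : premfd R) (t : X) (m : X -> M) x b : premanifold X -> U (m t) ->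
  smooth_at m t -> smooth_row x t -> smooth_row b t ->
  smooth_row (fun s => metric_form (m s) (x s) (b s)) t.
Proof.
move=> pX Um sm sx sb j; have [m1 _ _ _] := metric_iso G.
have pE := manifold_premanifold (vb_total (dvb_1 H)).
have pS := premanifold_dual (dvb_2 H).
have s1 : smooth_at (fun s => psi (m s) (x s) (b s) 0) t.
  by apply: (dt_smooth h pX) => //; exact: smooth_row_cst.
have s2 : smooth_at (fun s => metric_beta g (psi (m s) (x s) (b s) 0)) t.
  by apply: (smooth_comp pX pE s1); exact: (vbmor_smooth m1).
apply: (rsmooth_comp pX pS s2 (k := fun Phi => dzetaf Phi 0 j)).
apply: (dt_zsmooth hd) => /=; rewrite cobase_mk (dt_p2 h) //.
by rewrite (tprojK (tP tB)).
Qed.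

(** Both arguments are shifted, and each shift by -w/2 contributes -w(x, x')/2 by symmetry of w;
    together they cancel the term w(x, x'). *)
Lemma metric_adapt : metric_adapted g
  (fun m x b t => psi m x b (t + - 2^-1 *: metric_form m x b))
  (fun e => zeta e - (- 2^-1) *: metric_form (vproj Q (vproj (dstr1 E) e))
     (tphi tQ (vproj (dstr1 E) e)) (tphi tB (vproj (dstr2 E) e))).
Proof.
split.
  apply: (dtriv_shear (eta := fun m x b => - 2^-1 *: metric_form m x b) (dvb_A H) (dvb_B H)
    (vb_total (dvb_1 H)) h).
  - by move=> m x x' b Um; rewrite metric_formDl // scalerDr.
  - by move=> m x b b' Um; rewrite metric_formDr // scalerDr.
  - by move=> m a x b Um; rewrite metric_formZl // !scalerA mulrC.
  - by move=> m a x b Um; rewrite metric_formZr // !scalerA mulrC.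
  - move=> X t m x b pX Um sm sx sb j; under eq_fun do rewrite mxE.
    by apply: rsmoothM => //; [exact: rsmooth_cst|exact: smooth_metric_form].
move=> m x x' b t t' Um; rewrite metric_psiE // !dotDl !dotZl.
rewrite (metric_form_sym x' x) //; lra.
Qed.

End MetricExistence.

Lemma metric_adapted_exists (E : predvb Q B Q) (g : E -> E -> R) m : metric_dvb g ->
  exists U (tQ : ltriv Q U) (tB : ltriv B U) psi zeta,
    U m /\ @metric_adapted E g U tQ tB psi zeta.
Proof.
move=> HG; have H := proj1 HG.
have [U [tQ [tB Um]]] := ltriv_exists m (dvb_A H) (dvb_B H).
have [U' [oU' [s [U'm [psi [zeta h]]]]]] := dtriv_exists tQ tB tQ H Um.
exists U', (lsub oU' s tQ), (lsub oU' s tB); do 2 eexists; split => //.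
exact: (metric_adapt HG h).
Qed.

End Adapted.

(** * Recognizing a linear metric from its normal form *)

Section AdaptedMetric.
Variables (R : realType) (M : premfd R) (Q B : prevb M) (E : predvb Q B Q).
Variable g : E -> E -> R.
Hypotheses (H : is_dvb E)
  (L : forall m, exists U (tQ : ltriv Q U) (tB : ltriv B U) psi zeta,
    U m /\ @metric_adapted R M Q B E g U tQ tB psi zeta).

Let FQ := vb_fibres (dvb_A H).
Let F2 := vb_fibres (dvb_2 H).

Lemma adapted_metric_sym (e f : E) : vproj (dstr2 E) e = vproj (dstr2 E) f -> g e f = g f e.
Proof.
have [U [tQ [tB [psi [zeta [Um [h a]]]]]]] := L (vproj Q (vproj (dstr1 E) e)).
have [x [b [t ee]]] := dt_surj h Um erefl.
rewrite {1}ee (dt_p2 h) // => /esym /(dt_elem1 (dtriv_flip h) Um)[x' [t' /= ef]].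
move: (vproj Q _) Um ee ef => m Um -> ->.
by rewrite !a // addrC.
Qed.

Lemma adapted_metric_lin s (e e' f : E) : vproj (dstr2 E) e = vproj (dstr2 E) f ->
  vproj (dstr2 E) e' = vproj (dstr2 E) f ->
  g (vadd (dstr2 E) (vscale (dstr2 E) s e) e') f = s * g e f + g e' f.
Proof.
have [U [tQ [tB [psi [zeta [Um [h a]]]]]]] := L (vproj Q (vproj (dstr1 E) f)).
have [x [b [t ef]]] := dt_surj h Um erefl.
rewrite {1 2}ef (dt_p2 h) // => /(dt_elem1 (dtriv_flip h) Um)[x1 [t1 /= e1]].
move=> /(dt_elem1 (dtriv_flip h) Um)[x2 [t2 /= e2]].
move: (vproj Q _) Um ef e1 e2 => m Um -> -> ->.
rewrite (dt_scale2 h) // (dt_add2 h) // !a // !dotDl !dotDr !dotZl !dotZr mulrDr.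
by rewrite addrACA.
Qed.

Lemma adapted_metric_linr (e : E) : linear_over (dstr2 E) (vproj (dstr2 E) e) (g e).
Proof.
move=> a f f' fm f'm.
have pm : vproj (dstr2 E) (vadd (dstr2 E) (vscale (dstr2 E) a f) f') = vproj (dstr2 E) e.
  by rewrite (fprojD F2) ?(fprojZ F2) ?fm ?f'm.
rewrite (adapted_metric_sym (esym pm)) adapted_metric_lin //.
by congr (a * _ + _); exact: adapted_metric_sym.
Qed.

(** In the normal form the map from E to its dual over B is the identity on the coordinates (b, x,
    t); the isomorphism required of a linear metric follows from this. *)
Lemma adapted_metric_beta U (tQ : ltriv Q U) (tB : ltriv B U) psi zeta m x b t :
  @metric_adapted R M Q B E g U tQ tB psi zeta -> U m ->
  metric_beta g (psi m x b t) =
  dpsi (D := flip E) (tA := tB) (tB := tQ) (tK := tQ) zeta m b x t.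
Proof.
move=> [h a] Um; have hf := dtriv_flip h.
have c : cobase (metric_beta g (psi m x b t)) = tpsi tB (m, b).
  by rewrite cobase_mk (dt_p2 h).
apply: (dual_psi_ext (D := flip E) hf Um c); first exact: dpsi_cobase.
move=> x' t'; rewrite mkcovectorE //; last 2 first.
- exact: adapted_metric_linr.
- by rewrite !(dt_p2 h).
by rewrite a // (dpsiE (D := flip E) (dvb_2 H) hf) // (dotC x).
Qed.

Lemma adapted_metric_dvb : metric_dvb g.
Proof.
split => //; split.
- exact: adapted_metric_sym.
- exact: adapted_metric_lin.
- move=> e; have [U [tQ [tB [psi [zeta [Um [h a]]]]]]] := L (vproj Q (vproj (dstr1 E) e)).
  have [x [b [t ee]]] := dt_surj h Um erefl.
  move: (vproj Q _) Um ee => m Um -> e0.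
  (* The elements over the same b realize all pairs (x', t'): t' = 0 isolates t, and x' = 0 isolates
     x. *)
  have z x' t' : dot t x' + dot t' x = 0 by rewrite -(a m _ _ b) // e0 // !(dt_p2 h).
  rewrite (dt_p2 h) // (dt_zero2 h) //.
  have -> : t = 0 by apply: dot_inj => x'; have := z x' 0; rewrite !dot0l addr0.
  suff -> : x = 0 by [].
  by apply: dot_inj => t'; have := z 0 t'; rewrite dot0r add0r dot0l dotC.
- apply: (@iso_of_dtriv R M B Q Q (flip E) (dual_dvb (flip E)) (metric_beta g)).
  + exact: (dvb_B H).
  + exact: (dvb_A H).
  + exact: (dvb_A H).
  + exact: (vb_total (dvb_1 H)).
  + exact: (dual_manifold (dvb_2 H)).
  + move=> m; have [U [tQ [tB [psi [zeta [Um [h a]]]]]]] := L m.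
    have hf := dtriv_flip h.
    have hd := dual_dtriv (D := flip E) (dvb_B H) (dvb_A H) (dvb_A H) (dvb_2 H) hf
      (vb_total (dvb_1 H)).
    do 8 eexists; split; [exact: Um|exact: hf|exact: hd|].
    by move=> n b x t Un; exact: (adapted_metric_beta _ _ _ (conj h a) Un).
- move=> e tau; have [U [tQ [tB [psi [zeta [Um [h a]]]]]]] := L (cobase tau).
  move=> em; have [x [b [t ee]]] := dt_surj h Um em.
  rewrite ee (dt_p2 h) // (dt_zero2 h) // (dt_bar h) // (dt_add1 h) // !add0r addr0.
  by rewrite a // dot0r add0r (dt_p1 h) // (dcoordE FQ (tP tQ) _ Um erefl).
Qed.

End AdaptedMetric.

(** * The two constructions in adapted coordinates *)

Section DualAdapted.
Variables (R : realType) (M : premfd R) (Q B : prevb M).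

Section FromInvolution.
Variables (D : predvb Q Q B) (I : D -> D) (U : set M) (tQ : ltriv Q U) (tB : ltriv B U).
Variables (psi : M -> 'rV[R]_(trk tQ) -> 'rV[R]_(trk tQ) -> 'rV[R]_(trk tB) -> D)
    (zeta : D -> 'rV[R]_(trk tB)).
Hypotheses (H : is_dvb D) (ha : inv_adapted I psi zeta).

Local Notation dpsiD := (dpsi (D := D) (tA := tQ) (tB := tQ) (tK := tB) zeta).

Let h : dtriv psi zeta := proj1 ha.
Let a := proj2 ha.

(** The core part w of d enters as b.w through the first covector and as -b.w through the second:
    they have the same side b in B, and I negates the core. Hence the sum does not depend on the
    choice of d. *)
Lemma involution_sum m x x' b t t' (d : D) : U m ->
  vproj (dstr1 D) d = tpsi tQ (m, x) -> vproj (dstr2 D) d = tpsi tQ (m, x') ->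
  coform (dpsiD m x b t) d + coform (dpsiD m x' b t') (I d) = dot t x' + dot t' x.
Proof.
move=> Um /(dt_elem1 h Um)[y [w ->]]; rewrite (dt_p2 h) // => /(tpsi_inj Um) ->.
rewrite a // !(dpsiE (dvb_1 H) h) // addrACA -[X in _ + X]dotDr.
by rewrite subrr dot0r addr0.
Qed.

Lemma metric_of_involutionE m x x' b t t' : U m ->
  metric_of_involution I (dpsiD m x b t) (dpsiD m x' b t') = dot t x' + dot t' x.
Proof.
move=> Um; apply: choose_or_unique.
  exists (psi m x x' 0); rewrite /= !dpsi_cobase (dt_p1 h) // (dt_p2 h) //; split => //.
  by rewrite involution_sum // ?(dt_p1 h) ?(dt_p2 h).
move=> r [d []]; rewrite /= !dpsi_cobase => d1 d2 ->.
exact: involution_sum.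
Qed.

Lemma dual_metric_adapted :
  @metric_adapted R M Q B (dual_dvb D) (metric_of_involution I) U tQ tB dpsiD (dzeta psi).
Proof.
split; first exact: (dual_dtriv (dvb_A H) (dvb_A H) (dvb_K H) (dvb_1 H) h (vb_total (dvb_1 H))).
by move=> m x x' b t t' Um; exact: metric_of_involutionE.
Qed.

End FromInvolution.

Section FromMetric.
Variables (E : predvb Q B Q) (g : E -> E -> R) (U : set M) (tQ : ltriv Q U) (tB : ltriv B U).
Variables (psi : M -> 'rV[R]_(trk tQ) -> 'rV[R]_(trk tB) -> 'rV[R]_(trk tQ) -> E)
    (zeta : E -> 'rV[R]_(trk tQ)).
Hypotheses (HG : metric_dvb g) (ha : metric_adapted g psi zeta).

Local Notation dpsiE' := (dpsi (D := E) (tA := tQ) (tB := tB) (tK := tQ) zeta).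

Let H : is_dvb E := proj1 HG.
Let h : dtriv psi zeta := proj1 ha.
Let a := proj2 ha.

(** The core part t' of y enters both terms as t'.x', since x' is at once the side of e in Q and the
    second side of d; it cancels, and the difference does not depend on y. *)
Lemma metric_difference m x x' be b t (y : E) : U m ->
  vproj (dstr2 E) y = tpsi tB (m, b) -> vproj (dstr1 E) y = tpsi tQ (m, x) ->
  g (psi m x' b t) y - coform (dpsiE' m x x' be) y = dot t x - dot be b.
Proof.
move=> Um y2 /(dt_elem1 h Um)[b' [t' ey]]; subst y.
move: y2; rewrite (dt_p2 h) // => /(tpsi_inj Um) ->.
rewrite a // (dpsiE (dvb_1 H) h) // (dotC x') opprD addrAC addrA.
by rewrite subrK.
Qed.

Lemma dual_pairing_adapted m x x' be b t : U m ->
  @dual_pairing R M B Q Q (flip E) (metric_beta g (psi m x' b t)) (dpsiE' m x x' be) =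
  dot t x - dot be b.
Proof.
move=> Um; apply: choose_or_unique.
  exists (psi m x b 0); rewrite /= cobase_mk dpsi_cobase !(dt_p1 h) // !(dt_p2 h) //.
  split => //; rewrite (metric_betaE HG) ?(dt_p2 h) //.
  by apply/esym; apply: metric_difference; rewrite ?(dt_p1 h) ?(dt_p2 h).
move=> r [y []]; rewrite /= cobase_mk dpsi_cobase (dt_p2 h) // => y2 y1 ->.
rewrite (metric_betaE HG) ?y2 ?(dt_p2 h) //.
exact: metric_difference.
Qed.

(** Keeps [mkcovector] in the definition of the involution away from its default, the zero
    covector. *)
Lemma pairing_linear_over m x x' be : U m ->
  linear_over (dstr1 E) (tpsi tQ (m, x'))
    (fun e => @dual_pairing R M B Q Q (flip E) (metric_beta g e) (dpsiE' m x x' be)).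
Proof.
move=> Um s e f /(dt_elem1 h Um)[b [t ->]] /(dt_elem1 h Um)[b' [t' ->]].
rewrite (dt_scale1 h) // (dt_add1 h) // !dual_pairing_adapted //.
by rewrite dotDl dotDr dotZl dotZr; lra.
Qed.

(** As a function of (b, t) over x', the pairing t.x - be.b is the covector with second side x and
    core coordinate -be. *)
Lemma involution_of_metricE m x x' be : U m ->
  involution_of_metric g (dpsiE' m x x' be) = dpsiE' m x' x (- be).
Proof.
move=> Um; have p2 : dual_proj2 (dpsiE' m x x' be) = tpsi tQ (m, x').
  exact: (dual_proj2E (dvb_A H) (dvb_1 H) h).
have c : cobase (involution_of_metric g (dpsiE' m x x' be)) = tpsi tQ (m, x').
  by rewrite cobase_mk.
apply: (dual_psi_ext h Um c); first exact: dpsi_cobase.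
move=> b t; rewrite mkcovectorE.
- by rewrite dual_pairing_adapted // (dpsiE (dvb_1 H) h) // (dotC t) addrC dotNl.
- exact: (vb_fibres (dvb_1 H)).
- by rewrite /= p2; exact: pairing_linear_over.
- by rewrite /= p2 (dt_p1 h).
Qed.

Lemma dual_inv_adapted :
  @inv_adapted R M Q B (dual_dvb E) (involution_of_metric g) U tQ tB dpsiE' (dzeta psi).
Proof.
split; first exact: (dual_dtriv (dvb_A H) (dvb_B H) (dvb_A H) (dvb_1 H) h (vb_total (dvb_1 H))).
by move=> m x x' be Um; exact: involution_of_metricE.
Qed.

End FromMetric.

Lemma metric_of_involution_dvb (D : predvb Q Q B) (I : D -> D) :
  involutive_dvb I -> metric_dvb (metric_of_involution I).
Proof.
move=> HI; have H := proj1 HI; apply: adapted_metric_dvb; first exact: dual_is_dvb.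
move=> m; have [U [tQ [tB [psi [zeta [Um a]]]]]] := inv_adapted_exists m HI.
exists U, tQ, tB, (dpsi zeta), (dzeta psi); split => //.
exact: dual_metric_adapted.
Qed.

Lemma involution_of_metric_dvb (E : predvb Q B Q) (g : E -> E -> R) :
  metric_dvb g -> involutive_dvb (involution_of_metric g).
Proof.
move=> HG; have H := proj1 HG; apply: adapted_involution; first exact: dual_is_dvb.
move=> m; have [U [tQ [tB [psi [zeta [Um a]]]]]] := metric_adapted_exists m HG.
exists U, tQ, tB, (dpsi zeta), (dzeta psi); split => //.
exact: dual_inv_adapted.
Qed.

End DualAdapted.

(** * The correspondence between involutive and metric double vector bundles *)

Theorem proposition3p15 (R : realType) (M : premfd R) (Q B : prevb M) :
  (* (1) *)
  (forall (D : predvb Q Q B) (I : D -> D), involutive_dvb I ->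
    let E := dual_dvb D in
    let g := metric_of_involution I in
    (forall e1 e2 : E, vproj (dstr2 E) e1 = vproj (dstr2 E) e2 ->
      (exists d : D, vproj (dstr1 E) e1 = vproj (dstr1 D) d /\
                     vproj (dstr1 E) e2 = vproj (dstr2 D) d) /\
      (forall d : D, vproj (dstr1 E) e1 = vproj (dstr1 D) d ->
                     vproj (dstr1 E) e2 = vproj (dstr2 D) d ->
         g e1 e2 = coform e1 d + coform e2 (I d))) /\
    metric_dvb g) /\
  (* (2) *)
  (forall (E : predvb Q B Q) (g : E -> E -> R), metric_dvb g ->
    let D := dual_dvb E in
    let I := involution_of_metric g in
    (forall (d : D) (e : E), vproj (dstr2 D) d = vproj (dstr1 E) e ->
      coform (I d) e = @dual_pairing R M B Q Q (flip E) (metric_beta g e) d /\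
      (exists x : E, vproj (dstr2 E) x = vproj (dstr2 E) e /\
                     vproj (dstr1 E) x = vproj (dstr1 D) d) /\
      (forall x : E, vproj (dstr2 E) x = vproj (dstr2 E) e ->
                     vproj (dstr1 E) x = vproj (dstr1 D) d ->
         coform (I d) e = g e x - coform d x)) /\
    involutive_dvb I) /\
  (* (3), under the canonical isomorphism with the double dual over Q *)
  (forall (D : predvb Q Q B) (I : D -> D), involutive_dvb I ->
    let D' := dual_dvb (dual_dvb D) in
    let I' := involution_of_metric (metric_of_involution I) in
    @is_dvb_iso R M Q Q B D D' (ev (dstr1 D)) /\
    forall d : D, ev (dstr1 D) (I d) = I' (ev (dstr1 D) d)) /\
  (forall (E : predvb Q B Q) (g : E -> E -> R), metric_dvb g ->
    let E' := dual_dvb (dual_dvb E) in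
    let g' := metric_of_involution (involution_of_metric g) in
    @is_dvb_iso R M Q B Q E E' (ev (dstr1 E)) /\
    forall e1 e2 : E, vproj (dstr2 E) e1 = vproj (dstr2 E) e2 ->
      g' (ev (dstr1 E) e1) (ev (dstr1 E) e2) = g e1 e2).
Proof.
split; [|split; [|split]].
- move=> D I HI E g; split; last exact: metric_of_involution_dvb.
  have H := proj1 HI; move=> e1 e2.
  have [U [tQ [tB [psi [zeta [Um ha]]]]]] := inv_adapted_exists (vproj Q (cobase e1)) HI.
  have h := proj1 ha.
  have hd := dual_dtriv (dvb_A H) (dvb_A H) (dvb_K H) (dvb_1 H) h (vb_total (dvb_1 H)).
  have [x [b [t E1]]] := dual_elem (dvb_1 H) h Um erefl.
  rewrite {1}E1 (dt_p2 hd) // => /esym /(dt_elem1 (dtriv_flip hd) Um)[x' [t' /= E2]].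
  move: (vproj Q _) Um E1 E2 => m Um -> ->; rewrite !dpsi_cobase; split.
    (* Any two sides over the same m are realized in the decomposition, here with core part 0. *)
    by exists (psi m x x' 0); rewrite (dt_p1 h) // (dt_p2 h).
  move=> d d1 d2; rewrite (involution_sum H ha) //.
  exact: (metric_of_involutionE H ha).
- move=> E g HG D I; split; last exact: involution_of_metric_dvb.
  have H := proj1 HG; move=> d e.
  have [U [tQ [tB [psi [zeta [Um ha]]]]]] := metric_adapted_exists (vproj Q (cobase d)) HG.
  have h := proj1 ha.
  have hd := dual_dtriv (dvb_A H) (dvb_B H) (dvb_A H) (dvb_1 H) h (vb_total (dvb_1 H)).
  have [x [x' [be ed]]] := dual_elem (dvb_1 H) h Um erefl.
  rewrite {1}ed (dt_p2 hd) // => /esym /(dt_elem1 h Um)[b [t ee]].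
  move: (vproj Q _) Um ed ee => m Um -> ->.
  have IE : coform (I (dpsi zeta m x x' be)) (psi m x' b t) = dot t x - dot be b.
    rewrite /I (involution_of_metricE HG ha) // (dpsiE (dvb_1 H) h) //.
    by rewrite (dotC x) addrC dotNl.
  split; first by rewrite IE (dual_pairing_adapted HG ha).
  rewrite (dt_p2 h) // [vproj (dstr1 D) _](dt_p1 hd) //; split.
    by exists (psi m x b 0); rewrite (dt_p1 h) // (dt_p2 h).
  by move=> y y2 y1; rewrite IE; apply/esym; exact: (metric_difference HG ha).
- move=> D I HI D' I'; have H := proj1 HI; split; first exact: ev_iso.
  have HG := metric_of_involution_dvb HI.
  move=> d; have [U [tQ [tB [psi [zeta [Um ha]]]]]] :=
    inv_adapted_exists (vproj Q (vproj (dstr1 D) d)) HI.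
  have h := proj1 ha; have ha' := dual_metric_adapted H ha.
  have [x [y [z ed]]] := dt_surj h Um erefl.
  move: (vproj Q _) Um ed => m Um ->.
  (* Evaluation keeps the coordinates, and both involutions are (x, y, z) -> (y, x, -z) in them, the
     second because the dual decomposition is adapted to the metric. *)
  rewrite (proj2 ha) // !(ev_psi _ _ _ H h Um).
  by rewrite /I' (involution_of_metricE HG ha').
- move=> E g HG E' g'; have H := proj1 HG; split; first exact: ev_iso.
  have HI := involution_of_metric_dvb HG; have HD := proj1 HI.
  move=> e1 e2; have [U [tQ [tB [psi [zeta [Um ha]]]]]] :=
    metric_adapted_exists (vproj Q (vproj (dstr1 E) e1)) HG.
  have h := proj1 ha; have ha' := dual_inv_adapted HG ha.
  have [x [b [t E1]]] := dt_surj h Um erefl.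
  rewrite {1}E1 (dt_p2 h) // => /esym /(dt_elem1 (dtriv_flip h) Um)[x' [t' /= E2]].
  move: (vproj Q _) Um E1 E2 => m Um -> ->.
  (* Likewise both metrics are t.x' + t'.x in the coordinates that evaluation preserves. *)
  rewrite (proj2 ha) // !(ev_psi _ _ _ H h Um).
  exact: (metric_of_involutionE HD ha').
Qed.
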